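(* Let $\rho>1$ and let $\mu_\rho$ denote the Boltzmann measure with parameter $\rho$. There exists a constant $c=c(\rho)>0$ such that for all $n\ge 1$ and for any transitive Borel-measurable set $A\subset\mathbb{R}^n$, $$\liminf_{r\downarrow 0}\frac{\mu_\rho^{\otimes n}(A+[-r,r]^n)-\mu_\rho^{\otimes n}(A)}{r}\ge c\,t(1-t)(\log n)^{1-1/\rho},$$ where $t=\mu_\rho^{\otimes n}(A)$.
   Context: The Boltzmann measure $\mu_\rho$ with parameter $\rho\ge 1$ is the probability measure on $\mathbb{R}$ with density $\phi_\rho(x)=\frac{1}{2\Gamma(1+1/\rho)}e^{-|x|^\rho}$. A set $A\subseteq\mathbb{R}^n$ is transitive if its characteristic function is invariant under the action (by permuting the $n$ coordinates) of some subgroup of the symmetric group $S_n$ that acts transitively on $\{1,\dots,n\}$. $A+[-r,r]^n$ is the Minkowski sum. *)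

(* Defs.v *)
From HB Require Import structures.
From mathcomp Require Import all_boot all_order all_algebra all_fingroup.
From mathcomp Require Import all_classical all_reals all_analysis.
From mathcomp Require Import measurable_realfun.
From mathcomp Require Import ring lra.

Set Implicit Arguments.
Unset Strict Implicit.
Unset Printing Implicit Defensive.
Import Order.TTheory GRing.Theory Num.Theory.
Import numFieldNormedType.Exports.
Local Open Scope classical_set_scope.
Local Open Scope ring_scope.

(* Borel sigma-algebra: generated by the open sets of the entrywise topology. *)
Section borel_matrix.
Context {R : realType} {m n : nat}.

HB.instance Definition _ := @isMeasurable.Build
  (sigma_display (@open 'M[R]_(m, n))) 'M[R]_(m, n) <<s (@open 'M[R]_(m, n)) >>
  (@sigma_algebra0 _ setT _) (@sigma_algebraC _ _)
  (@sigma_algebra_bigcup _ setT _).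

End borel_matrix.

Lemma measurable_coord {R : realType} m n i j :
  measurable_fun [set: 'M[R]_(m, n)] (fun M : 'M[R]_(m, n) => M i j).
Proof.
apply: (measurability _ (RGenOpens.measurableE R)).
move=> _ [_ [a [b ->] <-]]; apply: sub_sigma_algebra; rewrite setTI.
by apply: open_comp => [M _|]; [exact: coord_continuous|exact: interval_open].
Qed.

Definition cons_row {R : realType} {n : nat} (p : R * 'rV[R]_n) : 'rV[R]_n.+1 :=
  row_mx (const_mx p.1 : 'rV[R]_1) p.2.

Section cons_row_theory.
Context {R : realType} {n : nat}.
Implicit Types (p : R * 'rV[R]_n).

Lemma cons_row0 p : cons_row p 0 ord0 = p.1.
Proof.
rewrite (_ : ord0 = lshift n (ord0 : 'I_1)); last exact: val_inj.
by rewrite /cons_row (@row_mxEl _ 1 1 n) mxE.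
Qed.

Lemma cons_rowS p (i : 'I_n) : cons_row p 0 (lift ord0 i) = p.2 0 i.
Proof.
rewrite (_ : lift ord0 i = rshift 1 i); last exact: val_inj.
by rewrite /cons_row (@row_mxEr _ 1 1 n).
Qed.

Lemma measurable_box (B : 'I_n -> set R) : (forall i, measurable (B i)) ->
  measurable [set x : 'rV[R]_n | forall i, B i (x 0 i)].
Proof.
move=> mB; rewrite (_ : [set _ | _] =
    \bigcap_(i in [set: 'I_n]) ((fun x : 'rV[R]_n => x 0 i) @^-1` B i)); last first.
  by apply/seteqP; split=> [x xB i _|x xB i]; exact: xB.
apply: fin_bigcap_measurable => // i _; rewrite -[X in measurable X]setTI.
exact: measurable_coord.
Qed.

Lemma open_ratr_balls (U : set 'rV[R]_n.+1) : open U ->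
  let b (qk : 'rV[rat]_n.+1 * nat) : set 'rV[R]_n.+1 :=
    [set x | forall i, ball (ratr (qk.1 0 i) : R) qk.2.+1%:R^-1 (x 0 i)] in
  U = \bigcup_(qk in [set qk | b qk `<=` U]) b qk.
Proof.
move=> oU b; apply/seteqP; split=> [x Ux|x [qk + xb]]; last exact.
have /nbhs_ballP[e /= e0 eU] : nbhs x U by exact: open_nbhs_nbhs.
have [k ke] : exists k : nat, k.+1%:R^-1 < e / 2.
  have e20 : 0 < e / 2 by rewrite divr_gt0.
  have /cvgrPdist_lt/(_ _ e20) : (@harmonic R) @ \oo --> 0 by exact: cvg_harmonic.
  case=> k _ /(_ k (leqnn k)); rewrite /= sub0r normrN ger0_norm ?invr_ge0//.
  by exists k.
have k0 : 0 < k.+1%:R^-1 :> R by rewrite invr_gt0.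
have /choice[q qP] (i : 'I_n.+1) :
    exists q : rat, ball (ratr q : R) k.+1%:R^-1 (x 0 i).
  have [q] : exists q : rat, ratr q \in `]x 0 i, x 0 i + k.+1%:R^-1[.
    by apply: rat_in_itvoo; rewrite ltrDl.
  rewrite in_itv/= => /andP[xq qx]; exists q.
  by rewrite /ball/= gtr0_norm ?subr_gt0// ltrBlDl.
exists (\row_i q i, k) => /=; last by move=> i; rewrite mxE.
move=> y by_; apply: eU; split => // i j; rewrite (ord1 i).
rewrite (splitr e); apply: (@ball_triangle _ _ (ratr (q j) : R)).
  by apply: ball_sym; apply: le_ball (qP j); exact: ltW.
by have := by_ j; rewrite mxE; apply: le_ball; exact: ltW.
Qed.

Lemma measurable_cons_row : measurable_fun setT (@cons_row R n).
Proof.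
apply: (@measurability _ _ _ _ _ _ (@open 'rV[R]_n.+1)) => //.
move=> _ [U oU <-]; rewrite setTI (open_ratr_balls oU) preimage_bigcup.
rewrite [X in measurable X](bigcup_mkcond).
apply: countable_bigcupT_measurable => [|qk]; first exact: countableP.
case: ifPn => // _.
rewrite (_ : _ @^-1` _ = ball (ratr (qk.1 0 ord0) : R) qk.2.+1%:R^-1 `*`
  [set x : 'rV[R]_n | forall i : 'I_n,
    ball (ratr (qk.1 0 (lift ord0 i)) : R) qk.2.+1%:R^-1 (x 0 i)]).
  have mb (a e : R) : measurable (ball a e).
    by apply: open_measurable; exact: ball_open.
  apply: measurableX; first exact: mb.
  exact: (measurable_box (fun=> mb _ _)).
apply/seteqP; split=> [p /= pb|p [/= p1 p2] i].
  split=> [|i /=]; first by have := pb ord0; rewrite cons_row0.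
  by have := pb (lift ord0 i); rewrite cons_rowS.
by case: (unliftP ord0 i) => [j|] ->; rewrite ?cons_row0 ?cons_rowS.
Qed.

HB.instance Definition _ :=
  isMeasurableFun.Build _ _ _ _ (@cons_row R n) measurable_cons_row.

End cons_row_theory.

Local Open Scope ereal_scope.

(* The n-fold product measure on R^n; power_prob_box is its characterization. *)
Fixpoint power_prob {R : realType} (P : probability R R) (n : nat) :
    probability 'rV[R]_n R :=
  if n isn't k.+1 then dirac (0%R : 'rV[R]_0)
  else distribution (P \x power_prob P k) (@cons_row R k).

Lemma power_prob_box {R : realType} (P : probability R R) n
    (B : 'I_n -> set R) : (forall i, measurable (B i)) ->
  power_prob P n [set x | forall i, B i (x 0%R i)] = \prod_(i < n) P (B i).
Proof.
elim: n B => [|n IH] B mB.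
  rewrite big_ord0 /= diracE mem_set//.
  by case.
rewrite big_ord_recl -(IH (fun i => B (lift ord0 i)))//.
rewrite -(product_measure1E P (power_prob P n))//; last first.
  exact: (measurable_box (fun=> mB _)).
rewrite /= /distribution /pushforward; congr (product_measure1 _ _ _).
apply/seteqP; split=> [p /= pb|p [/= p1 p2] i].
  split=> [|i /=]; first by have := pb ord0; rewrite cons_row0.
  by have := pb (lift ord0 i); rewrite cons_rowS.
by case: (unliftP ord0 i) => [j|] ->; rewrite ?cons_row0 ?cons_rowS.
Qed.

Local Close Scope ereal_scope.

Section boltzmann.
Context {R : realType}.
Notation leb := (@lebesgue_measure R).

Definition euler_gamma (s : R) : R :=
  \int[leb]_(x in `]0, +oo[) (x `^ (s - 1) * expR (- x)).

Definition boltzmann_pdf (rho x : R) : R :=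
  (2 * euler_gamma (1 + rho^-1))^-1 * expR (- (`|x| `^ rho)).

Lemma integral_expRN_itvcy (a : R) :
  (\int[leb]_(x in `[a, +oo[) (expR (- x))%:E = (expR (- a))%:E)%E.
Proof.
have dF (x : R) : is_derive x 1 (fun x => - expR (- x)) (expR (- x)).
  by apply: is_derive_eq; rewrite mulrN1 opprK.
have cE : continuous (fun x : R => expR (- x)).
  move=> x; apply: continuous_comp; last exact: continuous_expR.
  exact: oppr_continuous.
rewrite (@ge0_continuous_FTC2y _ _ (fun x => - expR (- x)) _ 0).
- by rewrite EFinN oppeK add0e.
- by move=> x _; exact: expR_ge0.
- exact: continuous_subspaceT.
- by rewrite -oppr0; apply: cvgN; exact: cvgr_expR.
- by move=> x _; exact: ex_derive.
- by apply: cvgN; apply/cvg_at_right_filter; exact: cE.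
- by move=> x _; rewrite derive1E; exact: derive_val.
Qed.


Let gint (a t : R) := t `^ a * expR (- t).

Let gint_ge0 a t : 0 <= gint a t.
Proof. by rewrite mulr_ge0 ?powR_ge0 ?expR_ge0. Qed.

Let measurable_expRN : measurable_fun [set: R] (fun t : R => expR (- t)).
Proof. by apply: measurableT_comp => //; exact: measurableT_comp. Qed.

Let measurable_gint a : measurable_fun [set: R] (gint a).
Proof. by apply: measurable_funM => //; exact: measurable_powR. Qed.

Let gint_lty a : 0 <= a <= 1 ->
  (\int[leb]_(t in `]0%R, +oo[) (gint a t)%:E < +oo)%E.
Proof.
move=> /andP[a0 a1].
have := @integral_exponential_pdf R 2^-1 ltac:(by rewrite invr_gt0).
set J := (\int[_]_x _)%E => J1.
have mexp : measurable_fun [set: R] (EFin \o exponential_pdf (2^-1 : R)).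
  by apply/measurable_EFinP; exact: measurable_exponential_pdf.
apply: (@le_lt_trans _ _ (4%:E * J)%E); last by rewrite J1 mule1 ltry.
rewrite -ge0_integralZl//; last first.
  by move=> x _; rewrite lee_fin exponential_pdf_ge0// invr_ge0.
apply: (@le_trans _ _
    (\int[leb]_(t in `]0%R, +oo[) (4%:E * (exponential_pdf 2^-1 t)%:E))%E).
  apply: ge0_le_integral => //.
  - by move=> x _; rewrite lee_fin gint_ge0.
  - by apply/measurable_EFinP/measurable_funTS; exact: measurable_gint.
  - by apply: measurable_funeM; exact: measurable_funTS.
  move=> t; rewrite /= in_itv/= andbT => t0; rewrite -EFinM lee_fin.
  rewrite exponential_pdfE ?(ltW t0)// mulrA.
  have -> : (4 * 2^-1 : R) = 2 by field.
  have -> : gint a t = t `^ a * expR (- 2^-1 * t) * expR (- 2^-1 * t).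
    by rewrite -mulrA -expRD /gint; congr (_ * expR _); field.
  rewrite ler_wpM2r ?expR_ge0//.
  apply: (@le_trans _ _ ((1 + t) * expR (- 2^-1 * t))).
    rewrite ler_wpM2r ?expR_ge0//.
    have [t1|t1] := leP t 1.
      apply: (@le_trans _ _ 1); last by rewrite lerDl ltW.
      have := @ge0_ler_powR R a a0 t 1; rewrite powR1 !nnegrE.
      by apply => //; exact: ltW.
    apply: (@le_trans _ _ t); last by rewrite lerDr.
    by apply: ler1_powR => //; exact: ltW.
  rewrite mulNr expRN ler_pdivrMr ?expR_gt0//.
  apply: (@le_trans _ _ (2 * (1 + 2^-1 * t))); first by lra.
  by rewrite ler_wpM2l// expR_ge1Dx.
apply: ge0_subset_integral => //; first exact: measurable_funeM.
by move=> x _; rewrite mule_ge0 ?lee_fin// exponential_pdf_ge0// invr_ge0.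
Qed.

Let gint_gt0 a : 0 <= a ->
  (0 < \int[leb]_(t in `]0%R, +oo[) (gint a t)%:E)%E.
Proof.
move=> a0.
apply: (@lt_le_trans _ _ (\int[leb]_(x in `[1%R, +oo[) (expR (- x))%:E)%E).
  by rewrite integral_expRN_itvcy lte_fin expR_gt0.
apply: (@le_trans _ _ (\int[leb]_(x in `[1%R, +oo[) (gint a x)%:E)%E).
  apply: ge0_le_integral => //.
  - by apply/measurable_EFinP/measurable_funTS; exact: measurable_expRN.
  - by apply/measurable_EFinP/measurable_funTS; exact: measurable_gint.
  move=> x; rewrite /= in_itv/= andbT => x1; rewrite lee_fin /gint.
  rewrite ler_peMl ?expR_ge0// -(powRr0 x).
  exact: ler_powR.
apply: ge0_subset_integral => //.
- by apply/measurable_EFinP/measurable_funTS; exact: measurable_gint.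
- by move=> x _; rewrite lee_fin gint_ge0.
- by move=> x /=; rewrite !in_itv/= !andbT; exact: lt_le_trans.
Qed.

Let integral_expR_powR (rho : R) : 0 < rho ->
  (\int[leb]_x (expR (- (`|x| `^ rho)))%:E =
   2%:E * \int[leb]_(t in `]0%R, +oo[) (gint rho^-1 t)%:E)%E.
Proof.
move=> rho0; have rhon0 : rho != 0 by rewrite gt_eqF.
pose E : set (R * R) := [set p | `|p.1| `^ rho <= p.2].
have inEE x t : ((x, t) \in E) = (`|x| `^ rho <= t).
  by apply/idP/idP; rewrite inE.
pose f (p : R * R) := (\1_E p * expR (- p.2))%:E.
have mE : measurable E.
  have mb : measurable_fun [set: R * R] (fun p => `|p.1| `^ rho <= p.2).
    apply: measurable_fun_ler => //.
    apply: (measurableT_comp (measurable_powR rho)).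
    exact: measurableT_comp.
  have := mb measurableT [set true] I; rewrite setTI.
  by congr measurable; apply/seteqP; split.
have mf : measurable_fun setT f.
  apply/measurable_EFinP/measurable_funM; first exact: measurable_indic.
  exact: (measurableT_comp measurable_expRN).
have f0 p : (0 <= f p)%E by rewrite lee_fin mulr_ge0 ?expR_ge0.
have := @fubini_tonelli _ _ _ _ R leb leb f mf f0.
rewrite (_ : (\int[leb]_x \int[leb]_y f (x, y))%E =
  (\int[leb]_x (expR (- (`|x| `^ rho)))%:E)%E); last first.
  apply: eq_integral => x _.
  rewrite -integral_expRN_itvcy [RHS]integral_mkcond.
  apply: eq_integral => t _.
  rewrite /f/= patchE indicE inEE mem_setE/= in_itv/= andbT.
  by case: ifPn => _; rewrite ?mul1r ?mul0r.
move=> ->.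
rewrite -ge0_integralZl//; last 2 first.
- by apply/measurable_EFinP/measurable_funTS; exact: measurable_gint.
- by move=> x _; rewrite lee_fin gint_ge0.
rewrite [RHS]integral_mkcond.
apply: eq_integral => t _.
rewrite patchE mem_setE/= in_itv/= andbT.
have [t0|t0] := ltP t 0.
  rewrite ltNge (ltW t0)/= integral0_eq// => x _.
  rewrite /f indicE inEE leNgt (lt_le_trans t0) ?powR_ge0//.
  by rewrite mul0r.
transitivity (2%:E * (gint rho^-1 t)%:E)%E; last first.
  case: ifPn => //; rewrite -leNgt => t0'.
  have -> : t = 0 by apply/eqP; rewrite eq_le t0 t0'.
  by rewrite /gint powR0 ?mul0r ?mule0// gt_eqF// invr_gt0.
have Et x : f (x, t) =
    ((expR (- t))%:E * (\1_(`[- (t `^ rho^-1), t `^ rho^-1]%classic) x)%:E)%E.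
  rewrite /f -EFinM mulrC !indicE; congr (_ * (_ : bool)%:R)%:E.
  rewrite inEE mem_setE/= in_itv/= -ler_norml; apply/idP/idP => h.
    rewrite -[leLHS]powRr1// -(divff rhon0) powRrM.
    by rewrite ge0_ler_powR ?nnegrE ?powR_ge0// invr_ge0 ltW.
  rewrite -[leRHS]powRr1// -(mulVf rhon0) powRrM.
  by rewrite ge0_ler_powR ?nnegrE ?powR_ge0// ltW.
under eq_integral do rewrite Et.
rewrite ge0_integralZl//; last first.
  by apply/measurable_EFinP; exact: measurable_indic.
have lebI (a : R) : 0 <= a -> leb `[- a, a]%classic = (2 * a)%:E.
  move=> a0; rewrite lebesgue_measure_itv/= lte_fin.
  case: ifPn => [_|]; first by rewrite -EFinD; congr EFin; ring.
  by rewrite -leNgt => h; congr EFin; lra.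
rewrite integral_indic// setIT; have := lebI _ (powR_ge0 t rho^-1); rewrite /= => ->.
by rewrite -!EFinM /gint; congr EFin; ring.
Qed.

Let euler_gammaE (rho : R) : 1 <= rho ->
  (\int[leb]_(t in `]0%R, +oo[) (gint rho^-1 t)%:E =
   (euler_gamma (1 + rho^-1))%:E)%E.
Proof.
move=> rho1.
have rho01 : 0 <= rho^-1 <= 1.
  by rewrite invr_ge0 invf_le1 ?rho1 ?(le_trans _ rho1) ?(lt_le_trans _ rho1).
rewrite /euler_gamma addrAC subrr add0r /Rintegral fineK//.
rewrite ge0_fin_numE ?gint_lty//.
by apply: integral_ge0 => x _; rewrite lee_fin gint_ge0.
Qed.

Lemma euler_gamma_gt0 (rho : R) : 1 <= rho -> 0 < euler_gamma (1 + rho^-1).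
Proof.
move=> rho1; rewrite -lte_fin -euler_gammaE// gint_gt0// invr_ge0.
exact: le_trans rho1.
Qed.

Lemma boltzmann_pdf_ge0 (rho x : R) : 1 <= rho -> 0 <= boltzmann_pdf rho x.
Proof.
move=> rho1; rewrite mulr_ge0 ?expR_ge0// invr_ge0 mulr_ge0//.
exact/ltW/euler_gamma_gt0.
Qed.

Let measurable_expR_powR (rho : R) :
  measurable_fun [set: R] (fun x : R => expR (- (`|x| `^ rho))).
Proof.
apply: (measurableT_comp measurable_expRN).
apply: (measurableT_comp (measurable_powR rho)).
exact: (@normr_measurable R setT).
Qed.

Lemma measurable_boltzmann_pdf (rho : R) :
  measurable_fun [set: R] (boltzmann_pdf rho).
Proof. by apply: measurable_funM => //; exact: measurable_expR_powR. Qed.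

Lemma integral_boltzmann_pdf (rho : R) : 1 <= rho ->
  (\int[leb]_x (boltzmann_pdf rho x)%:E = 1)%E.
Proof.
move=> rho1; have rho0 : 0 < rho by exact: lt_le_trans rho1.
have G0 := euler_gamma_gt0 rho1.
under eq_integral do rewrite EFinM.
rewrite ge0_integralZl//; last 2 first.
- by apply/measurable_EFinP; exact: measurable_expR_powR.
- by rewrite lee_fin invr_ge0 mulr_ge0// ltW.
rewrite integral_expR_powR// euler_gammaE// -!EFinM mulVf//.
by rewrite mulf_neq0// gt_eqF.
Qed.

(* The proof argument is what makes the density integrate to 1; it lets
   [boltzmann] carry a canonical probability structure. *)
Definition boltzmann (rho : R) (rho1 : 1 <= rho) : set R -> \bar R :=
  fun V => (\int[leb]_(x in V) (boltzmann_pdf rho x)%:E)%E.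

Variables (rho : R) (rho1 : 1 <= rho).
Local Notation bz := (boltzmann rho1).

Let boltzmann0 : bz set0 = 0%E.
Proof. by rewrite /boltzmann integral_set0. Qed.

Let boltzmann_ge0 A : (0 <= bz A)%E.
Proof. by apply: integral_ge0 => x _; rewrite lee_fin boltzmann_pdf_ge0. Qed.

Let boltzmann_sigma_additive : semi_sigma_additive bz.
Proof.
move=> /= F mF tF mUF; rewrite /boltzmann; apply: cvg_toP.
  apply: ereal_nondecreasing_is_cvgn => m n mn.
  apply: lee_sum_nneg_natr => // k _ _; apply: integral_ge0 => /= x Fkx.
  by rewrite lee_fin boltzmann_pdf_ge0.
rewrite ge0_integral_bigcup//=.
- by apply/measurable_EFinP/measurable_funTS; exact: measurable_boltzmann_pdf.
- by move=> x _; rewrite lee_fin boltzmann_pdf_ge0.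
Qed.

HB.instance Definition _ := isMeasure.Build _ _ _
  bz boltzmann0 boltzmann_ge0 boltzmann_sigma_additive.

Let boltzmann_setT : bz [set: R] = 1%E.
Proof. exact: integral_boltzmann_pdf. Qed.

HB.instance Definition _ :=
  @Measure_isProbability.Build _ _ R bz boltzmann_setT.

End boltzmann.

(* For a Borel set A, minkowski_sum A (cube r) may fail to be Borel because the
   cube is closed. It differs from the open set obtained with the open cube by
   a subset of the boundary of a union of cubes of the same size, which is
   Lebesgue negligible, so it is measurable for the completion of a measure
   with a density. The completion is computed by the outer measure mu^*, which
   agrees with mu on Borel sets (measurable_mu_extE). *)
Definition minkowski_sum {V : zmodType} (A B : set V) : set V :=
  [set a + b | a in A & b in B].

Definition cube {R : realType} (n : nat) (r : R) : set 'rV[R]_n :=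
  [set x | forall i, x 0 i \in `[- r, r]].

Definition transitive_set {R : realType} (n : nat) (A : set 'rV[R]_n) : Prop :=
  exists2 G : {group 'S_n}, [transitive G, on [set: 'I_n]%SET | 'P] &
    forall s, s \in G -> forall x, \1_A (col_perm s x) = \1_A x :> R.

(* Main.v *)
(* Split R into 2^m cells of equal probability, m ~ log2 n, indexed by the first
   m binary digits of the distribution function, so that R^n is encoded by n
   blocks of m fair bits.  For B in R and digit j, consider the probability that
   resampling a point within the cell obtained by flipping digit j leaves B.
   Every path from B to the complement of its r-neighbourhood spends a length at
   least r outside B but within that neighbourhood, which bounds r times this
   probability by the integral, over the neighbourhood minus B, of
   min(F, 1 - F, 2^-j), up to constants and lower-order terms.  The tail estimate
   1 - F(z) <= phi(z) / z^(rho - 1) bounds the sum over j < m of these minima by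
   C m^(1/rho) phi, and min(F, 1 - F, 2^-m) by C m^(1/rho - 1) phi.

   Enlarging A one coordinate at a time thus bounds both the total influence of
   the n m bits, by C m^(1/rho) times the boundary measure, and the L1 distance
   from A to its average over the cells, by C m^(1/rho - 1) times the boundary
   measure.  When A is transitive no bit has more than 1/n of the total
   influence S, and the inequality of Kahn, Kalai and Linial gives a variance at
   most C S / m.  Both contributions to t (1 - t) are therefore at most
   C m^(1/rho - 1) times the boundary measure. *)
From mathcomp Require Import all_boot all_order all_algebra.
From mathcomp Require Import ring lra zify.

Set Implicit Arguments.
Unset Strict Implicit.
Unset Printing Implicit Defensive.
Import Order.TTheory GRing.Theory Num.Theory.
Local Open Scope ring_scope.

(** * Influences on the discrete cube *)

Section walsh.
Context {R : realFieldType} {I : finType}.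
Local Notation cube := {ffun I -> bool}.
Implicit Types (f g h : cube -> R) (x y : cube) (S U : {set I}) (i : I).

(** No boundary measure is ever defined. Everything is proved at a fixed [r], as a bound of
    [r * (t * (1 - t))] by a multiple of the measure gained by an enlargement of [A], and the lower
    limit is read off at the end. The price is that each coordinate step starts from a set that is
    already enlarged, whereas the cube inequality needs the fluxes of [A] itself. Exchanging one for
    the other costs at most the total measure gained, at every coordinate; this loss carries a
    factor [r], so it is absorbed once [n * r] is small. The threshold on [r] may depend on [n],
    since [r] tends to 0 first.

    [A] is not a function of the bits. The cube inequality is therefore stated for functions into
    [[0, 1]], with influences in L1, and applied to the conditional probability [f] of [A] in each
    cell. As [f] has mean [t], what its variance misses is [t - E (f ^ 2) = E (f * (1 - f))], the
    probability that resampling within the cell leaves [A]. The influences of [f] and this loss are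
    both controlled by one quantity, the flux, taken for a digit flip and for the identity. *)

Definition cmean f : R := (2 ^+ #|I|)^-1 * \sum_x f x.

Definition walsh S x : R := \prod_(i in S) (-1) ^+ x i.

Definition flip i x : cube := [ffun j => x j (+) (j == i)].

Lemma flipK i : involutive (flip i).
Proof. by move=> x; apply/ffunP => j; rewrite !ffunE -addbA addbb addbF. Qed.

Lemma cube_gt0 : 0 < 2 ^+ #|I| :> R.
Proof. exact: exprn_gt0. Qed.

Lemma cmean_flip f i : cmean (fun x => f (flip i x)) = cmean f.
Proof.
congr (_ * _); rewrite [RHS](reindex_inj (h := flip i)) //.
exact: inv_inj (flipK i).
Qed.

Lemma eq_cmean f g : f =1 g -> cmean f = cmean g.
Proof. by move=> fg; congr (_ * _); apply: eq_bigr => x _. Qed.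

Lemma cmeanD f g : cmean (fun x => f x + g x) = cmean f + cmean g.
Proof. by rewrite /cmean big_split mulrDr. Qed.

Lemma cmeanZ (a : R) f : cmean (fun x => a * f x) = a * cmean f.
Proof. by rewrite /cmean -mulr_sumr mulrCA. Qed.

Lemma cmeanN f : cmean (fun x => - f x) = - cmean f.
Proof. by rewrite /cmean sumrN mulrN. Qed.

Lemma cmean_sum (J : Type) (r : seq J) (P : pred J) (F : J -> cube -> R) :
  cmean (fun x => \sum_(j <- r | P j) F j x) = \sum_(j <- r | P j) cmean (F j).
Proof. by rewrite /cmean exchange_big mulr_sumr. Qed.

Lemma ler_cmean f g : (forall x, f x <= g x) -> cmean f <= cmean g.
Proof.
by move=> fg; rewrite ler_wpM2l ?invr_ge0 ?(ltW cube_gt0)// ler_sum.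
Qed.

Lemma cmean_ge0 f : (forall x, 0 <= f x) -> 0 <= cmean f.
Proof.
by move=> f0; rewrite mulr_ge0 ?invr_ge0 ?(ltW cube_gt0)// sumr_ge0.
Qed.

Lemma cmean_eq0_odd f i : (forall x, f (flip i x) = - f x) -> cmean f = 0.
Proof.
move=> fN; have : cmean f = - cmean f.
  by rewrite -cmeanN -(cmean_flip f i); exact: eq_cmean.
lra.
Qed.

Lemma cauchy_schwarz_cmean (p f g : cube -> R) : (forall x, 0 <= p x) ->
  cmean (fun x => p x * (f x * g x)) ^+ 2 <=
  cmean (fun x => p x * f x ^+ 2) * cmean (fun x => p x * g x ^+ 2).
Proof.
move=> p0; set a := cmean (fun x => p x * f x ^+ 2).
set b := cmean (fun x => p x * (f x * g x)).
set c := cmean (fun x => p x * g x ^+ 2).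
have sq0 (h : cube -> R) : 0 <= cmean (fun x => p x * h x ^+ 2).
  by apply: cmean_ge0 => x; rewrite mulr_ge0 ?sqr_ge0.
have Q (s t : R) : 0 <= s ^+ 2 * a - 2 * s * t * b + t ^+ 2 * c.
  have := sq0 (fun x => s * f x - t * g x).
  rewrite (@eq_cmean _ (fun x => s ^+ 2 * (p x * f x ^+ 2) +
     (- 2 * s * t * (p x * (f x * g x)) + t ^+ 2 * (p x * g x ^+ 2))));
    last by move=> x; ring.
  by rewrite !cmeanD !cmeanZ -/a -/b -/c; lra.
have a0 : 0 <= a by exact: sq0.
have c0 : 0 <= c by exact: sq0.
have [a00|an0] := eqVneq a 0.
  (* At [(c + 1, b)] the form is [- (c + 2) * b ^+ 2], which forces [b = 0]. *)
  by have := Q (c + 1) b; rewrite a00; nra.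
have agt0 : 0 < a by rewrite lt_neqAle eq_sym an0.
by have := Q b a; nra.
Qed.

Lemma walsh_flip S i x : walsh S (flip i x) = (-1) ^+ (i \in S) * walsh S x.
Proof.
have [iS|iS] := boolP (i \in S); last first.
  rewrite mul1r; apply: eq_bigr => j jS; rewrite ffunE.
  by case: eqP => [ji|_]; [rewrite -ji jS in iS|rewrite addbF].
rewrite /walsh (bigD1 i)//= [in RHS](bigD1 i)//= ffunE eqxx mulrA.
congr (_ * _); first by case: (x i); rewrite /= ?expr0 ?expr1 ?mulrNN ?mulr1.
by apply: eq_bigr => j /andP[_ /negbTE ji]; rewrite ffunE ji addbF.
Qed.

(** Expanding the product of the factors [(-1) ^+ x i * (-1) ^+ y i + 1] over subsets gives the sum;
    a coordinate where [x] and [y] differ makes its factor vanish. *)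
Lemma walsh_orthogonal x y :
  \sum_S walsh S x * walsh S y = 2 ^+ #|I| *+ (x == y).
Proof.
transitivity (\prod_i ((-1) ^+ x i * (-1) ^+ y i + 1 : R)).
  rewrite bigA_distr; apply: eq_big => [S|S _]; first by rewrite inE.
  by rewrite /walsh -big_split/= -big_mkcond.
have [->|xy] := eqVneq x y.
  rewrite mulr1n -prodr_const; apply: eq_bigr => i _.
  by case: (y i); rewrite /= ?mulrNN ?mulr1.
have /existsP[i xyi] : [exists i, x i != y i].
  by apply: contraR xy => /existsPn xy; apply/eqP/ffunP => i; have := xy i;
     rewrite negbK => /eqP.
rewrite (bigD1 i)//= (_ : _ + 1 = 0) ?mul0r//.
by move: xyi; case: (x i); case: (y i); rewrite //= ?expr0 ?expr1 ?mulr1 ?mul1r addNr.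
Qed.

Definition coef f S : R := cmean (fun x => f x * walsh S x).

Lemma walsh_inversion f x : f x = \sum_S coef f S * walsh S x.
Proof.
rewrite /coef /cmean.
under eq_bigr do rewrite -mulrA mulr_suml.
rewrite -mulr_sumr exchange_big/=.
under eq_bigr => y _.
  under eq_bigr do rewrite -mulrA.
  rewrite -mulr_sumr walsh_orthogonal mulrnAr.
  over.
rewrite (bigD1 x)//= eqxx mulr1n big1 ?addr0 => [|y /negbTE ->]; last by rewrite mulr0n.
by rewrite mulrCA mulVf ?mulr1// gt_eqF// cube_gt0.
Qed.

Lemma parseval f : cmean (fun x => f x ^+ 2) = \sum_S coef f S ^+ 2.
Proof.
transitivity (cmean (fun x => \sum_S coef f S * (f x * walsh S x))).
  apply: eq_cmean => x; rewrite expr2 {1}[f x]walsh_inversion mulr_suml.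
  by apply: eq_bigr => S _; ring.
rewrite cmean_sum; apply: eq_bigr => S _.
by rewrite cmeanZ expr2.
Qed.

Lemma coef0 f : coef f set0 = cmean f.
Proof. by apply: eq_cmean => x; rewrite /walsh big_set0 mulr1. Qed.

(** The division by 2 makes [diff i] the projection onto the characters that contain [i]. *)
Definition diff i f x : R := (f x - f (flip i x)) / 2.

Lemma coef_diff i f S : coef (diff i f) S = if i \in S then coef f S else 0.
Proof.
have E : cmean (fun x => f (flip i x) * walsh S x) = (-1) ^+ (i \in S) * coef f S.
  rewrite -(cmean_flip _ i) -cmeanZ; apply: eq_cmean => x.
  by rewrite flipK walsh_flip; ring.
rewrite /coef (@eq_cmean _ (fun x => 2^-1 * (f x * walsh S x) +
    (- 2^-1) * (f (flip i x) * walsh S x))); last first.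
  by move=> x; rewrite /diff; field.
rewrite cmeanD !cmeanZ E -/(coef f S).
by case: ifP => _; rewrite ?expr0 ?expr1; field.
Qed.

(** The coefficients are an arbitrary family [c], not those of a given function, because the
    induction on [U] in [bonami] passes from [c] to [fun S => c (i |: S)]. *)
Definition noise (c : {set I} -> R) U x : R :=
  \sum_(S : {set I} | S \subset U) 3 ^- #|S| * c S * walsh S x.

Lemma noise_flip c U i x : i \notin U -> noise c U (flip i x) = noise c U x.
Proof.
move=> iU; apply: eq_bigr => S SU; rewrite walsh_flip.
by rewrite (negbTE (contra (subsetP SU i) iU)) mul1r.
Qed.

Lemma big_subset_setU1 (F : {set I} -> R) i U : i \notin U ->
  \sum_(S : {set I} | S \subset i |: U) F S =
  \sum_(S : {set I} | S \subset U) F S +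
  \sum_(S : {set I} | S \subset U) F (i |: S).
Proof.
move=> iU; rewrite (bigID (fun S => i \in S))/= addrC; congr (_ + _).
  apply: eq_bigl => S; apply/andP/idP => [[SU iS]|SU].
    apply/fintype.subsetP => j jS; have := subsetP SU _ jS.
    by rewrite !inE => /orP[/eqP ji|//]; rewrite -ji jS in iS.
  by split; [exact: fintype.subset_trans SU (subsetUr _ _)|exact: contra (subsetP SU i) iU].
rewrite (reindex_onto (fun S => i |: S) (fun S => S :\ i))/=; last first.
  by move=> S /andP[_ iS]; rewrite setD1K.
apply: eq_bigl => S; rewrite setU11 andbT; apply/andP/idP => [[]|SU].
  move=> SU /eqP SE; rewrite -SE -(setU1K iU); exact: setSD.
split; first exact: setUS.
by rewrite setU1K// (contra (subsetP SU i) iU).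
Qed.

Lemma noise_setU1 c U i x : i \notin U ->
  noise c (i |: U) x =
  noise c U x + 3^-1 * ((-1) ^+ x i * noise (fun S => c (i |: S)) U x).
Proof.
move=> iU; rewrite {1}/noise big_subset_setU1//; congr (_ + _).
rewrite /noise !mulr_sumr; apply: eq_bigr => S SU.
have iS : i \notin S by exact: contra (subsetP SU i) iU.
by rewrite cardsU1 iS add1n /walsh (big_setU1 _ iS)/= exprSr invfM; ring.
Qed.

(* The (2,4) hypercontractive inequality, with the factors [3 ^- (|S| / 2)] of
   the noise operator moved into the coefficients to avoid square roots. *)
Lemma bonami c U : cmean (fun x => noise c U x ^+ 4) <=
  (\sum_(S : {set I} | S \subset U) 3 ^- #|S| * c S ^+ 2) ^+ 2.
Proof.
move: {2}#|U| (erefl #|U|) => k; elim: k U c => [|k IH] U c.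
  move/eqP; rewrite cards_eq0 => /eqP ->.
  rewrite (big_pred1 set0) => [|S]; last exact: subset0.
  rewrite (@eq_cmean _ (fun=> c set0 ^+ 4)) => [|x]; last first.
    rewrite /noise (big_pred1 set0) => [|S]; last exact: subset0.
    by rewrite /walsh big_set0 cards0 expr0 invr1 mul1r mulr1.
  rewrite /cmean sumr_const card_ffun card_bool cards0 expr0 invr1 mul1r.
  rewrite -(mulr_natl (c set0 ^+ 4)) natrX mulrA mulVf ?mul1r ?gt_eqF ?cube_gt0//.
  by rewrite -exprM.
move=> cU; have /card_gt0P[i iU] : (0 < #|U|)%N by rewrite cU.
rewrite -(setD1K iU); set V := U :\ i; have iV : i \notin V by rewrite !inE eqxx.
have cV : #|V| = k by have := cardsD1 i U; rewrite iU cU /= add1n => -[].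
rewrite big_subset_setU1//.
set A0 := \sum_(S | _) _; set A1' := (X in (A0 + X) ^+ 2).
pose c1 S := c (i |: S).
pose A1 := \sum_(S : {set I} | S \subset V) 3 ^- #|S| * c1 S ^+ 2.
have -> : A1' = 3^-1 * A1.
  rewrite mulr_sumr; apply: eq_bigr => S SV.
  have iS : i \notin S by exact: contra (subsetP SV i) iV.
  by rewrite cardsU1 iS add1n exprSr invfM /c1; ring.
pose p x := noise c V x; pose q x := noise c1 V x.
have s2 x : ((-1) ^+ x i) ^+ 2 = 1 :> R by rewrite -exprM muln2 -signr_odd odd_double.
(* Expansion of [(p + s * q / 3) ^+ 4], with [s] the sign of coordinate [i]. The weight [1 / 3] is
   what makes the cross term [6 / 9 = 2 / 3] equal to that of the target [(A0 + A1 / 3) ^+ 2]. *)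
have E : cmean (fun x => noise c (i |: V) x ^+ 4) =
    cmean (fun x => p x ^+ 4) + (2 / 3 * cmean (fun x => p x ^+ 2 * q x ^+ 2) +
    81^-1 * cmean (fun x => q x ^+ 4)).
  rewrite (@eq_cmean _ (fun x => p x ^+ 4 + (2 / 3 * (p x ^+ 2 * q x ^+ 2) +
      (81^-1 * q x ^+ 4 + (-1) ^+ x i * (4 / 3 * (p x ^+ 3 * q x) +
       4 / 27 * (p x * q x ^+ 3)))))); last first.
    move=> x; rewrite noise_setU1// -/(p x) -/(q x).
    have s3 : ((-1) ^+ x i) ^+ 3 = (-1) ^+ x i :> R.
      by rewrite exprS s2 mulr1.
    have s4 : ((-1) ^+ x i) ^+ 4 = 1 :> R.
      by rewrite (exprM _ 2 2) s2 expr1n.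
    move: s3 s4 (s2 x); set s := (-1) ^+ x i => s3 s4 s2x.
    transitivity (p x ^+ 4 + 4 / 3 * s * (p x ^+ 3 * q x) +
      2 / 3 * s ^+ 2 * (p x ^+ 2 * q x ^+ 2) +
      4 / 27 * s ^+ 3 * (p x * q x ^+ 3) + 81^-1 * s ^+ 4 * q x ^+ 4); first by field.
    by rewrite s3 s4 s2x; field.
  rewrite !cmeanD !cmeanZ.
  (* [p] and [q] do not see coordinate [i], so the odd powers of its sign average to zero. *)
  rewrite [X in _ + (_ + (_ + X))](@cmean_eq0_odd _ i) ?addr0// => x.
  rewrite /p /q !noise_flip// ffunE eqxx addbT.
  by case: (x i); rewrite /= ?expr0 ?expr1; ring.
rewrite E.
have h0 := IH V c cV; have h1 := IH V c1 cV.
rewrite -/(p _) -/A0 in h0; rewrite -/A1 in h1.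
have pos (S : {set I}) (d : R) : 0 <= 3 ^- #|S| * d ^+ 2.
  by rewrite mulr_ge0 ?sqr_ge0// invr_ge0 exprn_ge0.
have A00 : 0 <= A0 by apply: sumr_ge0 => S _.
have A10 : 0 <= A1 by apply: sumr_ge0 => S _.
have := @cauchy_schwarz_cmean (fun=> 1) (fun x => p x ^+ 2) (fun x => q x ^+ 2)
  (fun=> ler01).
have e1 (r : cube -> R) : cmean (fun x => 1 * r x) = cmean r.
  by apply: eq_cmean => x; rewrite mul1r.
have e4 (r : cube -> R) : cmean (fun x => (r x ^+ 2) ^+ 2) = cmean (fun x => r x ^+ 4).
  by apply: eq_cmean => x; rewrite -exprM.
rewrite !e1 !e4 => cs.
have c01 : cmean (fun x => p x ^+ 2 * q x ^+ 2) <= A0 * A1.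
  have pq0 : 0 <= cmean (fun x => p x ^+ 2 * q x ^+ 2).
    by apply: cmean_ge0 => x; rewrite mulr_ge0 ?sqr_ge0.
  rewrite -ler_sqr ?nnegrE ?(mulr_ge0 A00 A10)//.
  apply: (le_trans cs); rewrite exprMn; apply: ler_pM => //;
    by apply: cmean_ge0 => x; rewrite exprn_even_ge0.
apply: (@le_trans _ _ (A0 ^+ 2 + (2 / 3 * (A0 * A1) + 81^-1 * A1 ^+ 2))).
  rewrite lerD// lerD// ler_wpM2l//; lra.
by have := sqr_ge0 A1; lra.
Qed.

Definition low_energy i f : R :=
  \sum_(S : {set I} | i \in S) 3 ^- #|S| * coef f S ^+ 2.

Lemma low_energy_diff i f :
  low_energy i f = \sum_(S : {set I}) 3 ^- #|S| * coef (diff i f) S ^+ 2.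
Proof.
rewrite /low_energy big_mkcond/=; apply: eq_bigr => S _.
by rewrite coef_diff; case: ifP => // _; rewrite expr0n mulr0.
Qed.

(* Duality turns [bonami] into a bound by the L1 norm: writing [w] for the
   noisy version of [h = diff i f], [Y = E (h w)] satisfies
   [Y ^ 4 <= (E |h|) ^ 3 * E (w ^ 4) <= (E |h|) ^ 3 * Y ^ 2]. *)
Lemma low_energy_le i f (a : R) : (forall x, 0 <= f x <= 1) ->
  cmean (fun x => `|f x - f (flip i x)|) <= a -> low_energy i f ^+ 2 <= a ^+ 3.
Proof.
move=> f01 fa; pose h := diff i f; pose w := noise (coef h) setT.
have h1 x : `|h x| <= 1.
  rewrite /h /diff ler_norml; have := f01 x; have := f01 (flip i x); lra.
have ha : cmean (fun x => `|h x|) <= a.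
  apply: (le_trans _ fa); apply: ler_cmean => x.
  by rewrite /h /diff normrM ler_piMr// ger0_norm; lra.
have h20 : 0 <= cmean (fun x => h x ^+ 2).
  by apply: cmean_ge0 => x; exact: sqr_ge0.
have hh : cmean (fun x => h x ^+ 2) <= a.
  apply: (le_trans _ ha); apply: ler_cmean => x; rewrite -real_normK ?num_real//.
  by rewrite expr2 ler_piMr.
have a0 : 0 <= a by exact: le_trans hh.
set Y := low_energy i f.
have YE : Y = cmean (fun x => h x * w x).
  rewrite /Y low_energy_diff; under [in RHS]eq_cmean do rewrite /w /noise mulr_sumr.
  rewrite cmean_sum; apply: eq_big => [S|S _]; first by rewrite subsetT.
  rewrite -/h expr2 mulrA -cmeanZ; apply: eq_cmean => x; ring.
have w4 : cmean (fun x => w x ^+ 4) <= Y ^+ 2.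
  rewrite /Y low_energy_diff; have := bonami (coef h) setT.
  by rewrite (eq_bigl xpredT) => [//|S]; rewrite subsetT.
have Y0 : 0 <= Y.
  by apply: sumr_ge0 => S _; rewrite mulr_ge0 ?sqr_ge0// invr_ge0 exprn_ge0.
set m := cmean (fun x => `|h x| * w x ^+ 2).
have m0 : 0 <= m by apply: cmean_ge0 => x; rewrite mulr_ge0 ?sqr_ge0.
have Ym : Y ^+ 2 <= a * m.
  apply: (@le_trans _ _ (cmean (fun x => `|h x|) * m)); last by rewrite ler_wpM2r.
  (* The weight is the absolute value of [h] and the first factor its sign, whose square is 1. *)
  have := @cauchy_schwarz_cmean (fun x => `|h x|) (fun x => (-1) ^+ (h x < 0)%R) w
    (fun x => normr_ge0 (h x)).
  rewrite YE (@eq_cmean _ (fun x => h x * w x)); last first.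
    by move=> x; rewrite mulrA [_ * _ ^+ _]mulrC -numEsign.
  rewrite [X in _ <= X * _](@eq_cmean _ (fun x => `|h x|)) //.
  by move=> x; rewrite sqrr_sign mulr1.
have mY : m ^+ 2 <= a * Y ^+ 2.
  have := @cauchy_schwarz_cmean (fun=> 1) (fun x => `|h x|) (fun x => w x ^+ 2)
    (fun=> ler01).
  rewrite (@eq_cmean _ (fun x => `|h x| * w x ^+ 2)) => [|x]; last by rewrite mul1r.
  rewrite (@eq_cmean (fun x => 1 * `|h x| ^+ 2) (fun x => h x ^+ 2)) => [|x]; last first.
    by rewrite mul1r real_normK ?num_real.
  rewrite (@eq_cmean (fun x => 1 * (w x ^+ 2) ^+ 2) (fun x => w x ^+ 4)) => [|x]; last first.
    by rewrite mul1r -exprM.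
  move=> mw; apply: (le_trans mw); apply: ler_pM => //.
  by apply: cmean_ge0 => x; rewrite exprn_even_ge0.
have [->|Yn0] := eqVneq Y 0; first by rewrite expr0n exprn_ge0.
have Y20 : 0 < Y ^+ 2 by rewrite exprn_gt0// lt_neqAle eq_sym Yn0.
rewrite -(ler_pM2r Y20).
have : (Y ^+ 2) ^+ 2 <= (a * m) ^+ 2.
  by rewrite ler_sqr// nnegrE; [exact: ltW|exact: mulr_ge0].
rewrite -expr2 => /le_trans; apply; rewrite exprMn.
by rewrite (_ : _ ^+ 3 * _ = a ^+ 2 * (a * Y ^+ 2)); [|ring]; rewrite ler_wpM2l ?sqr_ge0.
Qed.

(* Low frequencies are controlled by [low_energy_le], frequencies above [k] by
   the total energy. *)
Lemma talagrand_cube f (a : I -> R) (q : R) (k : nat) : (0 < k)%N -> 0 <= q ->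
  (forall x, 0 <= f x <= 1) ->
  (forall i, cmean (fun x => `|f x - f (flip i x)|) <= a i) ->
  (forall i, a i <= q ^+ 2) ->
  cmean (fun x => f x ^+ 2) - cmean f ^+ 2 <= (3 ^+ k * q + k%:R^-1) * \sum_i a i.
Proof.
move=> k0 q0 f01 fa aq.
have kR : 0 < k%:R :> R by rewrite ltr0n.
have a0 i : 0 <= a i by apply: le_trans (fa i); apply: cmean_ge0 => x.
(* [q] stands for the square root of the largest influence: the square of the low energy is at most
   [a i ^+ 3], hence at most [(q * a i) ^+ 2]. *)
have low i : low_energy i f <= q * a i.
  have l0 : 0 <= low_energy i f.
    by apply: sumr_ge0 => S _; rewrite mulr_ge0 ?sqr_ge0// invr_ge0 exprn_ge0.
  rewrite -ler_sqr ?nnegrE ?mulr_ge0//; apply: (le_trans (low_energy_le f01 (fa i))).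
  by rewrite exprMn exprS ler_wpM2r ?sqr_ge0.
have high i : \sum_(S : {set I} | i \in S) coef f S ^+ 2 <= a i.
  rewrite big_mkcond/= (eq_bigr (fun S => coef (diff i f) S ^+ 2)); last first.
    by move=> S _; rewrite coef_diff; case: ifP; rewrite ?expr0n.
  rewrite -parseval; apply: le_trans (fa i); apply: ler_cmean => x.
  rewrite /diff -real_normK ?num_real//.
  have := f01 x; have := f01 (flip i x) => fx fy.
  rewrite normrM [`|2^-1|]ger0_norm; last lra.
  have : `|f x - f (flip i x)| <= 1 by rewrite ler_norml; lra.
  by have := normr_ge0 (f x - f (flip i x)); nra.
have cardsum (F : {set I} -> R) :
    \sum_i \sum_(S : {set I} | i \in S) F S = \sum_(S : {set I}) #|S|%:R * F S.
  rewrite (exchange_big_dep predT)//=; apply: eq_bigr => S _.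
  by rewrite sumr_const mulr_natl.
rewrite parseval (bigD1 set0)//= coef0 addrAC subrr add0r.
apply: (@le_trans _ _ (3 ^+ k * \sum_i low_energy i f +
    k%:R^-1 * \sum_i \sum_(S : {set I} | i \in S) coef f S ^+ 2)); last first.
  rewrite mulrDl lerD// ?ler_wpM2l ?invr_ge0 ?(ltW kR) ?ler_sum// -mulrA.
  rewrite ler_wpM2l ?exprn_ge0// mulr_sumr ler_sum// => i _; exact: low.
rewrite !cardsum !mulr_sumr -big_split/=.
rewrite [leRHS](bigD1 set0)//= cards0 !mul0r !mulr0 addr0 add0r.
apply: ler_sum => S S0.
have S1 : 1 <= #|S|%:R :> R by rewrite ler1n card_gt0.
have -> : 3 ^+ k * (#|S|%:R * (3 ^- #|S| * coef f S ^+ 2)) +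
    k%:R^-1 * (#|S|%:R * coef f S ^+ 2) =
    (3 ^+ k * 3 ^- #|S| * #|S|%:R + k%:R^-1 * #|S|%:R) * coef f S ^+ 2.
  by ring.
(* It remains to see that the factor of [coef f S ^+ 2] is at least 1: its first term is when [S]
   has at most [k] elements, its second term otherwise. *)
rewrite ler_peMl ?sqr_ge0//.
have [Sk|kS] := leqP #|S| k.
  apply: (@le_trans _ _ (3 ^+ k * 3 ^- #|S| * #|S|%:R)); last first.
    by rewrite lerDl mulr_ge0// invr_ge0 ltW.
  rewrite mulr_ege1// ler_pdivlMr ?exprn_gt0// mul1r.
  by apply: ler_weXn2l => //; lra.
apply: (@le_trans _ _ (k%:R^-1 * #|S|%:R)); last first.
  by rewrite lerDr !mulr_ge0 ?invr_ge0 ?exprn_ge0.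
by rewrite mulrC ler_pdivlMr// mul1r ler_nat ltnW.
Qed.

End walsh.

(* When all the blocks have the same influences, each of the [n * m] bits has
   influence at most [S / n], so that [talagrand_cube] gains a factor [log n]. *)
Lemma kkl_cube (R : realFieldType) (n m : nat) (f : {ffun 'I_n * 'I_m -> bool} -> R)
    (a : 'I_m -> R) : (0 < m)%N -> (2 ^ m <= n)%N ->
  (forall x, 0 <= f x <= 1) ->
  (forall i j, cmean (fun x => `|f x - f (flip (i, j) x)|) <= a j) ->
  cmean (fun x => f x ^+ 2) - cmean f ^+ 2 <= 208 / m%:R * (n%:R * \sum_j a j).
Proof.
move=> m0 mn f01 fa; set S := n%:R * _.
have mR : 0 < m%:R :> R by rewrite ltr0n.
have n0 : (0 < n)%N by rewrite (leq_trans _ mn)// expn_gt0.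
have a0 j : 0 <= a j by apply: le_trans (fa (Ordinal n0) j); apply: cmean_ge0 => x.
have SE : \sum_(ij : 'I_n * 'I_m) a ij.2 = S.
  rewrite -(pair_big predT predT (fun _ j => a j))/= sumr_const card_ord.
  by rewrite -mulr_natl.
(* When [S >= m] the right-hand side exceeds 1, which already bounds the variance. *)
have [Sm|mS] := ltP S m%:R; last first.
  apply: (@le_trans _ _ 1).
    have : cmean (fun x => f x ^+ 2) <=
        cmean (fun _ : {ffun 'I_n * 'I_m -> bool} => 1).
      by apply: ler_cmean => x; have := f01 x; nra.
    rewrite {2}/cmean sumr_const card_ffun card_prod !card_ord card_bool.
    rewrite -mulr_natl natrX mulr1 mulVf; last by rewrite gt_eqF ?exprn_gt0.
    by have := sqr_ge0 (cmean f); lra.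
  by rewrite mulrAC ler_pdivlMr// mul1r (le_trans mS)// ler_peMl ?(le_trans (ltW mR))//; lra.
(* This cutoff gives [(16 ^+ k) ^+ 4 <= 2 ^+ m] and [m <= 16 * (16 ^+ k) ^+ 2], so that a single
   influence, at most [S / n <= m / 2 ^+ m], is at most [16 / (16 ^+ k) ^+ 2 = q ^+ 2]. The cube
   inequality is applied at [k.+1], which is positive even when [m < 16]. *)
pose k := (m %/ 16)%N.
have mk : (m < 16 * k.+1)%N by rewrite /k; lia.
have km : (16 * k <= m)%N by rewrite /k; lia.
have k2 : (k.+1 <= 2 ^ k)%N by exact: ltn_expl.
have k1R : 0 < k.+1%:R :> R by rewrite ltr0n.
pose q : R := 4 / 16 ^+ k.
have q0 : 0 <= q by rewrite divr_ge0// exprn_ge0.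
have aq (i : 'I_n * 'I_m) : a i.2 <= q ^+ 2.
  have anS : n%:R * a i.2 <= S.
    by rewrite ler_wpM2l// (bigD1 i.2)//= lerDl sumr_ge0.
  have nR : 2 ^+ m <= n%:R :> R by rewrite -natrX ler_nat.
  have k16 : (16 ^+ k) ^+ 4 <= 2 ^+ m :> R.
    rewrite -exprM (_ : 16 = 2 ^+ 4); last by rewrite -natrX.
    by rewrite -exprM ler_weXn2l//; [lra|lia].
  have mk16 : m%:R <= 16 * (16 ^+ k) ^+ 2 :> R.
    rewrite -!natrX -natrM ler_nat; apply: (leq_trans (ltnW mk)).
    rewrite leq_mul2l/=; apply: (leq_trans k2); apply: (@leq_trans (16 ^ k)).
      by case: (k) => // k'; rewrite leq_exp2r.
    by rewrite leq_pmulr// expn_gt0.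
  have X0 : 0 < 16 ^+ k :> R by rewrite exprn_gt0.
  rewrite /q expr_div_n ler_pdivlMr ?exprn_gt0//.
  move: X0 k16 mk16 anS (a0 i.2) Sm nR; set X := 16 ^+ k => X0 k16 mk16 anS ai Sm nR.
  have : 2 ^+ m * a i.2 <= m%:R.
    by apply: (le_trans _ (ltW Sm)); apply: (le_trans _ anS); rewrite ler_wpM2r.
  have : X ^+ 4 * a i.2 <= 2 ^+ m * a i.2 by rewrite ler_wpM2r.
  move=> h1 h2; have h3 : X ^+ 4 * a i.2 <= 16 * X ^+ 2.
    by apply: (le_trans h1); exact: le_trans h2 mk16.
  have X2 : 0 < X ^+ 2 by rewrite exprn_gt0.
  by rewrite -(ler_pM2r X2); move: h3; lra.
have := @talagrand_cube R _ f (fun ij => a ij.2) q k.+1 (ltn0Sn k) q0 f01.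
rewrite SE => /(_ (fun ij => _) aq) => h.
apply: (le_trans (h _)) => [[i j]//|].
have S0 : 0 <= S by rewrite mulr_ge0// sumr_ge0.
(* The low frequencies give [3 ^+ k.+1 * q * m = 12 * m * (3 / 16) ^+ k], at most 192 because
   [m <= 16 * k.+1 <= 16 * 2 ^+ k]; the high ones give [m / k.+1 <= 16]. *)
rewrite ler_wpM2r// (_ : 208 / m%:R = 192 / m%:R + 16 / m%:R); last by lra.
have mkR : m%:R <= 16 * k.+1%:R :> R by rewrite -natrM ler_nat ltnW.
apply: lerD; last first.
  by rewrite ler_pdivlMr// mulrC ler_pdivrMr.
rewrite ler_pdivlMr// /q exprS.
have X0 : 0 < 16 ^+ k :> R by rewrite exprn_gt0.
rewrite (_ : _ * m%:R = (12 * 3 ^+ k * m%:R) / 16 ^+ k); last by ring.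
rewrite ler_pdivrMr//.
have h1 : 2 ^+ k * 3 ^+ k <= 16 ^+ k :> R.
  rewrite -exprMn; apply: lerXn2r; rewrite ?nnegrE; lra.
have h2 : k.+1%:R <= 2 ^+ k :> R by rewrite -natrX ler_nat.
have h3 : 0 < 3 ^+ k :> R by rewrite exprn_gt0.
have h4 : 3 ^+ k * m%:R <= 3 ^+ k * (16 * k.+1%:R) :> R by apply: ler_wpM2l mkR; exact: ltW.
have h5 : 3 ^+ k * k.+1%:R <= 3 ^+ k * 2 ^+ k :> R by apply: ler_wpM2l h2; exact: ltW.
lra.
Qed.

Require Import Defs.
From mathcomp Require Import all_fingroup.
From mathcomp Require Import all_classical all_reals all_analysis.
From mathcomp Require Import measurable_realfun.

Import numFieldNormedType.Exports.
Local Open Scope classical_set_scope.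
Local Open Scope ring_scope.

(** * Product measures *)

Section borel_row.
Context {R : realType} {n : nat}.

Definition box (B : 'I_n -> set R) : set 'rV[R]_n := [set x | forall i, B i (x 0 i)].

Definition boxes : set (set 'rV[R]_n) :=
  [set U | exists2 B, (forall i, measurable (B i)) & U = box B].

Lemma measurable_boxes : boxes `<=` measurable.
Proof. by move=> _ [B mB ->]; exact: measurable_box. Qed.

Lemma boxes_setI_closed : setI_closed boxes.
Proof.
move=> _ _ [B mB ->] [C mC ->]; exists (fun i => B i `&` C i).
  by move=> i; exact: measurableI.
by apply/seteqP; split=> [x [xB xC] i|x xBC]; split => // i; have [] := xBC i.
Qed.


End borel_row.

(** An open set is a countable union of boxes with rational centres, by [open_ratr_balls]; that
    lemma concerns positive dimensions, and in dimension 0 there is a single point. *)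
Lemma borel_boxes {R : realType} n (A : set 'rV[R]_n) :
  measurable A -> <<s boxes >> A.
Proof.
move=> mA; suff : (@open 'rV[R]_n) `<=` <<s boxes >>.
  by move=> /(smallest_sub (smallest_sigma_algebra setT boxes)); exact.
elim: n A mA => [|k _] _ _ U oU.
  have [->|/set0P[x Ux]] := eqVneq U set0; first exact: sigma_algebra0.
  apply: sub_sigma_algebra; exists (fun=> setT) => //.
  by apply/seteqP; split=> // y _; rewrite (_ : y = x)//; apply/rowP; case.
rewrite (open_ratr_balls oU) bigcup_mkcond.
apply: (@countable_bigcupT_measurable _ (g_sigma_algebraType boxes)).
  exact: countableP.
move=> qk; case: ifPn => _; last exact: sigma_algebra0.
apply: sub_sigma_algebra.
by exists (fun i => ball (ratr (qk.1 0 i) : R) qk.2.+1%:R^-1) => // i;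
   apply: open_measurable; exact: ball_open.
Qed.

Lemma measurable_fun_row {R : realType} n d (T : measurableType d)
    (f : T -> 'rV[R]_n) :
  (forall i, measurable_fun setT (fun t => f t 0 i)) -> measurable_fun setT f.
Proof.
move=> mf; apply: (@measurability _ _ _ _ _ _ boxes).
  apply/seteqP; split=> U; first exact: borel_boxes.
  by move: U; apply: smallest_sub => //; [exact: sigma_algebra_measurable|exact: measurable_boxes].
move=> _ [_ [B mB ->] <-]; rewrite setTI.
rewrite (_ : _ @^-1` _ = \bigcap_(i in [set: 'I_n]) ((fun t => f t 0 i) @^-1` B i)).
  apply: fin_bigcap_measurable => // i _; rewrite -[X in measurable X]setTI.
  exact: mf.
by apply/seteqP; split=> [t tB i _|t tB i]; exact: tB.
Qed.

Section power_prob_theory.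
Context {R : realType} {n : nat} (P : probability R R).
Local Notation mu := (power_prob P n).
Local Open Scope ereal_scope.

Lemma power_prob_boxE (B : 'I_n -> set R) : (forall i, measurable (B i)) ->
  mu (box B) = \prod_(i < n) P (B i).
Proof. exact: power_prob_box. Qed.

Lemma power_prob_unique (nu : {measure set 'rV[R]_n -> \bar R}) :
  (forall B : 'I_n -> set R, (forall i, measurable (B i)) ->
    nu (box B) = \prod_(i < n) P (B i)) ->
  forall A, measurable A -> nu A = mu A.
Proof.
move=> nuB A /borel_boxes; apply: (g_sigma_algebra_measure_unique boxes
  measurable_boxes (fun=> setT)).
- move=> _; exists (fun=> setT) => //.
  by apply/seteqP; split.
- by rewrite bigcup_const.
- exact: boxes_setI_closed.
- by move=> _ [B mB ->]; rewrite nuB//; exact/esym/power_prob_boxE.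
move=> _; rewrite (_ : setT = box (fun=> setT)); last by apply/seteqP; split.
by rewrite nuB// big1 ?ltry// => i _; rewrite probability_setT.
Qed.

Definition upd (i : 'I_n) (x : 'rV[R]_n) (y : R) : 'rV[R]_n :=
  (\row_j (if j == i then y else x 0 j))%R.

Lemma updE i x y j : upd i x y 0%R j = if j == i then y else x 0%R j.
Proof. by rewrite mxE. Qed.

Lemma upd_upd i x y z : upd i (upd i x y) z = upd i x z.
Proof. by apply/rowP => j; rewrite !updE; case: eqP. Qed.

Lemma upd_id i x : upd i x (x 0%R i) = x.
Proof. by apply/rowP => j; rewrite updE; case: eqP => [->|]. Qed.

Lemma measurable_upd i :
  measurable_fun setT (fun xy : 'rV[R]_n * R => upd i xy.1 xy.2).
Proof.
apply: measurable_fun_row => j; have [->|ji] := eqVneq j i.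
  by under eq_fun do rewrite updE eqxx; exact: measurable_snd.
under eq_fun do rewrite updE (negbTE ji).
exact: (measurableT_comp (measurable_coord _ _)) measurable_fst.
Qed.

Lemma measurable_updr i x : measurable_fun setT (upd i x).
Proof.
apply: (measurableT_comp (measurable_upd i)) (pair1_measurable x).
Qed.

(** The section of [A] by the line through [x] in direction [i]. It ignores [x 0 i]; keeping the
    whole row as parameter avoids splitting off a coordinate. *)
Definition fiber (A : set 'rV[R]_n) i x : set R := [set y | A (upd i x y)].

Lemma measurable_fiber A i x : measurable A -> measurable (fiber A i x).
Proof.
by move=> mA; rewrite -[fiber _ _ _]setTI; exact: (measurable_updr i x).
Qed.

(** Resampling one coordinate independently preserves the product measure: on a box, the old
    coordinate [i] is unconstrained and the new one contributes the missing factor. With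
    [integral_upd], this takes the place of Fubini for one coordinate against the others. *)
Lemma pushforward_upd i A : measurable A ->
  (mu \x P) [set xy | A (upd i xy.1 xy.2)] = mu A.
Proof.
move=> mA.
pose U (xy : 'rV[R]_n * R) := upd i xy.1 xy.2.
have mU : measurable_fun setT U by exact: measurable_upd.
rewrite -(@power_prob_unique
  (pushforward (mu \x P) (mfun_Sub (mem_set mU))))// => B mB.
change ((mu \x P) (U @^-1` box B) = \prod_(i < n) P (B i)).
pose B' j := if j == i then setT else B j.
have mB' j : measurable (B' j) by rewrite /B'; case: ifP.
rewrite (_ : _ @^-1` _ = box B' `*` B i).
  transitivity (mu (box B') * P (B i)).
    by apply: product_measure1E => //; exact: (measurable_box mB').
  rewrite power_prob_boxE// (bigD1 i)//= /B' eqxx probability_setT mul1e muleC.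
  rewrite [in RHS](bigD1 i)//=; congr (_ * _).
  by apply: eq_bigr => j /negbTE ->.
apply/seteqP; split=> [[x y]/= UB|[x y]/= [xB' yB] j].
  split=> [j|]; last by have := UB i; rewrite updE eqxx.
  by rewrite /B'; have := UB j; rewrite updE; case: eqP.
by rewrite updE; have := xB' j; rewrite /B'; case: eqP => [->|].
Qed.

Lemma integral_upd i (F : 'rV[R]_n -> \bar R) : measurable_fun setT F ->
  (forall x, 0 <= F x) ->
  \int[mu]_x \int[P]_y F (upd i x y) = \int[mu]_x F x.
Proof.
move=> mF F0.
pose U (xy : 'rV[R]_n * R) := upd i xy.1 xy.2.
have mU : measurable_fun setT U by exact: measurable_upd.
have mFU : measurable_fun setT (F \o U) by exact: measurableT_comp.
have := @fubini_tonelli1 _ _ _ _ _ mu P (F \o U) mFU (fun xy => F0 _).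
rewrite /fubini_F/= => <-.
transitivity (\int[pushforward (mu \x P) U]_x F x).
  by rewrite (ge0_integral_pushforward mU)// preimage_setT.
by apply: eq_measure_integral => A mA _; exact: (pushforward_upd i mA).
Qed.

Lemma power_prob_fiber i A : measurable A ->
  \int[mu]_x P (fiber A i x) = mu A.
Proof.
move=> mA; rewrite -[RHS](pushforward_upd i)//.
by apply: eq_integral => x _; congr (P _); apply/seteqP; split=> y;
   rewrite /xsection/= inE.
Qed.

Lemma measurable_fun_fiber i A (C : set R) : measurable A -> measurable C ->
  measurable_fun setT (fun x => P (fiber A i x `&` C)).
Proof.
move=> mA mC.
pose E := [set xy : 'rV[R]_n * R | A (upd i xy.1 xy.2)] `&` (setT `*` C).
have mE : measurable E.
  apply: measurableI; last exact: measurableX.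
  by rewrite -[X in measurable X]setTI; exact: (measurable_upd i).
rewrite (_ : (fun _ => _) = P \o xsection E); first exact: measurable_fun_xsection.
apply/funext => x /=; congr (P _); apply/seteqP; split=> y; rewrite /xsection/= inE /E/=.
  by move=> [].
by move=> [? []].
Qed.

Lemma power_prob_perm (s : 'S_n) A : measurable A ->
  mu [set x | A (col_perm s x)] = mu A.
Proof.
move=> mA.
have ms : measurable_fun setT (@col_perm R 1 n s).
  apply: measurable_fun_row => j; under eq_fun do rewrite mxE.
  exact: measurable_coord.
apply: (@power_prob_unique (pushforward mu (mfun_Sub (mem_set ms)))) => // B mB.
change (mu (col_perm s @^-1` box B) = \prod_(i < n) P (B i)).
rewrite (_ : _ @^-1` _ = box (fun i => B ((s^-1)%g i))).
  rewrite power_prob_boxE// (reindex_inj (@perm_inj _ s)).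
  by apply: eq_bigr => i _; rewrite permK.
apply/seteqP; split=> [x xB i|x xB i]; last by rewrite mxE; have := xB (s i); rewrite permK.
by have := xB ((s^-1)%g i); rewrite mxE permKV.
Qed.

End power_prob_theory.

Lemma integral_perm {R : realType} {n : nat} (P : probability R R) (s : 'S_n)
    (F : 'rV[R]_n -> \bar R) : measurable_fun setT F -> (forall x, 0 <= F x)%E ->
  (\int[power_prob P n]_x F (col_perm s x) = \int[power_prob P n]_x F x)%E.
Proof.
move=> mF F0.
have ms : measurable_fun setT (@col_perm R 1 n s).
  apply: measurable_fun_row => j; under eq_fun do rewrite mxE.
  exact: measurable_coord.
transitivity (\int[pushforward (power_prob P n) (@col_perm R 1 n s)]_x F x)%E.
  by rewrite (ge0_integral_pushforward ms)// preimage_setT.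
by apply: eq_measure_integral => A mA _; exact: (power_prob_perm P s mA).
Qed.

(** * Cells of equal probability on the line *)

Definition dist_fun {R : realType} (P : probability R R) (w : R) : R :=
  fine (P `]-oo, w]%classic).

Section dist_fun_theory.
Context {R : realType} (P : probability R R).
Local Notation F := (dist_fun P).
Hypothesis F_cont : continuous F.
Hypothesis F_inc : {homo F : x y / x < y}.

Lemma dist_funE w : P `]-oo, w]%classic = (F w)%:E.
Proof. by rewrite fineK// fin_num_measure. Qed.

Lemma dist_fun_le : {homo F : x y / x <= y}.
Proof. by move=> x y; rewrite le_eqVlt => /predU1P[->//|/F_inc/ltW]. Qed.

Lemma dist_fun_ge0 w : 0 <= F w.
Proof. exact/fine_ge0. Qed.

Lemma dist_fun_lt1 w : F w < 1.
Proof.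
apply: (@lt_le_trans _ _ (F (w + 1))); first by apply: F_inc; rewrite ltrDl.
by rewrite -lee_fin -dist_funE probability_le1.
Qed.

Lemma dist_fun_mono : {mono F : x y / x < y}.
Proof. exact: leW_mono (le_mono F_inc). Qed.

Lemma probability_lt w : P `]-oo, w[%classic = (F w)%:E.
Proof.
apply/eqP; rewrite eq_le; apply/andP; split.
  rewrite -dist_funE le_measure ?inE//.
  by move=> x /=; rewrite !in_itv/= => /ltW.
apply/lee_subgt0Pr => e e0.
have /cvgrPdist_lt Fw := @F_cont w.
have /nbhs_ballP[d /= d0 dF] := Fw _ e0.
have wd : ball w d (w - d / 2).
  by rewrite /ball/= opprB addrC subrK ger0_norm ?gtr_pMr; lra.
have := dF _ wd; rewrite /= => /ltr_normlW Fwd.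
apply: (@le_trans _ _ (P `]-oo, w - d / 2]%classic)).
  by rewrite dist_funE -EFinB lee_fin; lra.
rewrite le_measure ?inE//.
by move=> x /=; rewrite !in_itv/=; lra.
Qed.

Lemma dist_fun_surj b : 0 < b < 1 -> exists w, F w = b.
Proof.
move=> /andP[b0 b1].
pose X : {RV P >-> R} := mfun_Sub (mem_set (@measurable_id _ R setT)).
have [x xb] : exists x, F x < b.
  have /fine_cvgP[_ /cvgrPdist_lt/(_ _ b0)] := cvg_cdfNy0 X.
  case=> M [_ MF]; exists (M - 1).
  have := MF (M - 1); rewrite sub0r normrN /= => /(_ ltac:(lra)).
  by rewrite ger0_norm// dist_fun_ge0.
have [y yb] : exists y, b < F y.
  have b10 : 0 < 1 - b by rewrite subr_gt0.
  have /fine_cvgP[_ /cvgrPdist_lt/(_ _ b10)] := cvg_cdfy1 X.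
  case=> M [_ MF]; exists (M + 1).
  have := MF (M + 1) => /= /(_ ltac:(lra)) /ltr_normlW.
  by rewrite -/(F (M + 1)); lra.
have xy : x <= y by rewrite leNgt; apply/negP => /F_inc; lra.
have [||c _ <-] := @IVT _ F x y b xy; last by exists c.
  exact: continuous_subspaceT.
by rewrite ge_min le_max (ltW xb) (ltW yb) orbT.
Qed.

Lemma measurable_dist_fun : measurable_fun setT F.
Proof. exact: continuous_measurable_fun. Qed.

Lemma measurable_dist_fun_itv a b : measurable [set w | a <= F w < b].
Proof.
rewrite -[X in measurable X]setTI.
rewrite (_ : [set w | _] = F @^-1` `[a, b[); first exact: measurable_dist_fun.
by apply/seteqP; split=> w; rewrite /= in_itv.
Qed.

Lemma probability_dist_fun_lt b : 0 <= b <= 1 -> P [set w | F w < b] = b%:E.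
Proof.
move=> /andP[]; rewrite le_eqVlt => /predU1P[<- _|b0].
  rewrite (_ : [set w | _] = set0) ?measure0//.
  by apply/seteqP; split=> w //=; rewrite ltNge dist_fun_ge0.
rewrite le_eqVlt => /predU1P[->|b1].
  rewrite (_ : [set w | _] = setT) ?probability_setT//.
  by apply/seteqP; split=> w //= _; exact: dist_fun_lt1.
have [w wb] : exists w, F w = b by apply: dist_fun_surj; rewrite b0.
rewrite -wb -probability_lt; congr (P _).
by apply/seteqP; split=> x; rewrite /= in_itv/= dist_fun_mono.
Qed.

(** An inequality, because the interval may stick out of [[0, 1]]; [cell_between] uses it with [a]
    possibly negative. *)
Lemma probability_dist_fun_itv a b : a <= b -> 0 <= b ->
  (P [set w | (a <= F w < b)%R] <= (b - a)%:E)%E.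
Proof.
wlog b1 : b / b <= 1.
  move=> H ab b0; have [/H/(_ ab b0)//|b1] := leP b 1.
  have [a1|a1] := leP a 1.
    apply: (@le_trans _ _ (1 - a)%:E); last by rewrite lee_fin; lra.
    apply: le_trans (H 1 _ _ _) => //; rewrite le_measure ?inE//;
      [exact: measurable_dist_fun_itv|exact: measurable_dist_fun_itv|].
    by move=> w /= /andP[-> _]; exact: dist_fun_lt1.
  rewrite (_ : [set w | _] = set0) ?measure0 ?lee_fin ?subr_ge0//.
  apply/seteqP; split=> // w /= /andP[aw _]; have := dist_fun_lt1 w; lra.
move=> ab b0; have Pb : P [set w | F w < b] = b%:E.
  by apply: probability_dist_fun_lt; rewrite b0.
have mlt c : measurable [set w | F w < c].
  rewrite -[X in measurable X]setTI.
  rewrite (_ : [set w | _] = F @^-1` `]-oo, c[); first exact: measurable_dist_fun.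
  by apply/seteqP; split=> w; rewrite /= in_itv.
have [a0|a0] := ltP a 0.
  apply: (@le_trans _ _ b%:E); last by rewrite lee_fin; lra.
  rewrite -Pb le_measure ?inE//; first exact: measurable_dist_fun_itv.
  by move=> w /= /andP[].
have Pa : P [set w | F w < a] = a%:E.
  by apply: probability_dist_fun_lt; rewrite a0 (le_trans ab).
have PS : (P [set w | (F w < b)%R] =
    P [set w | (F w < a)%R] + P [set w | (a <= F w < b)%R])%E.
  rewrite -measureU//; last 2 first.
  - exact: measurable_dist_fun_itv.
  - by apply/seteqP; split=> // w /= [wa /andP[aw _]]; lra.
  congr (P _); apply/seteqP; split=> w /=.
    by move=> wb; have [wa|aw] := ltP (F w) a; [left|right].
  by move=> [wa|/andP[]//]; exact: lt_le_trans ab.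
by rewrite EFinB -Pb PS Pa addeAC subee// add0e.
Qed.

End dist_fun_theory.

Lemma measure_partition d (T : measurableType d) (R : realType)
    (mu : {measure set T -> \bar R}) (K : finType) (J : K -> set T) (A : set T) :
  measurable A -> (forall k, measurable (J k)) ->
  (forall x, exists k, J k x) -> (forall k l x, J k x -> J l x -> k = l) ->
  (mu A = \sum_k mu (A `&` J k))%E.
Proof.
move=> mA mJ cJ dJ.
have -> : A = \bigcup_(k in [set` index_enum K]) (A `&` J k).
  apply/seteqP; split=> [x Ax|x [k _ []]//].
  by have [k Jk] := cJ x; exists k => //=; rewrite mem_index_enum.
rewrite measure_fin_bigcup//.
- rewrite -fsbig_seq ?index_enum_uniq//; apply: eq_bigr => k _.
  congr (mu _); apply/seteqP; split=> [x [Ax Jx]|x [[l _ [Ax _]] Jx]]; split => //.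
  by exists k => //=; rewrite mem_index_enum.
- by apply/trivIsetP => k l _ _ kl; apply/seteqP; split=> // x [[_ Jk] [_ Jl]];
    move: kl; rewrite (dJ _ _ _ Jk Jl) eqxx.
- by move=> k _; exact: measurableI.
Qed.

Lemma truncn_half {R : archiRealDomainType} (x : R) : 0 <= x ->
  (Num.truncn (2 * x))./2 = Num.truncn x.
Proof.
move=> x0; have /andP[h1 h2] := truncn_itv x0; set N := Num.truncn x in h1 h2 *.
have x20 : 0 <= 2 * x by rewrite mulr_ge0.
have : (N.*2 <= Num.truncn (2 * x))%N.
  by rewrite truncn_ge_nat// -muln2 natrM mulrC ler_wpM2l.
have : (Num.truncn (2 * x) < N.+1.*2)%N.
  by rewrite truncn_lt_nat// -muln2 natrM mulrC ltr_pM2r.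
lia.
Qed.

Section cells.
Context {R : realType} (P : probability R R) (m : nat).
Local Notation F := (dist_fun P).
Hypothesis F_cont : continuous F.
Hypothesis F_inc : {homo F : x y / x < y}.
Implicit Types (k : {ffun 'I_m -> bool}) (w : R).

(** Indices start at 0, so digit [j] has weight [2 ^- j.+1]. Two points that agree before digit [j]
    have values of [F] less than [2 ^- j] apart. *)
Definition bits w : {ffun 'I_m -> bool} :=
  [ffun j : 'I_m => odd (Num.truncn (2 ^+ j.+1 * F w))].

Definition cell k : set R := [set w | bits w = k].

(** [Num.truncn (2 ^+ l.+1 * F w)] is twice [Num.truncn (2 ^+ l * F w)] plus digit [l]. *)
Lemma bits_truncn w w' l : (l <= m)%N ->
  (forall j : 'I_m, (j < l)%N -> bits w j = bits w' j) ->
  Num.truncn (2 ^+ l * F w) = Num.truncn (2 ^+ l * F w').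
Proof.
elim: l => [_ _|l IH lm ww'].
  have t0 v : Num.truncn (2 ^+ 0 * F v) = 0%N.
    by apply/truncn_def; rewrite expr0 mul1r dist_fun_ge0 dist_fun_lt1.
  by rewrite !t0.
have h v : 0 <= 2 ^+ l * F v by rewrite mulr_ge0 ?exprn_ge0 ?dist_fun_ge0.
rewrite -[LHS]odd_double_half -[RHS]odd_double_half.
have := ww' (Ordinal lm) (ltnSn l); rewrite !ffunE/= => ->.
by rewrite !exprS -!mulrA !truncn_half// IH// 1?ltnW// => j jl; rewrite ww'// ltnW.
Qed.

Lemma bits_dist w w' l : (l <= m)%N ->
  (forall j : 'I_m, (j < l)%N -> bits w j = bits w' j) ->
  `|F w - F w'| < 2 ^- l.
Proof.
move=> lm ww'; have h v : 0 <= 2 ^+ l * F v.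
  by rewrite mulr_ge0 ?exprn_ge0 ?dist_fun_ge0.
have /andP[] := truncn_itv (h w); have /andP[] := truncn_itv (h w').
rewrite (bits_truncn lm ww') -natr1 => h1 h2 h3 h4.
have X0 : 0 < 2 ^+ l :> R by exact: exprn_gt0.
by rewrite -[_ ^- l]mulr1 mulrC ltr_pdivlMr// -(ger0_norm (ltW X0)) -normrM ltr_norml; lra.
Qed.

Lemma measurable_cell k : measurable (cell k).
Proof.
rewrite (_ : cell k = \bigcap_(j in [set: 'I_m])
    \bigcup_(N in [set N | odd N = k j])
      [set w | N%:R / 2 ^+ j.+1 <= F w < N.+1%:R / 2 ^+ j.+1]).
  apply: fin_bigcap_measurable => // j _; apply: bigcup_measurable => N _.
  exact: measurable_dist_fun_itv.
have E (j : 'I_m) N w : (N%:R / 2 ^+ j.+1 <= F w < N.+1%:R / 2 ^+ j.+1) =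
    (Num.truncn (2 ^+ j.+1 * F w) == N).
  by rewrite truncn_eq ?mulr_ge0 ?exprn_ge0 ?dist_fun_ge0// ler_pdivrMr ?exprn_gt0//
    ltr_pdivlMr ?exprn_gt0// [F w * _]mulrC.
apply/seteqP; split=> [w wk j _|w wk].
  exists (Num.truncn (2 ^+ j.+1 * F w)); last by rewrite /= E.
  by rewrite /= -wk ffunE.
apply/ffunP => j; have [N /= Nk] := wk j I.
by rewrite E ffunE => /eqP ->.
Qed.

Lemma cell_partition (A : set R) : measurable A ->
  (P A = \sum_k P (A `&` cell k))%E.
Proof.
move=> mA; apply: measure_partition => //; first exact: measurable_cell.
- by move=> w; exists (bits w).
- by move=> k l w <- <-.
Qed.

(** Each cell lies in a dyadic interval of values of [F], so its mass is at most [2 ^- m]. There are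
    [2 ^ m] cells and their masses add up to 1, so every bound is an equality. *)
Lemma probability_cell k : P (cell k) = (2 ^- m)%:E.
Proof.
have le_cell l : (P (cell l) <= (2 ^- m)%:E)%E.
  have [->|/set0P[w wl]] := eqVneq (cell l) set0.
    by rewrite measure0 lee_fin invr_ge0 exprn_ge0.
  set N := Num.truncn (2 ^+ m * F w).
  have X0 : 0 < 2 ^+ m :> R by exact: exprn_gt0.
  apply: (@le_trans _ _ (P [set v | N%:R / 2 ^+ m <= F v < N.+1%:R / 2 ^+ m])).
    rewrite le_measure ?inE//; [exact: measurable_cell|exact: measurable_dist_fun_itv|].
    move=> v vl /=; rewrite ler_pdivrMr// ltr_pdivlMr//.
    have -> : N = Num.truncn (2 ^+ m * F v).
      by apply: bits_truncn => // j _; rewrite wl vl.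
    by rewrite ![F v * _]mulrC truncn_itv// mulr_ge0 ?exprn_ge0 ?dist_fun_ge0.
  apply: (le_trans (probability_dist_fun_itv F_cont F_inc _ _)) => //.
  - by rewrite ler_pM2r ?invr_gt0// ler_nat.
  - by rewrite lee_fin -mulrBl -natr1 addrAC subrr add0r mul1r.
pose p l := fine (P (cell l)).
have pE l : P (cell l) = (p l)%:E by rewrite fineK// fin_num_measure//; exact: measurable_cell.
have ple l : p l <= 2 ^- m by rewrite -lee_fin -pE.
have sp : \sum_l p l = \sum_(l : {ffun 'I_m -> bool}) 2 ^- m.
  rewrite sumr_const card_ffun card_bool card_ord -(mulr_natl (2 ^- m)) natrX mulfV; last first.
    by rewrite expf_neq0.
  apply/EFin_inj; rewrite -sumEFin -(@probability_setT _ _ _ P) (cell_partition measurableT).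
  by apply: eq_bigr => l _; rewrite setTI pE.
rewrite pE; congr EFin; apply/eqP; rewrite eq_le ple leNgt; apply/negP => pk.
have : \sum_l p l < \sum_(l : {ffun 'I_m -> bool}) 2 ^- m.
  by rewrite (bigD1 k)//= [ltRHS](bigD1 k)//= ltr_leD// ler_sum.
by rewrite sp ltxx.
Qed.

End cells.

(** * Flux through the boundary of an enlargement *)

Lemma tonelli_section d1 d2 (T1 : measurableType d1) (T2 : measurableType d2)
    (R : realType) (m1 : probability T1 R)
    (m2 : {sigma_finite_measure set T2 -> \bar R}) (E : set (T1 * T2)) :
  measurable E ->
  (\int[m1]_x m2 (xsection E x) = \int[m2]_y m1 (ysection E y))%E.
Proof.
move=> mE; rewrite -[LHS]/((m1 \x m2)%E E) -[RHS]/((m1 \x^ m2)%E E).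
by apply: product_measure_unique => //= A1 A2 mA1 mA2; rewrite product_measure2E.
Qed.

Section gap.
Context {R : realType}.
Implicit Types (B C D : set R) (r w y z : R).
Local Notation leb := (@lebesgue_measure R).

Definition between (p : R * R) z : bool := (p.1 < z < p.2) || (p.2 < z < p.1).

(** Take for [z] the supremum of the points of [B] up to [y]. Points of [B] come arbitrarily close
    to [z], so [C] contains everything from [z] up to [z + r]; as [y] is not in [C], it lies beyond,
    and no point of [B] remains between [z] and [y]. *)
Lemma gap_right B C r w y : 0 < r ->
  (forall x z, B x -> `|z - x| < r -> C z) -> B w -> ~ C y -> w < y ->
  exists z, [/\ w <= z, z + r <= y & `]z, z + r[ `<=` C `\` B].
Proof.
move=> r0 BC Bw Cy wy; pose E := [set x | B x /\ x <= y].
have hE : has_sup E.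
  by split; [exists w; split => //; exact: ltW|exists y => x []].
pose z := sup E.
have zr v : v < z + r -> z <= v -> C v.
  move=> vz zv; have e0 : 0 < z + r - v by rewrite subr_gt0.
  have [x [Bx xy]] := sup_adherent e0 hE; rewrite -/z => zx.
  have xz : x <= z by exact: ub_le_sup (hE.2) _ _.
  by apply: (BC x) => //; rewrite ger0_norm; lra.
have zy : z <= y by apply: ge_sup; [exact: hE.1|move=> x []].
have zry : z + r <= y.
  by rewrite leNgt; apply/negP => yz; apply: Cy; exact: zr.
exists z; split => //.
  by apply: ub_le_sup (hE.2) _ _; split => //; exact: ltW.
move=> v; rewrite /= in_itv/= => /andP[zv vz]; split; first by apply: zr => //; exact: ltW.
move=> Bv; have : v <= z by apply: ub_le_sup (hE.2) _ _; split => //; lra.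
lra.
Qed.

Lemma lebesgue_gap B C r w y : measurable B -> measurable C -> 0 < r ->
  (forall x z, B x -> `|z - x| < r -> C z) -> B w -> ~ C y ->
  (r%:E <= leb ((C `\` B) `&` [set z | between (w, y) z]))%E.
Proof.
move=> mB mC r0 BC Bw Cy.
have mbtw : measurable [set z | between (w, y) z].
  rewrite (_ : [set z | _] = `]w, y[ `|` `]y, w[); first exact: measurableU.
  by apply/seteqP; split=> z; rewrite /between/= !in_itv/=;
    [move/orP => [->|->]; [left|right]|move=> [->|->]; rewrite ?orbT].
have mD : measurable ((C `\` B) `&` [set z | between (w, y) z]).
  by apply: measurableI => //; exact: measurableD.
have key z : `]z, z + r[ `<=` (C `\` B) `&` [set z | between (w, y) z] ->
    (r%:E <= leb ((C `\` B) `&` [set z | between (w, y) z]))%E.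
  move=> sub; apply: (@le_trans _ _ (leb `]z, z + r[%classic)).
    by rewrite lebesgue_measure_itv/= lte_fin ltrDl r0 -EFinB addrAC subrr add0r.
  by rewrite le_measure ?inE.
have [wy|yw|wy] := ltgtP w y.
- have [z [wz zry zD]] := gap_right r0 BC Bw Cy wy.
  apply: (key z) => v vz; split; first exact: zD.
  by move: vz; rewrite /between/= in_itv/=; move=> /andP[h1 h2]; apply/orP; left; lra.
(* A jump to the left becomes a jump to the right under reflection. *)
- pose B' := [set x | B (- x)]; pose C' := [set x | C (- x)].
  have [||||z [wz zry zD]] := @gap_right B' C' r (- w) (- y) r0.
  + move=> x z Bx xz; apply: (BC (- x)) => //; rewrite opprK -normrN.
    by rewrite opprD opprK.
  + by rewrite /B' /= opprK.
  + by rewrite /C' /= opprK.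
  + lra.
  apply: (key (- z - r)) => v; rewrite /= in_itv/= subrK => /andP[h1 h2].
  have := zD (- v); rewrite /= in_itv/= => /(_ ltac:(lra)) [].
  rewrite /C' /B' /= opprK => Cv Bv; split => //; rewrite /between/=.
  by apply/orP; right; lra.
- by exfalso; apply: Cy; apply: (BC w) => //; rewrite wy subrr normr0.
Qed.

Lemma measurable_between : measurable [set pz : (R * R) * R | between pz.1 pz.2].
Proof.
have mlt (f g : (R * R) * R -> R) : measurable_fun setT f -> measurable_fun setT g ->
    measurable [set pz | f pz < g pz].
  move=> mf mg; have mb := measurable_fun_ltr mf mg.
  have := mb measurableT [set true] I.
  by rewrite setTI; congr measurable; apply/seteqP; split.
have m1 : measurable_fun setT (fun pz : (R * R) * R => pz.1.1).
  exact: (measurableT_comp measurable_fst measurable_fst).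
have m2 : measurable_fun setT (fun pz : (R * R) * R => pz.1.2).
  exact: (measurableT_comp measurable_snd measurable_fst).
have m3 : measurable_fun setT (fun pz : (R * R) * R => pz.2) by exact: measurable_snd.
rewrite (_ : [set pz | _] =
    ([set pz | pz.1.1 < pz.2] `&` [set pz | pz.2 < pz.1.2]) `|`
    ([set pz | pz.1.2 < pz.2] `&` [set pz | pz.2 < pz.1.1])).
  by apply: measurableU; apply: measurableI; exact: mlt.
apply/seteqP; split=> pz; rewrite /between/=.
  by move=> /orP[/andP[? ?]|/andP[? ?]]; [left|right].
by move=> [[-> ->]//|[-> ->]]; rewrite orbT.
Qed.

(** Integrating the length bound over independent [w] and [y], then exchanging the integrals, turns
    a bound on every jump into an integral over [z] of the probability that the jump crosses [z]. *)
Lemma jump_tonelli (P : probability R R) X Y D r :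
  measurable X -> measurable Y -> measurable D -> 0 <= r ->
  (forall w y, X w -> Y y -> r%:E <= leb (D `&` [set z | between (w, y) z]))%E ->
  (r%:E * (P X * P Y) <=
   \int[leb]_(z in D) (P \x P) ((X `*` Y) `&` [set p | between p z]))%E.
Proof.
move=> mX mY mD r0 H.
pose E : set ((R * R) * R) :=
  ((X `*` Y) `*` D) `&` [set pz | between pz.1 pz.2].
have mE : measurable E.
  apply: measurableI; last exact: measurable_between.
  by apply: measurableX => //; exact: measurableX.
have mXY : measurable (X `*` Y) by exact: measurableX.
pose PP : probability (R * R)%type R := (P \x P)%E.
have T : (\int[P \x P]_p leb (xsection E p) =
    \int[leb]_z (P \x P) (ysection E z))%E.
  have := @tonelli_section _ _ _ _ R PP leb E mE.
  exact.
have -> : (P X * P Y = (P \x P) (X `*` Y))%E by rewrite product_measure1E.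
rewrite -integral_cst//.
apply: (@le_trans _ _ (\int[P \x P]_(p in X `*` Y) leb (xsection E p))%E).
  apply: ge0_le_integral => //.
  - exact/measurable_funTS/measurable_fun_xsection.
  - move=> [w y] [/= Xw Yy]; apply: (le_trans (H w y Xw Yy)).
    rewrite le_eqVlt; apply/orP; left; apply/eqP; congr (leb _).
    apply/seteqP; split=> z; rewrite /xsection/= inE/E/=; first by move=> [].
    by move=> [[_ ?] ?].
apply: (@le_trans _ _ (\int[P \x P]_p leb (xsection E p))%E).
  apply: ge0_subset_integral => //; exact: measurable_fun_xsection.
rewrite T [leRHS]integral_mkcond le_eqVlt; apply/orP; left; apply/eqP.
apply: eq_integral => z _; rewrite patchE; case: ifPn => zD.
  congr ((P \x P)%E _); apply/seteqP; split=> p; rewrite /ysection/= inE/E/=.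
    by move=> [[? _] ?].
  by move=> [? ?]; split => //; split => //; rewrite -in_setE.
rewrite (_ : ysection _ _ = set0) ?measure0//.
apply/seteqP; split=> // p; rewrite /ysection/= inE => -[[_ Dz] _].
by move: zD; rewrite notin_setE.
Qed.

Lemma measurable_fun_between (P : probability R R) X Y :
  measurable X -> measurable Y -> measurable_fun setT
    (fun z => (P \x P)%E ((X `*` Y) `&` [set p | between p z])).
Proof.
move=> mX mY; pose PP : probability (R * R)%type R := (P \x P)%E.
pose E : set ((R * R) * R) := ((X `*` Y) `*` setT) `&` [set pz | between pz.1 pz.2].
have mE : measurable E.
  apply: measurableI; last exact: measurable_between.
  by apply: measurableX => //; exact: measurableX.
apply: eq_measurable_fun (@measurable_fun_ysection _ _ _ _ R PP E mE) => z _ /=.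
congr ((P \x P)%E _); apply/seteqP; split=> p; rewrite /ysection/= inE/E/=.
  by move=> [[]].
by move=> [].
Qed.

End gap.

(** * Jumps of a point of the line from its cell to another *)

Section resample.
Context {R : realType} (P : probability R R) (m : nat).
Local Notation leb := (@lebesgue_measure R).
Local Notation F := (dist_fun P).
Hypothesis F_cont : continuous F.
Hypothesis F_inc : {homo F : x y / x < y}.
Local Notation pattern := {ffun 'I_m -> bool}.
Local Notation cell := (cell P).
Implicit Types (B C D : set R) (s : pattern -> pattern) (k : pattern).
Local Open Scope ereal_scope.

(* Probability that [B] contains a [P]-random point but not an independent
   point drawn from the cell whose pattern is obtained by [s]. *)
Definition flux s B : \bar R :=
  (2 ^+ m)%R%:E * \sum_k P (B `&` cell k) * P (~` B `&` cell (s k)).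

Lemma flux_ge0 s B : 0 <= flux s B.
Proof. by rewrite mule_ge0 ?lee_fin ?exprn_ge0// sume_ge0// => k _; rewrite mule_ge0. Qed.

Lemma sum_cell s D : bijective s -> measurable D ->
  \sum_k P (D `&` cell (s k)) = P D.
Proof.
move=> bs mD; rewrite (cell_partition m F_cont mD) [RHS](reindex s)//.
exact: onW_bij.
Qed.

Lemma sum_cell_le_r s B D : bijective s -> measurable B -> measurable D ->
  (2 ^+ m)%R%:E * \sum_k P (B `&` cell k) * P (D `&` cell (s k)) <= P D.
Proof.
move=> bs mB mD; apply: (@le_trans _ _
    ((2 ^+ m)%R%:E * \sum_k (2 ^- m)%R%:E * P (D `&` cell (s k)))).
  rewrite lee_wpmul2l ?lee_fin ?exprn_ge0//; apply: lee_sum => k _.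
  rewrite lee_wpmul2r// -(probability_cell F_cont F_inc k) le_measure ?inE//.
  - by apply: measurableI => //; exact: measurable_cell.
  - exact: measurable_cell.
rewrite -ge0_sume_distrr// sum_cell// muleA -EFinM mulfV ?mul1e//.
Qed.

Lemma sum_cell_le_l s B D : bijective s -> measurable B -> measurable D ->
  (2 ^+ m)%R%:E * \sum_k P (B `&` cell k) * P (D `&` cell (s k)) <= P B.
Proof.
move=> bs mB mD; case: (bs) => t ts st.
have bt : bijective t by exists s.
apply: le_trans (sum_cell_le_r bt mD mB); rewrite le_eqVlt; apply/orP; left; apply/eqP.
congr (_ * _); rewrite (reindex t); last exact: onW_bij.
by apply: eq_bigr => k _; rewrite st muleC.
Qed.

Lemma flux_le1 s B : bijective s -> measurable B -> flux s B <= 1.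
Proof.
move=> bs mB; apply: (le_trans (sum_cell_le_l bs mB (measurableC mB))).
exact: probability_le1.
Qed.

(** The flux is not monotone, but passing to a larger set only loses the jumps from [B] that land in
    the added part. This serves to return from an enlargement to the original set. *)
Lemma flux_le s B C : bijective s -> measurable B -> measurable C -> B `<=` C ->
  flux s B <= flux s C + P (C `\` B).
Proof.
move=> bs mB mC BC; have mD : measurable (C `\` B) by exact: measurableD.
apply: le_trans (leeD (lexx _) (sum_cell_le_r bs mB mD)).
rewrite /flux -ge0_muleDr//; last 2 first.
- by rewrite sume_ge0// => k _; rewrite mule_ge0.
- by rewrite sume_ge0// => k _; rewrite mule_ge0.
rewrite lee_wpmul2l ?lee_fin ?exprn_ge0// -big_split/=; apply: lee_sum => k _.
have mc := measurable_cell F_cont.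
apply: (@le_trans _ _ (P (B `&` cell k) * (P (~` C `&` cell (s k)) +
    P ((C `\` B) `&` cell (s k))))).
  rewrite lee_wpmul2l// -measureU//.
  - rewrite le_measure ?inE//.
    + by apply: measurableI => //; exact: measurableC.
    + by apply: measurableU; apply: measurableI => //; exact: measurableC.
    move=> x [Bx kx]; have [Cx|Cx] := pselect (C x); first by right.
    by left.
  - by apply: measurableI => //; exact: measurableC.
  - by apply: measurableI.
  - by apply/seteqP; split=> // x [[Cx _] [[]]].
rewrite ge0_muleDr// leeD2r// lee_wpmul2r// le_measure ?inE//.
- exact: measurableI.
- exact: measurableI.
- exact: setSI.
Qed.

Definition tail (z : R) : R := Num.min (F z) (1 - F z)%R.

Lemma measurable_tail_min d :
  measurable_fun setT (fun z => (2 * Num.min (tail z) d)%R).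
Proof.
have mF := measurable_dist_fun F_cont.
apply: measurable_funM => //; apply: measurable_minr => //.
by apply: measurable_minr => //; exact: measurable_funB.
Qed.

(** A jump across [z] that moves [F] by at most [d] has one end in [U], beyond [z], and the other in
    [L], where [F] is below [F z] by at most [d]. The masses of [L] and [U] bound each of the two
    orders by the minimum of [tail z] and [d], hence the factor 2. *)
Lemma cell_between s (d : R) z B D : (0 <= d)%R -> bijective s ->
  measurable B -> measurable D ->
  (forall w y, bits P m y = s (bits P m w) -> `|F w - F y| <= d)%R ->
  (2 ^+ m)%R%:E * \sum_k (P \x P) (((B `&` cell k) `*` (D `&` cell (s k))) `&`
    [set p | between p z]) <= (2 * Num.min (tail z) d)%R%:E.
Proof.
move=> d0 bs mB mD sd.
pose L := [set w | (F z - d <= F w < F z)%R]; pose U := `]z, +oo[%classic.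
have mL : measurable L by exact: measurable_dist_fun_itv.
have mU : measurable U by exact: measurable_itv.
have mc := measurable_cell F_cont.
have PL : P L <= (Num.min d (F z))%:E.
  rewrite EFin_min le_min; apply/andP; split.
    apply: (le_trans (probability_dist_fun_itv F_cont F_inc _ _)).
    - by rewrite gerBl.
    - exact: dist_fun_ge0.
    - by rewrite lee_fin opprB addrC subrK.
  rewrite -(probability_lt F_cont) le_measure ?inE//.
  by move=> w /andP[_]; rewrite /= in_itv/= (dist_fun_mono F_inc).
have PU : P U = (1 - F z)%R%:E.
  rewrite (_ : U = ~` `]-oo, z]%classic); last by rewrite setCitvl.
  by rewrite probability_setC// dist_funE.
have half : (2 ^+ m)%R%:E * (\sum_k P (L `&` cell k) * P (U `&` cell (s k))) <=
      (Num.min (tail z) d)%:E.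
  rewrite EFin_min le_min EFin_min le_min; apply/andP; split; first (apply/andP; split).
  - apply: (le_trans (sum_cell_le_l bs mL mU)); apply: (le_trans PL).
    by rewrite lee_fin ge_min lexx orbT.
  - by apply: (le_trans (sum_cell_le_r bs mL mU)); rewrite PU.
  - apply: (le_trans (sum_cell_le_l bs mL mU)); apply: (le_trans PL).
    by rewrite lee_fin ge_min lexx.
have half' : (2 ^+ m)%R%:E * (\sum_k P (U `&` cell k) * P (L `&` cell (s k))) <=
      (Num.min (tail z) d)%:E.
  rewrite EFin_min le_min EFin_min le_min; apply/andP; split; first (apply/andP; split).
  - apply: (le_trans (sum_cell_le_r bs mU mL)); apply: (le_trans PL).
    by rewrite lee_fin ge_min lexx orbT.
  - by apply: (le_trans (sum_cell_le_l bs mU mL)); rewrite PU.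
  - apply: (le_trans (sum_cell_le_r bs mU mL)); apply: (le_trans PL).
    by rewrite lee_fin ge_min lexx.
rewrite mulr_natl mulr2n EFinD; apply: le_trans (leeD half half').
rewrite -ge0_muleDr//; last 2 first.
- by rewrite sume_ge0// => k _; rewrite mule_ge0.
- by rewrite sume_ge0// => k _; rewrite mule_ge0.
rewrite lee_wpmul2l ?lee_fin ?exprn_ge0// -big_split/=; apply: lee_sum => k _.
have mI (A : set R) l : measurable A -> measurable (A `&` cell l).
  by move=> mA; exact: measurableI.
rewrite -!(product_measure1E P P)//; try exact: mI.
pose PP : probability (R * R)%type R := (P \x P)%E.
have mX (A A' : set R) l l' : measurable A -> measurable A' ->
    measurable ((A `&` cell l) `*` (A' `&` cell l')).
  by move=> mA mA'; apply: measurableX; exact: mI.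
apply: (@le_trans _ _ (PP (((L `&` cell k) `*` (U `&` cell (s k))) `|`
    ((U `&` cell k) `*` (L `&` cell (s k)))))); last by apply: measureU2; exact: mX.
have mbtw : measurable [set p | between p z].
  rewrite (_ : [set p | _] = (`]-oo, z[ `*` `]z, +oo[) `|` (`]z, +oo[ `*` `]-oo, z[)).
    by apply: measurableU; exact: measurableX.
  apply/seteqP; split=> [[w y]|[w y]]; rewrite /between/= !in_itv/= !andbT.
    by move=> /orP[/andP[-> ->]|/andP[-> ->]]; [left|right].
  by move=> [[-> ->]//|[-> ->]]; rewrite orbT.
apply: (@le_measure _ _ _ PP); rewrite ?inE.
- by apply: measurableI => //; exact: mX.
- by apply: measurableU; exact: mX.
move=> [w y] [/= [[_ wk] [_ yk]] b].
have /ler_normlP[wy yw] : (`|F w - F y| <= d)%R by apply: sd; rewrite yk wk.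
move: b; rewrite /between/= => /orP[/andP[wz zy]|/andP[yz zw]]; [left|right].
  have := F_inc wz; have := F_inc zy => ? ?.
  by rewrite /U/L/= in_itv/= zy; do 2 split => //; lra.
have := F_inc yz; have := F_inc zw => ? ?.
by rewrite /U/L/= in_itv/= zw; do 2 split => //; lra.
Qed.

(* A path from [B] to the complement of its [r]-neighbourhood [C] spends a
   length at least [r] in [C \ B]. *)
Lemma flux_enlargement s (d r : R) B C : (0 <= d)%R -> (0 < r)%R -> bijective s ->
  measurable B -> measurable C -> B `<=` C ->
  (forall x z, B x -> `|z - x| < r -> C z)%R ->
  (forall w y, bits P m y = s (bits P m w) -> `|F w - F y| <= d)%R ->
  r%:E * flux s B <= r%:E * P (C `\` B) +
    \int[leb]_(z in C `\` B) (2 * Num.min (tail z) d)%R%:E.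
Proof.
move=> d0 r0 bs mB mC BC BrC sd.
have mc := measurable_cell F_cont.
have mD : measurable (C `\` B) by exact: measurableD.
have mBc : measurable (~` B) by exact: measurableC.
have mCc : measurable (~` C) by exact: measurableC.
have mI (A : set R) l : measurable A -> measurable (A `&` cell l).
  by move=> mA; exact: measurableI.
(* [S1] counts the jumps that stay in the neighbourhood [C], which its added mass pays for; only the
   jumps in [S2], which leave [C], are sure to cross a length [r]. *)
pose S1 := \sum_k P (B `&` cell k) * P ((C `\` B) `&` cell (s k)).
pose S2 := \sum_k P (B `&` cell k) * P (~` C `&` cell (s k)).
have S10 : 0 <= S1 by rewrite sume_ge0// => k _; rewrite mule_ge0.
have S20 : 0 <= S2 by rewrite sume_ge0// => k _; rewrite mule_ge0.
have m20 : 0 <= (2 ^+ m)%R%:E :> \bar R by rewrite lee_fin exprn_ge0.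
have r0' : 0 <= r%:E by rewrite lee_fin ltW.
have fluxE : flux s B <= (2 ^+ m)%R%:E * S1 + (2 ^+ m)%R%:E * S2.
  rewrite -ge0_muleDr// lee_wpmul2l// -big_split/=; apply: lee_sum => k _.
  rewrite -ge0_muleDr// lee_wpmul2l//.
  apply: (@le_trans _ _ (P (((C `\` B) `&` cell (s k)) `|` (~` C `&` cell (s k))))).
    rewrite le_measure ?inE//; [exact: mI|by apply: measurableU; exact: mI|].
    move=> x [Bx kx]; have [Cx|Cx] := pselect (C x); first by left.
    by right.
  by apply: measureU2; exact: mI.
apply: (le_trans (lee_wpmul2l r0' fluxE)).
rewrite ge0_muleDr; [|exact: mule_ge0|exact: mule_ge0].
apply: leeD; first by rewrite lee_wpmul2l//; exact: sum_cell_le_r.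
rewrite muleCA.
pose G k z := (P \x P) (((B `&` cell k) `*` (~` C `&` cell (s k))) `&`
    [set p | between p z]).
have mG k : measurable_fun (C `\` B) (G k).
  by apply: measurable_funTS; apply: measurable_fun_between; exact: mI.
have G0 k z : 0 <= G k z by exact: measure_ge0.
apply: (@le_trans _ _ ((2 ^+ m)%R%:E * \sum_k \int[leb]_(z in C `\` B) G k z)).
  rewrite lee_wpmul2l// ge0_sume_distrr; last by move=> k _; rewrite mule_ge0.
  apply: lee_sum => k _; apply: jump_tonelli; [exact: mI|exact: mI|exact: mD|exact: ltW|].
  by move=> w y [Bw _] [Cy _]; exact: lebesgue_gap BrC Bw Cy.
rewrite -ge0_integral_sum// -ge0_integralZl//; last 2 first.
- by apply: emeasurable_sum.
- by move=> z _; rewrite sume_ge0.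
apply: ge0_le_integral => //.
- by move=> z _; rewrite mule_ge0// sume_ge0.
- by apply: measurable_funeM; exact: emeasurable_sum.
- by apply/measurable_EFinP/measurable_funTS; exact: measurable_tail_min.
- by move=> z _; apply: cell_between.
Qed.

End resample.

(** * Tails of the Boltzmann measure *)

Section boltzmann_dist.
Context {R : realType} (rho : R) (rho1 : 1 <= rho).
Local Notation leb := (@lebesgue_measure R).
Local Notation P := (boltzmann rho1).
Local Notation F := (dist_fun (boltzmann rho1)).
Local Notation pdf := (boltzmann_pdf rho).
Local Notation c0 := ((2 * euler_gamma (1 + rho^-1))^-1).

Let rho0 : 0 < rho. Proof. exact: lt_le_trans rho1. Qed.

Lemma boltzmann_const_gt0 : 0 < c0.
Proof. by rewrite invr_gt0 mulr_gt0// euler_gamma_gt0. Qed.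

Lemma boltzmann_pdf_gt0 x : 0 < pdf x.
Proof. by rewrite mulr_gt0 ?boltzmann_const_gt0 ?expR_gt0. Qed.

Lemma boltzmann_pdf_le x y : `|x| <= `|y| -> pdf y <= pdf x.
Proof.
move=> xy; rewrite ler_wpM2l ?(ltW boltzmann_const_gt0)// ler_expR lerN2.
by rewrite ge0_ler_powR ?nnegrE// ltW.
Qed.

Lemma boltzmann_pdfN x : pdf (- x) = pdf x.
Proof. by rewrite /boltzmann_pdf normrN. Qed.

Lemma boltzmann_opp (A : set R) : measurable A ->
  P ((-%R : R -> R) @^-1` A) = P A.
Proof.
move=> mA; rewrite /boltzmann.
under eq_integral do rewrite -boltzmann_pdfN.
transitivity (\int[pushforward leb (-%R : R -> measurableTypeR R)]_(x in A) (pdf x)%:E)%E.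
  rewrite ge0_integral_pushforward//.
  - by apply/measurable_EFinP/measurable_funTS; exact: measurable_boltzmann_pdf.
  - by move=> x _; rewrite lee_fin boltzmann_pdf_ge0.
by apply: eq_measure_integral => B mB _; exact: lebesgue_measureN.
Qed.

Lemma boltzmann_itv_bounds x y (a b : R) : x <= y ->
  (forall z, x <= z <= y -> a <= pdf z <= b) -> 0 <= a ->
  ((a * (y - x))%:E <= P `]x, y]%classic <= (b * (y - x))%:E)%E.
Proof.
move=> xy ab a0.
have b0 : 0 <= b.
  by have /andP[h1 h2] : a <= pdf x <= b by [apply: ab; rewrite lexx]; lra.
have lebxy : leb `]x, y]%classic = (y - x)%:E.
  rewrite lebesgue_measure_itv/= lte_fin; case: ifPn => [_|]; first by rewrite -EFinB.
  by rewrite -leNgt => yx; congr EFin; lra.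
have mI : measurable (`]x, y]%classic : set R) by exact: measurable_itv.
have mpdf : measurable_fun (`]x, y]%classic : set R) (EFin \o pdf).
  by apply/measurable_EFinP/measurable_funTS; exact: measurable_boltzmann_pdf.
have inI z : z \in (`]x, y]%classic : set R) -> x <= z <= y.
  by rewrite inE/= in_itv/= => /andP[/ltW -> ->].
apply/andP; split.
  rewrite EFinM -lebxy -integral_cst//; apply: ge0_le_integral => //.
  - by move=> z /mem_set/inI/ab/andP[].
rewrite EFinM -lebxy -integral_cst//; apply: ge0_le_integral => //.
- by move=> z _; rewrite lee_fin boltzmann_pdf_ge0.
- by move=> z /mem_set/inI/ab/andP[].
Qed.

Lemma dist_fun_diff x y : x <= y -> P `]x, y]%classic = (F y - F x)%:E.
Proof.
move=> xy; rewrite EFinB -!dist_funE.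
rewrite (_ : `]-oo, y]%classic = `]-oo, x]%classic `|` `]x, y]%classic); last first.
  by rewrite -itv_bndbnd_setU.
rewrite measureU//; last first.
  by apply/seteqP; split=> // z; rewrite /= !in_itv/=; lra.
by rewrite [X in (X - _)%E]addeC addeK// fin_num_measure.
Qed.

Lemma boltzmann_dist_inc : {homo F : x y / x < y}.
Proof.
move=> x y xy; rewrite -subr_gt0 -lte_fin -dist_fun_diff ?(ltW xy)//.
pose M := Num.max `|x| `|y|.
have M0 : 0 <= M by rewrite le_max normr_ge0.
have /andP[h _] : ((pdf M * (y - x))%:E <= P `]x, y]%classic <= (c0 * (y - x))%:E)%E.
  apply: boltzmann_itv_bounds; [exact: ltW| |exact: boltzmann_pdf_ge0].
  move=> z /andP[xz zy]; apply/andP; split.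
    apply: boltzmann_pdf_le; rewrite (ger0_norm M0) /M le_max !ler_norml.
    by have := ler_norm y; have := lerNnormlW (lexx `|x|) ; lra.
  by rewrite ler_piMr ?(ltW boltzmann_const_gt0)// -expR0 ler_expR oppr_le0 powR_ge0.
by apply: lt_le_trans h; rewrite lte_fin mulr_gt0 ?boltzmann_pdf_gt0 ?subr_gt0.
Qed.

Lemma boltzmann_dist_lipschitz x y : x <= y -> F y - F x <= c0 * (y - x).
Proof.
move=> xy; rewrite -lee_fin -dist_fun_diff//.
have /andP[] // : ((0 * (y - x))%:E <= P `]x, y]%classic <= (c0 * (y - x))%:E)%E.
apply: boltzmann_itv_bounds => // z _; rewrite boltzmann_pdf_ge0//=.
by rewrite ler_piMr ?(ltW boltzmann_const_gt0)// -expR0 ler_expR oppr_le0 powR_ge0.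
Qed.

Lemma boltzmann_dist_cont : continuous F.
Proof.
have lip x y : `|F x - F y| <= c0 * `|x - y|.
  wlog xy : x y / x <= y.
    by move=> H; have [/H//|/ltW/H] := leP x y; rewrite distrC [`|x - y|]distrC.
  have := dist_fun_le boltzmann_dist_inc xy => Fxy.
  rewrite distrC ger0_norm ?subr_ge0// distrC ger0_norm ?subr_ge0//.
  exact: boltzmann_dist_lipschitz.
move=> x; apply/cvgrPdist_lt => e e0.
near=> y; apply: (le_lt_trans (lip x y)).
rewrite mulrC -ltr_pdivlMr ?boltzmann_const_gt0//.
near: y; apply: cvgr_dist_lt => //; first by rewrite divr_gt0 ?boltzmann_const_gt0.
Unshelve. all: by end_near. Qed.

Lemma integral_expRM_itvcy (a z : R) : 0 < a ->
  (\int[leb]_(x in `[z, +oo[) (expR (- (a * x)))%:E = (a^-1 * expR (- (a * z)))%:E)%E.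
Proof.
move=> a0; have an0 : a != 0 by rewrite gt_eqF.
have dF (x : R) :
    is_derive x 1 (fun x => - (a^-1 * expR (- (a * x)))) (expR (- (a * x))).
  by apply: is_derive_eq; rewrite /GRing.scale/=; field.
have cE : continuous (fun x : R => expR (- (a * x))).
  move=> x; apply: continuous_comp; last exact: continuous_expR.
  by apply: cvgN; apply: cvgMr; exact: cvg_id.
rewrite (@ge0_continuous_FTC2y _ _ (fun x => - (a^-1 * expR (- (a * x)))) _ 0).
- by rewrite EFinN oppeK add0e.
- by move=> x _; exact: expR_ge0.
- exact: continuous_subspaceT.
- rewrite -[X in _ --> X]oppr0; apply: cvgN; rewrite -[X in _ --> X](mulr0 a^-1).
  apply: cvgMr; apply: (@cvg_comp _ _ _ (fun x => a * x) (fun x => expR (- x)) _ +oo).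
    by apply: gt0_cvgMry => //; exact: cvg_id.
  exact: cvgr_expR.
- by move=> x _; exact: ex_derive.
- by apply: cvgN; apply: cvgMr; apply/cvg_at_right_filter; exact: cE.
- by move=> x _; rewrite derive1E; exact: derive_val.
Qed.

(** Writing a power [rho] as [x] times its power [rho - 1], which is nondecreasing, gives [x ^ rho -
    z ^ rho >= z ^ (rho - 1) * (x - z)]. Integrated, this exponential decay yields the tail
    estimate. *)
Lemma boltzmann_pdf_decay z x : 0 <= z <= x ->
  pdf x <= pdf z * expR (- (z `^ (rho - 1) * (x - z))).
Proof.
move=> /andP[z0 zx]; have x0 := le_trans z0 zx.
rewrite /boltzmann_pdf -mulrA ler_wpM2l ?(ltW boltzmann_const_gt0)//.
rewrite -expRD ler_expR !ger0_norm// -!(mulr_powRB1 _ rho0)//.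
have : z `^ (rho - 1) <= x `^ (rho - 1).
  by apply: ge0_ler_powR; rewrite ?nnegrE ?subr_ge0.
by nra.
Qed.

Lemma boltzmann_tail_pos z : 0 < z -> 1 - F z <= pdf z / z `^ (rho - 1).
Proof.
move=> z0; set a := z `^ (rho - 1); have a0 : 0 < a by exact: powR_gt0.
rewrite -lee_fin EFinB -dist_funE -probability_setC// setCitvl.
apply: (@le_trans _ _ (P `[z, +oo[%classic)).
  by rewrite le_measure ?inE// => x; rewrite /= !in_itv/= !andbT; exact: ltW.
apply: (@le_trans _ _ (\int[leb]_(x in `[z, +oo[)
    ((pdf z * expR (a * z))%:E * (expR (- (a * x)))%:E))%E).
  apply: ge0_le_integral => //.
  - by move=> x _; rewrite lee_fin boltzmann_pdf_ge0.
  - by apply/measurable_EFinP/measurable_funTS; exact: measurable_boltzmann_pdf.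
  - apply: measurable_funeM; apply/measurable_EFinP/measurable_funTS.
    by apply: measurableT_comp => //; apply: measurableT_comp => //; exact: measurable_funM.
  move=> x; rewrite /= in_itv/= andbT => zx; rewrite -EFinM lee_fin.
  rewrite -mulrA -expRD (_ : a * z - a * x = - (a * (x - z))); last by ring.
  by apply: boltzmann_pdf_decay; rewrite (ltW z0).
rewrite ge0_integralZl//; last 2 first.
- apply/measurable_EFinP/measurable_funTS.
  by apply: measurableT_comp => //; apply: measurableT_comp => //; exact: measurable_funM.
- by rewrite lee_fin mulr_ge0 ?expR_ge0 ?boltzmann_pdf_ge0.
rewrite integral_expRM_itvcy// -EFinM lee_fin.
by rewrite mulrACA -expRD subrr expR0 mulr1.
Qed.

Lemma boltzmann_tail z : z != 0 ->
  Num.min (F z) (1 - F z) <= pdf z / `|z| `^ (rho - 1).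
Proof.
move=> zn0; have [z0|z0|z0] := ltgtP z 0; last by rewrite z0 eqxx in zn0.
  apply: (@le_trans _ _ (F z)); first by rewrite ge_min lexx.
  rewrite ltr0_norm// -boltzmann_pdfN.
  apply: le_trans (boltzmann_tail_pos _); last by rewrite oppr_gt0.
  have Fz : P `]-oo, z]%classic = (F z)%:E by exact: dist_funE.
  rewrite -lee_fin EFinB -(probability_lt boltzmann_dist_cont (- z)) -probability_setC//.
  rewrite setCitvl -Fz -(boltzmann_opp (measurable_itv `]-oo, z])).
  rewrite le_eqVlt; apply/orP; left; apply/eqP; congr (boltzmann rho1 _).
  by apply/seteqP; split=> x; rewrite /= !in_itv/= andbT lerNl.
rewrite gtr0_norm//; apply: (@le_trans _ _ (1 - F z)); first by rewrite ge_min lexx orbT.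
exact: boltzmann_tail_pos.
Qed.

Lemma tail_le1 z : Num.min (F z) (1 - F z) <= 1.
Proof.
by rewrite ge_min (ltW (dist_fun_lt1 boltzmann_dist_inc z)).
Qed.

Lemma tail_ge0 z : 0 <= Num.min (F z) (1 - F z).
Proof.
by rewrite le_min dist_fun_ge0 subr_ge0 (ltW (dist_fun_lt1 boltzmann_dist_inc z)).
Qed.

End boltzmann_dist.

(** * Tails truncated at powers of two *)

Lemma sum_min_geometric {R : realFieldType} (u : R) (J m : nat) : 0 <= u ->
  \sum_(j < m) Num.min u (2 ^- j) <= J%:R * u + 2 / 2 ^+ J.
Proof.
move=> u0; have [mJ|Jm] := leqP m J.
  apply: (@le_trans _ _ (m%:R * u)).
    rewrite -[m in leRHS]card_ord mulr_natl -sumr_const ler_sum// => j _.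
    by rewrite ge_min lexx.
  apply: (@le_trans _ _ (J%:R * u)); first by rewrite ler_wpM2r// ler_nat.
  by rewrite lerDl divr_ge0// exprn_ge0.
(* From index [J] on, the terms are bounded by a geometric series of sum [2 / 2 ^+ J]; keeping its
   remainder makes the induction on [k] work. *)
suff H k : \sum_(j < J + k) Num.min u (2 ^- j) <=
    J%:R * u + 2 / 2 ^+ J - 2 / 2 ^+ (J + k).
  rewrite -(subnKC (ltnW Jm)); apply: (le_trans (H _)).
  by rewrite gerBl divr_ge0// exprn_ge0.
elim: k => [|k IH].
  rewrite addn0 addrK -[J in leRHS]card_ord mulr_natl -sumr_const ler_sum// => j _.
  by rewrite ge_min lexx.
rewrite addnS big_ord_recr/= exprS invfM.
have : Num.min u (2 ^- (J + k)) <= 2 ^- (J + k) by rewrite ge_min lexx orbT.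
lra.
Qed.

Section tail_sums.
Context {R : realType}.

(* Here [u] is the tail of the Boltzmann measure at a point [z], [c * expR (- y)]
   is its density at [z] and [y = `|z| `^ rho]. *)
Variables (a c y u : R) (m : nat).
Hypotheses (a01 : 0 <= a <= 1) (c0 : 0 < c) (y0 : 0 <= y) (m0 : (0 < m)%N).
Hypotheses (u0 : 0 <= u) (u1 : u <= 1).
Hypothesis uy : 0 < y -> u <= c * expR (- y) / y `^ (1 - a).

Let mR : 0 < m%:R :> R. Proof. by rewrite ltr0n. Qed.
Let a0 : 0 <= a. Proof. by case/andP: a01. Qed.
Let a1 : 0 <= 1 - a. Proof. by case/andP: a01; rewrite subr_ge0. Qed.

Let powm x : 0 < x -> x / x `^ (1 - a) = x `^ a.
Proof.
move=> x0; rewrite -{1}[x]powRr1 ?(ltW x0)// -powRB ?opprB; last first.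
  by rewrite (gt_eqF x0) implybT.
by rewrite addrCA subrr addr0.
Qed.

Let e4 : expR 1 <= 4 :> R.
Proof.
have := @expR_ge1Dx R (- 2^-1); rewrite expRN => h.
have e : expR 1 = expR 2^-1 * expR 2^-1 :> R by rewrite -expRD; congr expR; lra.
have e0 := @expR_gt0 R 2^-1.
have h2 : expR 2^-1 <= 2 :> R.
  have : 2^-1 <= (expR 2^-1)^-1 :> R by lra.
  by rewrite lef_pV2 ?posrE.
by rewrite e; nra.
Qed.

Let exp2 n : expR (n%:R / 2) <= 2 ^+ n :> R.
Proof.
have h2 : expR 2^-1 <= 2 :> R.
  rewrite -ler_sqr ?nnegrE ?expR_ge0// -expRM_natl.
  rewrite (_ : 2 * 2^-1 = 1 :> R); last by lra.
  by have := e4; lra.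
by rewrite mulrC expRM_natr lerXn2r// nnegrE ?expR_ge0.
Qed.

(** Two regimes. If [y >= m / 4], the tail bound already gains [y ^ (1 - a)], which is [m ^ (1 - a)]
    up to a factor 4. If [y < m / 4], then [2 ^- m] is smaller than [expR (- y)] by the factor
    [expR (m / 4)], because [expR (m / 2) <= 2 ^ m]. *)
Lemma tail_min_le : Num.min u (2 ^- m) <= (4 + 4 / c) / m%:R `^ (1 - a) * (c * expR (- y)).
Proof.
have ey := expR_gt0 (- y).
have [ym|my] := leP (m%:R / 4) y.
  have yp : 0 < y by apply: lt_le_trans ym; rewrite divr_gt0.
  apply: (@le_trans _ _ u); first by rewrite ge_min lexx.
  apply: (le_trans (uy yp)).
  rewrite [leRHS]mulrC ler_wpM2l ?mulr_ge0 ?(ltW c0) ?(ltW ey)//.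
  rewrite -div1r ler_pdivrMr ?powR_gt0//.
  rewrite mulrAC ler_pdivlMr ?powR_gt0// mul1r.
  apply: (@le_trans _ _ ((4 * y) `^ (1 - a))).
    by apply: ge0_ler_powR; rewrite ?nnegrE//; lra.
  rewrite powRM//; apply: ler_wpM2r; first exact: powR_ge0.
  apply: (@le_trans _ _ 4); last by rewrite lerDl divr_ge0// ltW.
  by apply: ler1_powR; have := a0; lra.
apply: (@le_trans _ _ (2 ^- m)); first by rewrite ge_min lexx orbT.
rewrite mulrAC ler_pdivlMr ?powR_gt0//.
apply: (@le_trans _ _ (4 * expR (- y))); last first.
  rewrite mulrA ler_wpM2r ?(ltW ey)// mulrDl divfK ?gt_eqF//.
  by rewrite lerDr mulr_ge0// ltW.
apply: (@le_trans _ _ (2 ^- m * m%:R)).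
  rewrite ler_wpM2l ?invr_ge0 ?exprn_ge0//; apply: ler1_powR; rewrite ?ler1n//; have := a0; lra.
rewrite mulrC ler_pdivrMr ?exprn_gt0//.
apply: (@le_trans _ _ (4 * expR (m%:R / 4))).
  by have := @expR_ge1Dx R (m%:R / 4); lra.
rewrite -mulrA ler_wpM2l//.
apply: (@le_trans _ _ (expR (- y) * expR (m%:R / 2))).
  by rewrite -expRD ler_expR; lra.
by rewrite ler_wpM2l ?(ltW ey).
Qed.

(** If [y >= m], the tail bound serves for all [m] terms, and [m / m ^ (1 - a) = m ^ a]. Otherwise
    it serves for the first [J] terms, with [J] about [2 * y], for a total of order [y ^ a] times
    the density when [y >= 1]; the remaining terms are geometric. *)
Lemma tail_sum_le : \sum_(j < m) Num.min u (2 ^- j) <=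
  (3 + 16 / c) * m%:R `^ a * (c * expR (- y)).
Proof.
have ey := expR_gt0 (- y).
have ma1 : 1 <= m%:R `^ a :> R.
  by rewrite -[leLHS](powRr0 m%:R); apply: ler_powR; rewrite ?ler1n.
have cc : (3 + 16 / c) * c = 3 * c + 16 by field; rewrite gt_eqF.
have -> : (3 + 16 / c) * m%:R `^ a * (c * expR (- y)) =
    m%:R `^ a * (3 * c + 16) * expR (- y) by rewrite -cc; ring.
have [my|ym] := leP m%:R y.
  have yp : 0 < y by exact: lt_le_trans my.
  apply: (@le_trans _ _ (m%:R * u)).
    rewrite -[m in leRHS]card_ord mulr_natl -sumr_const ler_sum// => j _.
    by rewrite ge_min lexx.
  apply: (@le_trans _ _ (m%:R * (c * expR (- y) / m%:R `^ (1 - a)))).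
    rewrite ler_wpM2l ?(ltW mR)//; apply: (le_trans (uy yp)).
    rewrite ler_wpM2l ?mulr_ge0 ?(ltW c0) ?(ltW ey)// lef_pV2 ?posrE ?powR_gt0//.
    by apply: ge0_ler_powR; rewrite ?nnegrE// ltW.
  rewrite mulrCA powm//.
  have : 0 < c * expR (- y) * m%:R `^ a by rewrite !mulr_gt0// powR_gt0.
  have : 0 < m%:R `^ a * expR (- y) by rewrite mulr_gt0// powR_gt0.
  lra.
have y20 : 0 <= 2 * y by have := y0; lra.
(* Since [2 * y < J], the geometric remainder [2 / 2 ^+ J] is at most [2 * expR (- y)]. *)
set J := (Num.truncn (2 * y)).+1.
have /andP[J1 J2] : 2 * y < J%:R <= 2 * y + 1.
  by have /andP[h1 h2] := truncn_itv y20; rewrite /J h2 -natr1 lerD2r h1.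
apply: (le_trans (sum_min_geometric J m u0)).
have h2J : 2 / 2 ^+ J <= 2 * expR (- y).
  rewrite ler_wpM2l// expRN lef_pV2 ?posrE ?expR_gt0 ?exprn_gt0//.
  by apply: (le_trans _ (exp2 J)); rewrite ler_expR; lra.
have [y1|y1] := leP 1 y.
  have yp : 0 < y by lra.
  have hJ : J%:R * u <= 3 * (c * expR (- y)) * m%:R `^ a.
    apply: (@le_trans _ _ (3 * y * (c * expR (- y) / y `^ (1 - a)))).
      by apply: ler_pM => //; [lra|exact: uy].
    rewrite (_ : 3 * y * _ = 3 * (c * expR (- y)) * (y / y `^ (1 - a))); last by ring.
    rewrite powm// ler_wpM2l ?mulr_ge0 ?(ltW c0) ?(ltW ey)//.
    by apply: ge0_ler_powR; rewrite ?nnegrE// ltW.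
  have : expR (- y) <= m%:R `^ a * expR (- y) by rewrite ler_peMl// ltW.
  lra.
(* The tail bound blows up near 0, but for [y < 1] one has [J <= 3], [u <= 1] and
   [expR (- y) >= 1 / 4]. This gives [12 * expR (- y)], and [12 + 2 <= 16]. *)
have hJ : J%:R * u <= 3 by apply: (@le_trans _ _ J%:R); [rewrite ler_piMr|lra].
have e1 : 4^-1 <= expR (- y).
  rewrite expRN lef_pV2 ?posrE ?expR_gt0//; apply: le_trans e4.
  by rewrite ler_expR ltW.
have : expR (- y) <= m%:R `^ a * expR (- y) by rewrite ler_peMl// ltW.
have : 0 < m%:R `^ a * expR (- y) * c by rewrite !mulr_gt0// powR_gt0.
lra.
Qed.

End tail_sums.

(** * Flux along a coordinate *)

Section boltzmann_flux.
Context {R : realType} (rho : R) (rho_gt1 : 1 < rho).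
Local Notation leb := (@lebesgue_measure R).
Local Notation P := (boltzmann (ltW rho_gt1)).
Local Notation F := (dist_fun P).
Local Notation pdf := (boltzmann_pdf rho).

(** With [c] the normalizing constant of the density, the bracket dominates both [4 + 4 / c] of
    [tail_min_le] and [3 + 16 / c] of [tail_sum_le]. The outer 2 is the one of [cell_between]. *)
Definition isoperimetric_const : R :=
  2 * (4 + 16 / (2 * euler_gamma (1 + rho^-1))^-1).
Local Notation C0 := isoperimetric_const.

Let c0 := boltzmann_const_gt0 (ltW rho_gt1).

Lemma isoperimetric_const_gt0 : 0 < C0.
Proof. by rewrite mulr_gt0// addr_gt0// divr_gt0. Qed.

Let rho0 : 0 < rho. Proof. exact: lt_trans rho_gt1. Qed.

Let a01 : 0 <= rho^-1 <= 1.
Proof. by rewrite invr_ge0 (ltW rho0) invf_le1// ltW. Qed.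

Lemma boltzmann_tail_powR z : 0 < `|z| `^ rho ->
  tail P z <= pdf z / (`|z| `^ rho) `^ (1 - rho^-1).
Proof.
move=> y0; have z0 : z != 0.
  by apply: contraL y0 => /eqP ->; rewrite normr0 powR0 ?ltxx// gt_eqF.
rewrite -powRrM mulrBr mulr1 mulfV ?gt_eqF//; exact: boltzmann_tail.
Qed.

Lemma boltzmann_tail_min (m : nat) z : (0 < m)%N ->
  2 * Num.min (tail P z) (2 ^- m) <= C0 / m%:R `^ (1 - rho^-1) * pdf z.
Proof.
move=> m0.
have h := tail_min_le a01 c0 (powR_ge0 _ _) m0 (@boltzmann_tail_powR z).
rewrite -/(pdf z) in h.
have p0 : 0 <= (m%:R `^ (1 - rho^-1))^-1 * pdf z.
  by rewrite mulr_ge0 ?invr_ge0 ?powR_ge0 ?boltzmann_pdf_ge0// ltW.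
apply: (@le_trans _ _ (2 * ((4 + 4 / (2 * euler_gamma (1 + rho^-1))^-1) /
  m%:R `^ (1 - rho^-1) * pdf z))); first by rewrite ler_wpM2l.
rewrite /C0 -!mulrA ler_wpM2l// ler_wpM2r// lerD2l ler_wpM2r//.
  by rewrite invr_ge0 ltW.
lra.
Qed.

Lemma boltzmann_tail_sum (m : nat) z : (0 < m)%N ->
  \sum_(j < m) 2 * Num.min (tail P z) (2 ^- j) <= C0 * m%:R `^ (rho^-1) * pdf z.
Proof.
move=> m0; rewrite -mulr_sumr.
have h := tail_sum_le a01 c0 (powR_ge0 _ _) m0 (tail_ge0 _ z) (tail_le1 _ z)
  (@boltzmann_tail_powR z).
rewrite -/(pdf z) in h.
have p0 : 0 <= m%:R `^ (rho^-1) * pdf z.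
  by rewrite mulr_ge0 ?powR_ge0 ?boltzmann_pdf_ge0// ltW.
apply: (@le_trans _ _ (2 * ((3 + 16 / (2 * euler_gamma (1 + rho^-1))^-1) *
  m%:R `^ (rho^-1) * pdf z))); first by rewrite ler_wpM2l.
by rewrite /C0 -!mulrA ler_wpM2l// ler_wpM2r// lerD2r; lra.
Qed.

Lemma measurable_tail_min_pow m : measurable_fun setT (fun z => 2 * Num.min (tail P z) (2 ^- m)).
Proof. by apply: measurable_tail_min; exact: boltzmann_dist_cont. Qed.

Section enlargement.
Variables (m : nat) (r : R) (B C : set R).
Hypotheses (m0 : (0 < m)%N) (r0 : 0 < r) (mB : measurable B) (mC : measurable C).
Hypotheses (BC : B `<=` C) (BrC : forall x z, B x -> `|z - x| < r -> C z).
Local Open Scope ereal_scope.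

Lemma integral_density_le (f : R -> R) (a : R) (D : set R) : measurable D ->
  measurable_fun setT f -> (forall z, 0 <= f z <= a * pdf z)%R -> (0 <= a)%R ->
  \int[leb]_(z in D) (f z)%:E <= a%:E * P D.
Proof.
move=> mD mf fa a0; rewrite /boltzmann -ge0_integralZl//.
- apply: ge0_le_integral => //.
  + by move=> z _; rewrite lee_fin; have /andP[] := fa z.
  + exact/measurable_EFinP/measurable_funTS.
  + apply: measurable_funeM; apply/measurable_EFinP/measurable_funTS.
    exact: measurable_boltzmann_pdf.
  by move=> z _; rewrite -EFinM lee_fin; have /andP[] := fa z.
- by apply/measurable_EFinP/measurable_funTS; exact: measurable_boltzmann_pdf.
by move=> z _; rewrite lee_fin boltzmann_pdf_ge0// ltW.
Qed.

(** For the identity, the flux is the probability that resampling within the cell leaves [B]. The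
    two points share all their [m] digits, hence the truncation at [2 ^- m]. *)
Lemma flux_id_enlargement : r%:E * flux P (@id {ffun 'I_m -> bool}) B <=
  (r + C0 / m%:R `^ (1 - rho^-1))%R%:E * P (C `\` B).
Proof.
have mD : measurable (C `\` B) by exact: measurableD.
apply: (le_trans (flux_enlargement (d := 2 ^- m) _ _ _ r0 _ mB mC BC BrC _)).
- exact: boltzmann_dist_cont.
- exact: boltzmann_dist_inc.
- by rewrite invr_ge0 exprn_ge0.
- by exists id.
- move=> w y wy; apply/ltW/(bits_dist (m := m)) => //.
  + exact: boltzmann_dist_inc.
  + by move=> j _; rewrite wy.
have q0 : (0 <= C0 / m%:R `^ (1 - rho^-1))%R.
  by rewrite divr_ge0 ?powR_ge0// ltW// isoperimetric_const_gt0.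
rewrite EFinD ge0_muleDl ?lee_fin ?(ltW r0)// leeD2l//.
apply: integral_density_le => //; first exact: measurable_tail_min_pow.
move=> z; rewrite boltzmann_tail_min// andbT mulr_ge0// le_min tail_ge0/=.
by rewrite invr_ge0 exprn_ge0.
Qed.

Lemma flux_flip_enlargement : r%:E * \sum_(j < m) flux P (flip j) B <=
  (r * m%:R + C0 * m%:R `^ (rho^-1))%R%:E * P (C `\` B).
Proof.
have mD : measurable (C `\` B) by exact: measurableD.
have t0 z (j : nat) : (0 <= 2 * Num.min (tail P z) (2 ^- j))%R.
  by rewrite mulr_ge0// le_min tail_ge0/= invr_ge0 exprn_ge0.
rewrite ge0_sume_distrr; last by move=> j _; exact: flux_ge0.
apply: (@le_trans _ _ (\sum_(j < m) (r%:E * P (C `\` B) +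
    \int[leb]_(z in C `\` B) (2 * Num.min (tail P z) (2 ^- j))%R%:E))).
  apply: lee_sum => j _; apply: (flux_enlargement _ _ _ r0 _ mB mC BC BrC _).
  - exact: boltzmann_dist_cont.
  - exact: boltzmann_dist_inc.
  - by rewrite invr_ge0 exprn_ge0.
  - by exists (flip j); exact: flipK.
  (* Flipping digit [j] keeps the digits before it, hence the truncation at [2 ^- j]. *)
  - move=> w y wy; apply/ltW; rewrite distrC; apply: (bits_dist (m := m)).
    + exact: boltzmann_dist_inc.
    + exact: ltnW.
    + by move=> i ij; rewrite wy ffunE -val_eqE (ltn_eqF ij) addbF.
rewrite big_split/= -ge0_integral_sum//; last 2 first.
- by move=> j; apply/measurable_EFinP/measurable_funTS; exact: measurable_tail_min_pow.
- by move=> j z _; rewrite lee_fin.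
have q0 : (0 <= C0 * m%:R `^ (rho^-1))%R.
  by rewrite mulr_ge0 ?powR_ge0// ltW// isoperimetric_const_gt0.
have rm0 : (0 <= r * m%:R)%R by rewrite mulr_ge0// ltW.
rewrite EFinD ge0_muleDl ?lee_fin//; apply: (@leeD R).
  by rewrite sumr_const card_ord mulrC EFinM -muleA mule_natl.
under eq_integral do rewrite sumEFin.
apply: integral_density_le => //.
  by apply: measurable_sum => j; exact: measurable_tail_min_pow.
by move=> z; rewrite boltzmann_tail_sum// andbT sumr_ge0.
Qed.

End enlargement.
End boltzmann_flux.

Section coordinate_flux.
Context {R : realType} (P : probability R R) (n m : nat).
Local Notation mu := (power_prob P n).
Hypothesis F_cont : continuous (dist_fun P).
Hypothesis F_inc : {homo dist_fun P : x y / x < y}.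
Implicit Types (A G : set 'rV[R]_n) (s : {ffun 'I_m -> bool} -> {ffun 'I_m -> bool}).
Local Open Scope ereal_scope.

Definition cflux s i A : \bar R := \int[mu]_x flux P s (fiber A i x).

Lemma measurable_flux_fiber s i A : measurable A ->
  measurable_fun setT (fun x => flux P s (fiber A i x)).
Proof.
move=> mA; apply: measurable_funeM; apply: emeasurable_sum => k.
apply: emeasurable_funM.
  by apply: measurable_fun_fiber => //; exact: measurable_cell.
apply: (@measurable_fun_fiber _ _ P i (~` A)) => //; first exact: measurableC.
exact: measurable_cell.
Qed.

Lemma cflux_ge0 s i A : 0 <= cflux s i A.
Proof. by apply: integral_ge0 => x _; exact: flux_ge0. Qed.

Lemma cflux_le1 s i A : bijective s -> measurable A -> cflux s i A <= 1.
Proof.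
move=> bs mA; apply: (@le_trans _ _ (\int[mu]_x cst 1 x)).
  apply: ge0_le_integral => //.
  - by move=> x _; exact: flux_ge0.
  - exact: measurable_flux_fiber.
  - by move=> x _; apply: flux_le1 => //; exact: measurable_fiber.
by rewrite integral_cst// mul1e probability_le1.
Qed.

Lemma cflux_le s i A G : bijective s -> measurable A -> measurable G -> A `<=` G ->
  cflux s i A <= cflux s i G + mu (G `\` A).
Proof.
move=> bs mA mG AG; have mGA : measurable (G `\` A) by exact: measurableD.
rewrite -(power_prob_fiber P i mGA) -ge0_integralD//; last 3 first.
- by move=> x _; exact: flux_ge0.
- exact: measurable_flux_fiber.
- have := measurable_fun_fiber P i mGA measurableT.
  by under eq_fun do rewrite setIT.
apply: ge0_le_integral => //.
- by move=> x _; exact: flux_ge0.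
- exact: measurable_flux_fiber.
- apply: emeasurable_funD; first exact: measurable_flux_fiber.
  have := measurable_fun_fiber P i mGA measurableT.
  by under eq_fun do rewrite setIT.
move=> x _; apply: flux_le => //; [exact: measurable_fiber|exact: measurable_fiber|].
by move=> y; exact: AG.
Qed.

(** Permuting the coordinates by [g] preserves the measure and carries a line in direction [g i] to
    a line in direction [i]. *)
Lemma cflux_perm s i A (g : 'S_n) : measurable A ->
  (forall x, A (col_perm g x) <-> A x) -> cflux s (g i) A = cflux s i A.
Proof.
move=> mA gA; rewrite /cflux -[RHS](integral_perm P g)//; last 2 first.
- exact: measurable_flux_fiber.
- by move=> x; exact: flux_ge0.
apply: eq_integral => x _; congr (flux _ _ _); apply/seteqP.
have E y : col_perm g (upd (g i) x y) = upd i (col_perm g x) y.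
  by apply/rowP => j; rewrite !mxE (inj_eq perm_inj).
by split=> y; rewrite /fiber/= -E gA.
Qed.

End coordinate_flux.

(** * Discretization *)

Section discretization.
Context {R : realType} (P : probability R R) (n m : nat).
Local Notation mu := (power_prob P n).
Local Notation F := (dist_fun P).
Hypothesis F_cont : continuous F.
Hypothesis F_inc : {homo F : x y / x < y}.
Local Notation cube := {ffun 'I_n * 'I_m -> bool}.
Implicit Types (A : set 'rV[R]_n) (b : cube) (i : 'I_n) (x : 'rV[R]_n).

Definition row_bits i b : {ffun 'I_m -> bool} := [ffun j => b (i, j)].

Definition pcell b : set 'rV[R]_n := box (fun i => cell P (row_bits i b)).

Lemma measurable_pcell b : measurable (pcell b).
Proof. by apply: measurable_box => i; exact: measurable_cell. Qed.

Lemma pcell_uniq b c x : pcell b x -> pcell c x -> b = c.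
Proof.
move=> bx cx; apply/ffunP => -[i j].
have /ffunP/(_ j) : row_bits i b = row_bits i c by rewrite -(bx i) -(cx i).
by rewrite !ffunE.
Qed.

Lemma pcell_cover x : exists b, pcell b x.
Proof.
exists [ffun ij => bits P m (x 0 ij.1) ij.2] => i.
by apply/ffunP => j; rewrite !ffunE.
Qed.

Local Open Scope ereal_scope.

Lemma probability_pcell b : mu (pcell b) = (2 ^- (n * m))%R%:E.
Proof.
rewrite power_prob_boxE => [|i]; last exact: measurable_cell.
under eq_bigr do rewrite probability_cell//.
by rewrite prodEFin prodr_const card_ord -exprVn -exprM mulnC exprVn.
Qed.

Lemma pcell_partition A : measurable A -> mu A = \sum_b mu (A `&` pcell b).
Proof.
move=> mA; apply: measure_partition => //; first exact: measurable_pcell.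
- exact: pcell_cover.
- by move=> b c x; exact: pcell_uniq.
Qed.

Definition density A b : R := (2 ^+ (n * m) * fine (mu (A `&` pcell b)))%R.

Lemma mu_pcellE A b : measurable A ->
  mu (A `&` pcell b) = (density A b / 2 ^+ (n * m))%:E.
Proof.
move=> mA; rewrite /density mulrAC divff ?mul1r ?expf_neq0// fineK//.
by rewrite fin_num_measure//; apply: measurableI => //; exact: measurable_pcell.
Qed.

Lemma density01 A b : measurable A -> (0 <= density A b <= 1)%R.
Proof.
move=> mA; have X0 : (0 < 2 ^+ (n * m) :> R)%R by exact: exprn_gt0.
rewrite mulr_ge0 ?(ltW X0) ?fine_ge0//=.
have h : mu (A `&` pcell b) <= mu (pcell b).
  rewrite le_measure ?inE//; last exact: measurable_pcell.
  by apply: measurableI => //; exact: measurable_pcell.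
by move: h; rewrite probability_pcell mu_pcellE// lee_fin ler_pdivrMr// mulVf// gt_eqF.
Qed.

Lemma card_bits : #|{: 'I_n * 'I_m}| = (n * m)%N.
Proof. by rewrite card_prod !card_ord. Qed.

Lemma cmean_density A : measurable A -> (cmean (density A))%:E = mu A.
Proof.
move=> mA; rewrite (pcell_partition mA) /cmean card_bits mulr_sumr -sumEFin.
by apply: eq_bigr => b _; rewrite mu_pcellE// mulrC.
Qed.

Definition offcell i b : set 'rV[R]_n :=
  [set x | forall l, l != i -> cell P (row_bits l b) (x 0%R l)].

Lemma measurable_offcell i b : measurable (offcell i b).
Proof.
rewrite (_ : offcell i b = box (fun l => if l == i then setT else cell P (row_bits l b))).
  by apply: measurable_box => l; case: ifP => // _; exact: measurable_cell.
apply/seteqP; split=> [x xb l|x xb l li]; first by case: eqVneq => // /xb.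
by have := xb l; rewrite (negbTE li).
Qed.

Lemma fiber_pcell A i b x : fiber (A `&` pcell b) i x =
  if x \in offcell i b then fiber A i x `&` cell P (row_bits i b) else set0.
Proof.
apply/seteqP; split=> y.
  move=> [Ay xb]; rewrite ifT; last first.
    by rewrite inE => l li; have := xb l; rewrite updE (negbTE li).
  by split => //; have := xb i; rewrite updE eqxx.
case: ifPn => // /[!inE] xb [Ay iy]; split => // l; rewrite updE.
by case: eqP => [->//|/eqP]; exact: xb.
Qed.

Lemma row_bits_flip i j b l :
  row_bits l (flip (i, j) b) = if l == i then flip j (row_bits i b) else row_bits l b.
Proof.
apply/ffunP => h; rewrite !ffunE xpair_eqE; case: eqP => [->|_] /=.
  by rewrite !ffunE.
by rewrite addbF ffunE.
Qed.

Lemma offcell_flip i j b : offcell i (flip (i, j) b) = offcell i b.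
Proof.
apply/seteqP; split=> x xb l li; have := xb l li; rewrite row_bits_flip (negbTE li)//.
Qed.

(** For a fixed [x], the vertices [b] with [x] in [offcell i b] have all their rows except row [i]
    dictated by [x], so they correspond one to one to the patterns of row [i]. *)
Lemma sum_offcell i x (w : {ffun 'I_m -> bool} -> \bar R) :
  \sum_b (\1_(offcell i b) x)%:E * w (row_bits i b) = \sum_k w k.
Proof.
rewrite (partition_big (row_bits i) predT)//=; apply: eq_bigr => k _.
pose bk : cube := [ffun lj => if lj.1 == i then k lj.2 else bits P m (x 0%R lj.1) lj.2].
have bki : row_bits i bk = k by apply/ffunP => j; rewrite !ffunE eqxx.
have xbk : offcell i bk x.
  by move=> l li; apply/ffunP => j; rewrite !ffunE/= (negbTE li).
rewrite (bigD1 bk)/= ?bki// indicE mem_set// mul1e big1 ?adde0// => b /andP[/eqP bi nb].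
rewrite indicE memNset ?mul0e// => xb; move/eqP: nb; apply.
apply/ffunP => -[l j]; rewrite ffunE/=; case: (eqVneq l i) => [->|li].
  by rewrite -bi ffunE.
by have /ffunP/(_ j) := xb l li; rewrite !ffunE.
Qed.

(** The share of the starting cell [b] in [cflux P (flip j) i A]. *)
Let excess i j A b : \bar R := \int[mu]_x ((\1_(offcell i b) x)%:E *
  ((2 ^+ m)%R%:E * (P (fiber A i x `&` cell P (row_bits i b)) *
    P (~` fiber A i x `&` cell P (flip j (row_bits i b)))))).

Let measurable_excess i j A b : measurable A ->
  measurable_fun setT (fun x => (\1_(offcell i b) x)%:E *
  ((2 ^+ m)%R%:E * (P (fiber A i x `&` cell P (row_bits i b)) *
    P (~` fiber A i x `&` cell P (flip j (row_bits i b)))))).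
Proof.
move=> mA; apply: emeasurable_funM.
  by apply/measurable_EFinP/measurable_indic; exact: measurable_offcell.
apply: measurable_funeM; apply: emeasurable_funM.
  by apply: measurable_fun_fiber => //; exact: measurable_cell.
apply: (@measurable_fun_fiber _ _ P i (~` A)) => //; first exact: measurableC.
exact: measurable_cell.
Qed.

Let excess_ge0 i j A b x : 0 <= (\1_(offcell i b) x)%:E *
  ((2 ^+ m)%R%:E * (P (fiber A i x `&` cell P (row_bits i b)) *
    P (~` fiber A i x `&` cell P (flip j (row_bits i b))))).
Proof. by rewrite !mule_ge0// lee_fin// exprn_ge0. Qed.

Let sum_excess i j A : measurable A -> \sum_b excess i j A b = cflux P (flip j) i A.
Proof.
move=> mA; rewrite -ge0_integral_sum//; last by move=> b; exact: measurable_excess.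
apply: eq_integral => x _.
rewrite (sum_offcell i x (fun k => (2 ^+ m)%R%:E * (P (fiber A i x `&` cell P k) *
    P (~` fiber A i x `&` cell P (flip j k))))).
by rewrite -ge0_sume_distrr// => k _; rewrite mule_ge0.
Qed.

(** On each line, let [p] and [p'] be the masses of the fiber in the two cells, and [q'] that of its
    complement in the second. As [p' + q' = 2 ^- m], one has [p = 2 ^+ m * p * (p' + q')], which is
    at most [p' + 2 ^+ m * p * q'] because [p <= 2 ^- m]. *)
Let mu_le_excess i j A b : measurable A ->
  mu (A `&` pcell b) <= mu (A `&` pcell (flip (i, j) b)) + excess i j A b.
Proof.
move=> mA; have mAb c : measurable (A `&` pcell c).
  by apply: measurableI => //; exact: measurable_pcell.
have mP c : measurable_fun setT (fun x => P (fiber (A `&` pcell c) i x)).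
  by have := measurable_fun_fiber P i (mAb c) measurableT; under eq_fun do rewrite setIT.
rewrite -(power_prob_fiber P i (mAb b)) -(power_prob_fiber P i (mAb (flip (i, j) b))).
rewrite -ge0_integralD//; last exact: measurable_excess.
apply: ge0_le_integral => //; first by apply: emeasurable_funD => //; exact: measurable_excess.
move=> x _; rewrite !fiber_pcell offcell_flip row_bits_flip eqxx indicE.
case: ifPn => xb; last by rewrite measure0 adde_ge0// mul0e.
rewrite mul1e; set k := row_bits i b; set B := fiber A i x.
have mB : measurable B by exact: measurable_fiber.
have mc l : measurable (cell P l) by exact: measurable_cell.
pose p := fine (P (B `&` cell P k)); pose p' := fine (P (B `&` cell P (flip j k))).
pose q' := fine (P (~` B `&` cell P (flip j k))).
have pE : P (B `&` cell P k) = p%:E by rewrite fineK// fin_num_measure//; exact: measurableI.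
have p'E : P (B `&` cell P (flip j k)) = p'%:E.
  by rewrite fineK// fin_num_measure//; exact: measurableI.
have q'E : P (~` B `&` cell P (flip j k)) = q'%:E.
  by rewrite fineK// fin_num_measure//; apply: measurableI => //; exact: measurableC.
have X0 : (0 < 2 ^+ m :> R)%R by exact: exprn_gt0.
have pq : (p' + q' = 2 ^- m)%R.
  apply: EFin_inj; rewrite EFinD -p'E -q'E -(probability_cell F_cont F_inc (flip j k)).
  rewrite -measureU//.
  - by rewrite -setIUl setUv setTI.
  - exact: measurableI.
  - by apply: measurableI => //; exact: measurableC.
  - by apply/seteqP; split=> // y [[By _] [nBy _]].
have ple : (p <= 2 ^- m)%R.
  rewrite -lee_fin -pE -(probability_cell F_cont F_inc k) le_measure ?inE//.
  exact: measurableI.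
have p'0 : (0 <= p')%R by exact: fine_ge0.
rewrite pE p'E q'E -!EFinM -EFinD lee_fin.
have e : (2 ^+ m * 2 ^- m = 1 :> R)%R by rewrite mulfV// gt_eqF.
move: X0 e pq ple; set X := (2 ^+ m)%R; set Y := (2 ^- m)%R => X0 e pq ple.
have -> : q' = (Y - p')%R by lra.
have -> : (p' + X * (p * (Y - p')) = p + p' * (1 - X * p) + (X * Y - 1) * p)%R by ring.
have : (X * p <= X * Y)%R by rewrite ler_pM2l.
by rewrite e => h; nra.
Qed.

(** The difference of the densities in [b] and in its flip is bounded in absolute value by the
    excesses of both; each excess is thus counted twice in the sum over [b]. *)
Lemma influence_density i j A : measurable A ->
  (cmean (fun b => `|density A b - density A (flip (i, j) b)|)%R)%:E <=
  2%:E * cflux P (flip j) i A.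
Proof.
move=> mA; have X0 : (0 < 2 ^+ (n * m) :> R)%R by exact: exprn_gt0.
have ex0 b : 0 <= excess i j A b by apply: integral_ge0 => x _; exact: excess_ge0.
apply: (@le_trans _ _ (\sum_b (excess i j A b + excess i j A (flip (i, j) b)))).
  rewrite /cmean card_bits mulr_sumr -sumEFin; apply: lee_sum => b _.
  rewrite -[X in (X * _)%R](gtr0_norm (x := (2 ^+ (n * m))^-1)) ?invr_gt0// -normrM.
  rewrite mulrBr ![((_^-1) * density _ _)%R]mulrC.
  have h1 := mu_le_excess i j b mA; have h2 := mu_le_excess i j (flip (i, j) b) mA.
  rewrite flipK !mu_pcellE// in h1 h2.
  have [->|e1] := eqVneq (excess i j A b) +oo.
    by rewrite addye ?leey// -ltNye (lt_le_trans _ (ex0 _)).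
  have [->|e2] := eqVneq (excess i j A (flip (i, j) b)) +oo.
    by rewrite addey ?leey// -ltNye (lt_le_trans _ (ex0 _)).
  have f1 : excess i j A b \is a fin_num by rewrite ge0_fin_numE// ltey.
  have f2 : excess i j A (flip (i, j) b) \is a fin_num by rewrite ge0_fin_numE// ltey.
  have g1 := ex0 b; have g2 := ex0 (flip (i, j) b).
  move: h1 h2 g1 g2; rewrite -(fineK f1) -(fineK f2) -!EFinD !lee_fin => h1 h2 g1 g2.
  by rewrite ler_norml; lra.
rewrite big_split/= -(reindex_inj (h := flip (i, j)) (F := excess i j A) (P := predT)).
  by rewrite sum_excess// -mule2n mule_natl.
exact: inv_inj (@flipK _ (i, j)).
Qed.

End discretization.

(** * Averaging over cells and the variance it loses *)

Section cell_average.
Context {R : realType} (P : probability R R) (n m : nat).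
Local Notation mu := (power_prob P n).
Local Notation F := (dist_fun P).
Hypothesis F_cont : continuous F.
Hypothesis F_inc : {homo F : x y / x < y}.
Implicit Types (A : set 'rV[R]_n) (i : 'I_n) (x y : 'rV[R]_n) (H G : 'rV[R]_n -> \bar R).

Definition same_cell (w z : R) : bool := bits P m z == bits P m w.

Lemma same_cellE w z : same_cell w z = (bits P m z == bits P m w).
Proof. by []. Qed.

Lemma same_cell_sym w z : same_cell w z = same_cell z w.
Proof. by rewrite /same_cell eq_sym. Qed.

Lemma measurable_same_cell :
  measurable_fun setT (fun p : R * R => ((same_cell p.1 p.2)%:R : R)%:E).
Proof.
apply/measurable_EFinP.
pose f (p : R * R) : R :=
  \sum_(k : {ffun 'I_m -> bool}) \1_(cell P k) p.1 * \1_(cell P k) p.2.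
have mi (k : {ffun 'I_m -> bool}) : measurable_fun setT (\1_(cell P k) : R -> R).
  by apply: measurable_indic; exact: measurable_cell.
have mf : measurable_fun setT f.
  apply: measurable_sum => k; apply: measurable_funM.
    exact: (measurableT_comp (mi k) measurable_fst).
  exact: (measurableT_comp (mi k) measurable_snd).
apply: eq_measurable_fun mf => -[w z] _ /=.
rewrite /f (bigD1 (bits P m w))//= big1 => [|k kw].
  rewrite addr0 !indicE mem_set// mul1r /same_cell.
  by case: eqP => [zw|zw]; [rewrite mem_set|rewrite memNset].
by rewrite indicE memNset ?mul0r// => wk; move/eqP: kw; apply; rewrite -wk.
Qed.

Lemma measurable_same_cellr w :
  measurable_fun setT (fun z : R => ((same_cell w z)%:R : R)%:E).
Proof. exact: (measurableT_comp measurable_same_cell (pair1_measurable w)). Qed.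

Local Opaque same_cell.
Local Open Scope ereal_scope.

Lemma same_cell_ge0 w z : 0 <= ((same_cell w z)%:R : R)%:E.
Proof. by rewrite lee_fin. Qed.

Let X0 : 0 <= (2 ^+ m)%R%:E :> \bar R.
Proof. by rewrite lee_fin exprn_ge0. Qed.

Lemma same_cell_swap (N : \bar R) (f h : R -> \bar R) : 0 <= N ->
  measurable_fun setT f -> measurable_fun setT h ->
  (forall w, 0 <= f w) -> (forall w, 0 <= h w) ->
  \int[P]_w (f w * (N * \int[P]_z (((same_cell w z)%:R : R)%:E * h z))) =
  \int[P]_z (N * (\int[P]_w (((same_cell z w)%:R : R)%:E * f w)) * h z).
Proof.
move=> N0 mf mh f0 h0.
pose K (p : R * R) := N * (f p.1 * (((same_cell p.1 p.2)%:R : R)%:E * h p.2)).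
have mK : measurable_fun setT K.
  apply: measurable_funeM; apply: emeasurable_funM.
    exact: (measurableT_comp mf measurable_fst).
  apply: emeasurable_funM; first exact: measurable_same_cell.
  exact: (measurableT_comp mh measurable_snd).
have K0 p : 0 <= K p by rewrite !mule_ge0// lee_fin.
have := @fubini_tonelli _ _ _ _ R P P K mK K0.
rewrite /fubini_F /fubini_G => T.
have pull (c : \bar R) (g : R -> \bar R) : 0 <= c -> measurable_fun setT g ->
    (forall z, 0 <= g z) ->
    \int[P]_z (N * (c * g z)) = c * (N * \int[P]_z g z).
  move=> c0 mg g0; have mcg : measurable_fun setT (fun z => c * g z).
    exact: measurable_funeM.
  have cg0 z : setT z -> 0 <= c * g z by move=> _; rewrite mule_ge0.
  have E1 := ge0_integralZl P measurableT mcg cg0 N0.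
  have E2 := ge0_integralZl P measurableT mg (fun z _ => g0 z) c0.
  by rewrite E1 E2 muleCA.
have ms (g : R -> \bar R) w : measurable_fun setT g ->
    measurable_fun setT (fun z => ((same_cell w z)%:R : R)%:E * g z).
  by move=> mg; apply: emeasurable_funM; [exact: measurable_same_cellr|exact: mg].
have s0 (g : R -> \bar R) w z : 0 <= g z -> 0 <= ((same_cell w z)%:R : R)%:E * g z.
  by move=> g0; rewrite mule_ge0// lee_fin.
transitivity (\int[P]_w \int[P]_z K (w, z)).
  apply: eq_integral => w _.
  exact: (esym (pull (f w) _ (f0 w) (ms h w mh) (fun z => s0 h w z (h0 z)))).
rewrite T; apply: eq_integral => z _.
transitivity (h z * (N * \int[P]_w (((same_cell z w)%:R : R)%:E * f w))); last first.
  exact: muleC.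
transitivity (\int[P]_w (N * (h z * (((same_cell z w)%:R : R)%:E * f w)))); last first.
  exact: (pull (h z) _ (h0 z) (ms f z mf) (fun w => s0 f z w (f0 w))).
apply: eq_integral => w _; rewrite /K/= same_cell_sym; congr (_ * _).
by rewrite [RHS]muleC [LHS]muleC muleAC.
Qed.

(* Conditional expectation given all coordinates but the [i]-th and the cell of
   the [i]-th one. *)
Definition cellavg i H x : \bar R :=
  (2 ^+ m)%R%:E * \int[P]_y (((same_cell (x 0%R i) y)%:R : R)%:E * H (upd i x y)).

Lemma cellavg_ge0 i H : (forall x, 0 <= H x) -> forall x, 0 <= cellavg i H x.
Proof.
move=> H0 x; rewrite mule_ge0//; apply: integral_ge0 => y _.
by rewrite mule_ge0// lee_fin.
Qed.

Lemma measurable_cellavg i H : measurable_fun setT H -> (forall x, 0 <= H x) ->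
  measurable_fun setT (cellavg i H).
Proof.
move=> mH H0; apply: measurable_funeM.
pose K (p : 'rV[R]_n * R) :=
  ((same_cell (p.1 0%R i) p.2)%:R : R)%:E * H (upd i p.1 p.2).
have mK : measurable_fun setT K.
  apply: emeasurable_funM; last exact: (measurableT_comp mH (measurable_upd i)).
  have m1 : measurable_fun setT (fun p : 'rV[R]_n * R => (p.1 0%R i, p.2)).
    apply/measurable_fun_pairP; split => /=; last exact: measurable_snd.
    exact: (measurableT_comp (measurable_coord _ _) measurable_fst).
  exact: (measurableT_comp measurable_same_cell m1).
have K0 p : 0 <= K p by rewrite mule_ge0// lee_fin.
exact: (@measurable_fun_fubini_tonelli_F _ _ _ _ R P K mK K0).
Qed.

Lemma cellavg_upd i H x w : cellavg i H (upd i x w) =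
  (2 ^+ m)%R%:E * \int[P]_y (((same_cell w y)%:R : R)%:E * H (upd i x y)).
Proof.
rewrite /cellavg updE eqxx; congr (_ * _); apply: eq_integral => y _.
by rewrite upd_upd.
Qed.

Lemma cellavg_le1 i H : measurable_fun setT H -> (forall x, 0 <= H x <= 1) ->
  forall x, cellavg i H x <= 1.
Proof.
move=> mH H01 x; have H0 z : 0 <= H z by have /andP[] := H01 z.
have H1 z : H z <= 1 by have /andP[] := H01 z.
apply: (@le_trans _ _ ((2 ^+ m)%R%:E * P (cell P (bits P m (x 0%R i))))); last first.
  by rewrite probability_cell// -EFinM mulfV// expf_neq0.
rewrite lee_wpmul2l//; have mc := measurable_cell F_cont (bits P m (x 0%R i)).
have -> : P (cell P (bits P m (x 0%R i))) =
    \int[P]_y (\1_(cell P (bits P m (x 0%R i))) y : R)%:E.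
  by rewrite integral_indic// setIT.
apply: ge0_le_integral => //.
- by move=> y _; rewrite mule_ge0// lee_fin.
- apply: emeasurable_funM; first exact: measurable_same_cellr.
  exact: (measurableT_comp mH (measurable_updr i x)).
- by apply/measurable_EFinP/measurable_indic.
move=> y _; rewrite same_cellE indicE; case: eqP => yx.
  by rewrite mul1e mem_set.
by rewrite mul0e lee_fin.
Qed.

(** On each line in direction [i] the averaging kernel is symmetric. This reversibility lets
    [cellavgs_escape] move a step from one factor to the other. *)
Lemma cellavg_selfadjoint i G H : measurable_fun setT G -> measurable_fun setT H ->
  (forall x, 0 <= G x) -> (forall x, 0 <= H x) ->
  \int[mu]_x (G x * cellavg i H x) = \int[mu]_x (cellavg i G x * H x).
Proof.
move=> mG mH G0 H0; have mTG := measurable_cellavg i mG G0.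
have mTH := measurable_cellavg i mH H0.
rewrite -(@integral_upd _ _ P i (fun x => G x * cellavg i H x)); last 2 first.
- exact: emeasurable_funM.
- by move=> x; rewrite mule_ge0// cellavg_ge0.
rewrite -(@integral_upd _ _ P i (fun x => cellavg i G x * H x)); last 2 first.
- exact: emeasurable_funM.
- by move=> x; rewrite mule_ge0// cellavg_ge0.
apply: eq_integral => x _.
under eq_integral do rewrite cellavg_upd.
under [RHS]eq_integral do rewrite cellavg_upd.
apply: same_cell_swap => //.
- exact: (measurableT_comp mG (measurable_updr i x)).
- exact: (measurableT_comp mH (measurable_updr i x)).
Qed.

Definition cellavgs (s : seq 'I_n) H := foldr cellavg H s.

Lemma cellavgs01 s H : measurable_fun setT H -> (forall x, 0 <= H x <= 1) ->
  measurable_fun setT (cellavgs s H) /\ forall x, 0 <= cellavgs s H x <= 1.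
Proof.
move=> mH H01; elim: s => [//|i s [ms s01]] /=.
have s0 x : 0 <= cellavgs s H x by have /andP[] := s01 x.
split; first exact: measurable_cellavg.
by move=> x; rewrite cellavg_ge0//= cellavg_le1.
Qed.

Let ind A x : \bar R := (\1_A x : R)%:E.

Let ind01 A x : 0 <= ind A x <= 1.
Proof. by rewrite /ind !lee_fin indicE ler0n lern1 leq_b1. Qed.

Let ind_ge0 A x : 0 <= ind A x. Proof. by have /andP[] := ind01 A x. Qed.

Let measurable_ind A : measurable A -> measurable_fun setT (ind A).
Proof. by move=> mA; apply/measurable_EFinP/measurable_indic. Qed.

(* A random walk leaves [A] with at most the sum of the probabilities that each
   of its steps does. *)
Lemma cellavgs_escape s A : measurable A ->
  \int[mu]_x (ind A x * cellavgs s (ind (~` A)) x) <=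
  \sum_(i <- s) \int[mu]_x (ind (~` A) x * cellavg i (ind A) x).
Proof.
move=> mA; have mAc : measurable (~` A) by exact: measurableC.
elim: s => [|i s IH].
  rewrite big_nil integral0_eq// => x _ /=; rewrite /ind !indicE in_setC.
  by case: (x \in A); rewrite ?mul0e ?mule0.
have [ms s01] := cellavgs01 s (measurable_ind mAc) (ind01 _).
set h := cellavgs s _ in ms s01 IH *.
have h0 x : 0 <= h x by have /andP[] := s01 x.
have h1 x : h x <= 1 by have /andP[] := s01 x.
have mT := measurable_cellavg i (measurable_ind mA) (ind_ge0 A).
have T0 := cellavg_ge0 i (ind_ge0 A).
have T1 := cellavg_le1 i (measurable_ind mA) (ind01 A).
rewrite /= cellavg_selfadjoint//; [|exact: measurable_ind].
rewrite big_cons addeC; apply: le_trans (leeD IH (lexx _)).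
rewrite -ge0_integralD//; last 4 first.
- by move=> x _; rewrite mule_ge0.
- by apply: emeasurable_funM => //; exact: measurable_ind.
- by move=> x _; rewrite mule_ge0.
- by apply: emeasurable_funM => //; exact: measurable_ind.
apply: ge0_le_integral => //.
- by move=> x _; rewrite mule_ge0.
- exact: emeasurable_funM.
- by apply: emeasurable_funD; apply: emeasurable_funM => //; exact: measurable_ind.
(* On [A], the average of the indicator is at most 1, which leaves the term of the induction
   hypothesis; off [A], [h <= 1] leaves the contribution of direction [i]. *)
move=> x _; rewrite /ind !indicE in_setC; case: (x \in A) => /=.
  by rewrite mul1e mul0e adde0 -[leRHS]mul1e lee_wpmul2r.
by rewrite mul0e add0e mul1e -[leRHS]mule1 lee_wpmul2l.
Qed.

(** On each line both sides are [2 ^+ m] times the sum over the cells of the mass of the fiber times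
    that of its complement; for the identity, entering and leaving [A] are equally likely. *)
Lemma integral_cellavg_indic i A : measurable A ->
  \int[mu]_x (ind (~` A) x * cellavg i (ind A) x) =
  cflux P (@id {ffun 'I_m -> bool}) i A.
Proof.
move=> mA; have mAc : measurable (~` A) by exact: measurableC.
rewrite -(@integral_upd _ _ P i (fun x => ind (~` A) x * cellavg i (ind A) x)); last 2 first.
- apply: emeasurable_funM; first exact: measurable_ind.
  exact: measurable_cellavg (measurable_ind mA) (ind_ge0 A).
- by move=> x; rewrite mule_ge0// cellavg_ge0.
apply: eq_integral => x _; under eq_integral do rewrite cellavg_upd.
set B := fiber A i x; have mB : measurable B by exact: measurable_fiber.
have mc := measurable_cell F_cont.
transitivity (\int[P]_w \sum_(k : {ffun 'I_m -> bool})
    ((2 ^+ m)%R%:E * P (B `&` cell P k)) * (\1_(~` B `&` cell P k) w)%:E).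
  apply: eq_integral => w _.
  rewrite (bigD1 (bits P m w))//= big1 ?adde0 => [|k kw]; last first.
    rewrite indicE memNset ?mule0// => -[_ wk]; move/eqP: kw; apply; exact/esym.
  rewrite muleC; congr (_ * _ * _).
    have -> : P (B `&` cell P (bits P m w)) =
        \int[P]_y (\1_(B `&` cell P (bits P m w)) y : R)%:E.
      by rewrite integral_indic ?setIT//; exact: measurableI.
    apply: eq_integral => y _; rewrite /ind -EFinM !indicE same_cellE.
    have -> : (y \in B `&` cell P (bits P m w)) =
        (upd i x y \in A) && (bits P m y == bits P m w).
      apply/idP/andP; rewrite !inE; first by move=> [By yw]; split => //; exact/eqP.
      by move=> [Ay /eqP yw]; split.
    by rewrite -natrM mulnb andbC.
  rewrite /ind !indicE in_setI [X in _ && X]mem_set// andbT.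
  by congr (nat_of_bool _)%:R%:E; apply/idP/idP; rewrite !inE.
rewrite ge0_integral_sum//; last 2 first.
- move=> k; apply: measurable_funeM; apply/measurable_EFinP/measurable_indic.
  by apply: measurableI => //; exact: measurableC.
- by move=> k w _; rewrite !mule_ge0// lee_fin.
rewrite /flux ge0_sume_distrr; last by move=> k _; rewrite mule_ge0.
apply: eq_bigr => k _; rewrite ge0_integralZl//; last 2 first.
- apply/measurable_EFinP/measurable_indic.
  by apply: measurableI => //; exact: measurableC.
- by rewrite mule_ge0.
rewrite integral_indic//; last by apply: measurableI => //; exact: measurableC.
by rewrite setIT muleA.
Qed.

Definition merge (s : seq 'I_n) x y : 'rV[R]_n :=
  (\row_j (if j \in s then y 0 j else x 0 j))%R.

Definition same_cells (s : seq 'I_n) x y : bool :=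
  all (fun i => same_cell (x 0%R i) (y 0%R i)) s.

Lemma measurable_merge s x : measurable_fun setT (merge s x).
Proof.
apply: measurable_fun_row => j; have [js|/negbTE js] := boolP (j \in s).
  by under eq_fun do rewrite mxE js; exact: measurable_coord.
by under eq_fun do rewrite mxE js; exact: measurable_cst.
Qed.

Lemma measurable_same_cells s x :
  measurable_fun setT (fun y => ((same_cells s x y)%:R : R)%:E).
Proof.
elim: s => [|i s IH].
  by apply: (eq_measurable_fun (cst 1)); [move=> y _|exact: measurable_cst].
have mi : measurable_fun setT (fun y => ((same_cell (x 0%R i) (y 0%R i))%:R : R)%:E).
  exact: (measurableT_comp (measurable_same_cellr (x 0%R i)) (measurable_coord _ _)).
apply: eq_measurable_fun (emeasurable_funM mi IH) => y _.
by rewrite -EFinM -natrM mulnb.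
Qed.

Lemma same_cells_upd s i x y z w : i \notin s ->
  same_cells s (upd i x z) (upd i y w) = same_cells s x y.
Proof.
move=> si; apply: eq_in_all => j js; rewrite !updE.
by case: eqP => // ji; rewrite -ji js in si.
Qed.

(** Averaging in distinct directions one after the other is averaging over a product of cells, with
    a normalization [2 ^+ m] for each direction. *)
Lemma cellavgsE s H x : uniq s -> measurable_fun setT H -> (forall x, 0 <= H x) ->
  cellavgs s H x = (2 ^+ (m * size s))%R%:E *
    \int[mu]_y (((same_cells s x y)%:R : R)%:E * H (merge s x y)).
Proof.
move=> + mH H0; elim: s x => [x _|i s IH x /= /andP[si us]].
  rewrite muln0 expr0 mul1e; transitivity (\int[mu]_y cst (H x) y).
    by rewrite integral_cst// [X in _ * X](@probability_setT _ _ _ mu) mule1.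
  apply: eq_integral => y _; rewrite mul1e /=; congr H.
  by apply/rowP => j; rewrite mxE in_nil.
pose Phi y := ((same_cells (i :: s) x y)%:R : R)%:E * H (merge (i :: s) x y).
have mPhi : measurable_fun setT Phi.
  apply: emeasurable_funM; first exact: measurable_same_cells.
  exact: (measurableT_comp mH (measurable_merge _ _)).
have Phi0 y : 0 <= Phi y by rewrite mule_ge0// lee_fin.
pose K (p : 'rV[R]_n * R) := Phi (upd i p.1 p.2).
have mK : measurable_fun setT K by exact: (measurableT_comp mPhi (measurable_upd i)).
have K0 p : 0 <= K p by exact: Phi0.
(* As [i] is not in [s], the inner integral ignores coordinate [i] of [y], which can be set to [z];
   [integral_upd] then merges the two integrals. *)
have step z : ((same_cell (x 0%R i) z)%:R : R)%:E * cellavgs s H (upd i x z) =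
    (2 ^+ (m * size s))%R%:E * \int[mu]_y K (y, z).
  rewrite IH// muleCA; congr (_ * _).
  have mK' : measurable_fun setT (fun y =>
      ((same_cells s (upd i x z) y)%:R : R)%:E * H (merge s (upd i x z) y)).
    apply: emeasurable_funM; first exact: measurable_same_cells.
    exact: (measurableT_comp mH (measurable_merge _ _)).
  have K'0 y : setT y -> 0 <=
      ((same_cells s (upd i x z) y)%:R : R)%:E * H (merge s (upd i x z) y).
    by move=> _; rewrite mule_ge0// lee_fin.
  rewrite -(ge0_integralZl mu measurableT mK' K'0 (same_cell_ge0 _ _)).
  apply: eq_integral => y _; rewrite /K/Phi/=.
  rewrite updE eqxx muleA -EFinM -natrM mulnb; congr (_%:E * H _).
    have E1 : same_cells s x (upd i y z) = same_cells s x y.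
      by rewrite -{1}(upd_id i x) same_cells_upd.
    have E2 : same_cells s (upd i x z) y = same_cells s x y.
      by rewrite -{1}(upd_id i y) same_cells_upd.
    by rewrite E2 -E1.
  apply/rowP => j; rewrite !mxE in_cons; case: eqP => [->|ji] /=.
    by rewrite (negbTE si).
  by [].
have mG := @measurable_fun_fubini_tonelli_G _ _ _ _ R mu K mK K0.
have G0 z : setT z -> 0 <= fubini_G mu K z by move=> _; apply: integral_ge0.
have N0 : 0 <= (2 ^+ (m * size s))%R%:E :> \bar R by rewrite lee_fin exprn_ge0.
rewrite /cellavg mulnS exprD EFinM -muleA; congr (_ * _).
under eq_integral do rewrite step.
rewrite (ge0_integralZl P measurableT mG G0 N0); congr (_ * _).
have := @fubini_tonelli _ _ _ _ R mu P K mK K0.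
rewrite /fubini_F/fubini_G/= => <-.
exact: integral_upd.
Qed.

Lemma same_cells_pcell (b : {ffun 'I_n * 'I_m -> bool}) x y : pcell P b x ->
  same_cells (enum 'I_n) x y <-> pcell P b y.
Proof.
move=> xb; split=> [/allP xy i|yb].
  have := xy i; rewrite mem_enum same_cellE => /(_ isT) /eqP yx.
  by rewrite /cell/= yx; exact: xb.
by apply/allP => i _; rewrite same_cellE; apply/eqP; rewrite (yb i) (xb i).
Qed.

Lemma density_setC A (b : {ffun 'I_n * 'I_m -> bool}) :
  measurable A -> density P (~` A) b = (1 - density P A b)%R.
Proof.
move=> mA; have Y0 : (0 < 2 ^+ (n * m) :> R)%R by exact: exprn_gt0.
have mb := measurable_pcell F_cont b.
have : mu (pcell P b) = mu (A `&` pcell P b) + mu (~` A `&` pcell P b).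
  rewrite -measureU//.
  - by rewrite -setIUl setUv setTI.
  - exact: measurableI.
  - by apply: measurableI => //; exact: measurableC.
  - by apply/seteqP; split=> // y [[Ay _] [nAy _]].
rewrite probability_pcell// !mu_pcellE//; last exact: measurableC.
rewrite -EFinD => -[] h; have Yn0 := lt0r_neq0 Y0.
have : (2 ^+ (n * m) * 2 ^- (n * m) = density P A b + density P (~` A) b :> R)%R.
  by rewrite h -mulrDl mulrC divfK.
by rewrite mulfV// => ->; rewrite addrAC subrr add0r.
Qed.

(** The measure of [A] minus the mean square of the density is the probability that a point is in
    [A] while its resampling in the same cell is not. Resampling one coordinate after another
    realizes this, so [cellavgs_escape] bounds it by one flux per coordinate. *)
Lemma variance_density A : measurable A ->
  mu A <= (cmean (fun b : {ffun 'I_n * 'I_m -> bool} => density P A b ^+ 2)%R)%:E +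
    \sum_i cflux P (@id {ffun 'I_m -> bool}) i A.
Proof.
move=> mA; have Y0 : (0 < 2 ^+ (n * m) :> R)%R by exact: exprn_gt0.
have mAc : measurable (~` A) by exact: measurableC.
have mb (b : {ffun 'I_n * 'I_m -> bool}) := measurable_pcell F_cont b.
have := cellavgs_escape (enum 'I_n) mA.
under [leRHS]eq_bigr do rewrite integral_cellavg_indic//.
rewrite big_enum/= => esc.
suff <- : (\int[mu]_x (ind A x * cellavgs (enum 'I_n) (ind (~` A)) x) +
    (cmean (fun b : {ffun 'I_n * 'I_m -> bool} => density P A b ^+ 2)%R)%:E)%E = mu A.
  by rewrite addeC leeD2l.
transitivity (\sum_(b : {ffun 'I_n * 'I_m -> bool}) (mu (A `&` pcell P b) *
   ((2 ^+ (n * m))%R%:E * mu (~` A `&` pcell P b))) +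
   (cmean (fun b : {ffun 'I_n * 'I_m -> bool} => density P A b ^+ 2)%R)%:E).
  congr (_ + _); transitivity (\int[mu]_x \sum_(b : {ffun 'I_n * 'I_m -> bool})
      ((2 ^+ (n * m))%R%:E * mu (~` A `&` pcell P b)) *
      (\1_(A `&` pcell P b) x : R)%:E).
    apply: eq_integral => x _.
    rewrite cellavgsE ?enum_uniq//; last exact: measurable_ind.
    have [b xb] := pcell_cover P m x.
    rewrite (bigD1 b)//= big1 ?adde0 => [|c cb]; last first.
      rewrite indicE memNset ?mule0// => -[_ xc]; move/eqP: cb; apply.
      exact: pcell_uniq xc xb.
    rewrite muleC -cardE card_ord mulnC; congr (_ * _ * _).
      have -> : mu (~` A `&` pcell P b) =
          \int[mu]_y (\1_(~` A `&` pcell P b) y : R)%:E.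
        by rewrite integral_indic ?setIT//; exact: measurableI.
      apply: eq_integral => y _; rewrite (_ : merge _ x y = y); last first.
        by apply/rowP => j; rewrite mxE mem_enum.
      rewrite /ind !indicE -EFinM -natrM mulnb andbC in_setI.
      congr ((nat_of_bool (_ && _))%:R%:E).
      by apply/idP/idP; rewrite inE => /(same_cells_pcell y xb).
    by rewrite /ind !indicE in_setI [X in _ && X]mem_set// andbT.
  rewrite ge0_integral_sum//; last 2 first.
  - move=> b; apply: measurable_funeM; apply/measurable_EFinP/measurable_indic.
    exact: measurableI.
  - by move=> b x _; rewrite !mule_ge0 ?lee_fin// ltW.
  apply: eq_bigr => b _; rewrite ge0_integralZl//; last 2 first.
  - by apply/measurable_EFinP/measurable_indic; exact: measurableI.
  - by rewrite mule_ge0 ?lee_fin// ltW.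
  by rewrite integral_indic// ?setIT 1?muleC//; exact: measurableI.
rewrite -(@cmean_density _ P n m F_cont A mA).
under eq_bigr do rewrite !mu_pcellE// density_setC// -!EFinM.
rewrite sumEFin -EFinD; congr (_%:E); rewrite /cmean card_bits !mulr_sumr.
rewrite -big_split/=; apply: eq_bigr => b _.
by field; rewrite gt_eqF.
Qed.

End cell_average.

(** * Enlargements *)

Lemma le_limf_einf {R : realType} (f : R -> \bar R) (c : \bar R) (s0 : R) : 0 < s0 ->
  (forall s, 0 < s < s0 -> (c <= f s)%E) -> (c <= limf_einf f 0%R^'+)%E.
Proof.
move=> s00 cf; rewrite limf_einfE.
have V0 : \forall s \near 0^'+, 0 < s < s0.
  by near=> s; apply/andP; split; near: s; [exact: nbhs_right_gt|exact: nbhs_right_lt].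
apply: (@le_trans _ _ (ereal_inf [set f s | s in [set s | 0 < s < s0]])).
  by apply: le_ereal_inf_tmp => _ [s /cf cs <-].
by apply: ereal_sup_ubound; exists [set s | 0 < s < s0].
Unshelve. all: by end_near. Qed.

Section staircase.
Context {R : realType} {n : nat}.
Implicit Types (A : set 'rV[R]_n) (r : R) (k : nat) (i : 'I_n).

(* Starting from [r] rather than [0] makes these sets open: the sum of a Borel
   set and a coordinate segment need not be Borel. *)
Definition staircase A r k : set 'rV[R]_n :=
  [set x | exists2 a : 'rV[R]_n, A a &
    forall i, `|x 0 i - a 0 i| < if (i < k)%N then 2 * r else r].

Lemma measurable_staircase A r k : measurable (staircase A r k).
Proof.
apply: sub_sigma_algebra; rewrite openE => x [a Aa xa]; rewrite /interior/=.
suff : nbhs x [set y : 'rV[R]_n |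
    forall i, `|y 0 i - a 0 i| < if (i < k)%N then 2 * r else r].
  by apply: filterS => y ya; exists a.
apply: (@filter_forall _ _ (fun i => [set y : 'rV[R]_n |
    `|y 0 i - a 0 i| < if (i < k)%N then 2 * r else r]) (nbhs x)) => i.
have ci : {for x, continuous (fun y : 'rV[R]_n => `|y 0 i - a 0 i|)}.
  apply: continuous_comp; last exact: norm_continuous.
  by apply: continuousB; [exact: coord_continuous|exact: cst_continuous].
exact: (cvgr_lt _ ci _ (xa i)).
Qed.

Lemma staircase0 A r : 0 < r -> A `<=` staircase A r 0.
Proof. by move=> r0 x Ax; exists x => // i; rewrite subrr normr0. Qed.

Lemma staircaseS A r k l : 0 < r -> (k <= l)%N -> staircase A r k `<=` staircase A r l.
Proof.
move=> r0 kl x [a Aa xa]; exists a => // i; apply: lt_le_trans (xa i) _.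
by case: ifPn => ik; [rewrite (leq_trans ik kl)|case: ifP => // _; lra].
Qed.

(** The radius in direction [i] goes from [r] to [2 * r], so along that direction one step contains
    the [r]-neighbourhood of the previous one, as the flux bounds require. *)
Lemma staircase_upd A r i x z : staircase A r i x -> `|z - x 0 i| < r ->
  staircase A r i.+1 (upd i x z).
Proof.
move=> [a Aa xa] zx; exists a => // j; rewrite updE ltnS leq_eqVlt val_eqE.
case: eqVneq => [->|ji] /=; last exact: xa.
have := xa i; rewrite ltnn => xi.
rewrite (_ : z - a 0 i = (z - x 0 i) + (x 0 i - a 0 i)); last by ring.
by apply: (le_lt_trans (ler_normD _ _)); lra.
Qed.

Lemma staircase_minkowski A r : staircase A r n `<=` minkowski_sum A (cube (2 * r)).
Proof.
move=> x [a Aa xa]; exists a => //; exists (x - a); last by rewrite addrC subrK.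
move=> i; rewrite in_itv/= -ler_norml !mxE.
by have := xa i; rewrite ltn_ord => /ltW.
Qed.

End staircase.

(** * The isoperimetric inequality at a fixed scale *)

Section boltzmann_isoperimetry.
Context {R : realType} (rho : R) (rho_gt1 : 1 < rho).
Local Notation P := (boltzmann (ltW rho_gt1)).
Local Notation C0 := (isoperimetric_const rho).

Variables (n m : nat) (A : set 'rV[R]_n).
Local Notation mu := (power_prob P n).
Local Notation idp := (@id {ffun 'I_m -> bool}).
Hypotheses (m0 : (0 < m)%N) (mn : (2 ^ m <= n)%N).
Hypotheses (mA : measurable A) (trA : transitive_set A).

Let F_cont := @boltzmann_dist_cont _ _ (ltW rho_gt1).
Let F_inc := @boltzmann_dist_inc _ _ (ltW rho_gt1).

Let bij_id : bijective idp. Proof. by exists id. Qed.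

Let bij_flip (j : 'I_m) : bijective (flip j).
Proof. by exists (flip j); exact: flipK. Qed.

Let p (i : 'I_n) : R := fine (cflux P idp i A).
Let q (i : 'I_n) (j : 'I_m) : R := fine (cflux P (flip j) i A).

Let cflux_fin s (i : 'I_n) (G : set 'rV[R]_n) : bijective s -> measurable G ->
  cflux P (m := m) s i G \is a fin_num.
Proof.
move=> bs mG; rewrite ge0_fin_numE ?cflux_ge0//.
by rewrite (le_lt_trans (cflux_le1 _ _ i bs mG)) ?ltry.
Qed.

(** Transitivity enters here: some permutation that preserves [A] sends [i'] to [i]. Digit [j] thus
    has the same flux in all blocks, as [kkl_cube] requires of its bounds. *)
Let q_const i i' j : q i j = q i' j.
Proof.
case: trA => G trG inv.
have [g gG ig] := atransP2 trG (finset.in_setT i') (finset.in_setT i).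
have gA x : A (col_perm g x) <-> A x.
  have E : (col_perm g x \in A) = (x \in A).
    have := inv g gG x; rewrite !indicE => /eqP; rewrite eqr_nat.
    by case: (_ \in A); case: (_ \in A).
  by split=> /mem_set h; apply/set_mem; [rewrite -E|rewrite E].
have {}ig : i = g i' by rewrite ig /= apermE.
have E := cflux_perm F_cont (flip j) i' mA gA.
by rewrite /q ig E.
Qed.

Let t : R := fine (mu A).

(* The KKL inequality for the density of [A] on the cells, plus the error made
   by replacing [A] by that density. *)
Lemma variance_le_cflux :
  t * (1 - t) <= \sum_i p i + 416 / m%:R * (\sum_i \sum_j q i j).
Proof.
have n0 : (0 < n)%N by rewrite (leq_trans _ mn)// expn_gt0.
pose i0 := Ordinal n0.
have muA : mu A = t%:E by rewrite fineK// fin_num_measure.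
have tE : cmean (density P (m := m) A) = t.
  by apply: EFin_inj; rewrite cmean_density.
(* An influence of the density is at most twice a flux, hence [416 = 2 * 208]. *)
have kkl := @kkl_cube R n m (density P A) (fun j => 2 * q i0 j) m0 mn
  (fun b => density01 F_cont F_inc b mA).
have h : forall i j, cmean (fun b => `|density P A b - density P A (flip (i, j) b)|) <=
    2 * q i0 j.
  move=> i j; rewrite -lee_fin [leRHS]EFinM (q_const i0 i) /q fineK ?cflux_fin//.
  exact: influence_density.
have := kkl h; rewrite tE => {}kkl.
have := @variance_density R P n m F_cont F_inc A mA.
rewrite muA (eq_bigr (fun i => (p i)%:E)); last by move=> i _; rewrite /p fineK ?cflux_fin.
rewrite sumEFin -EFinD lee_fin => var.
have -> : \sum_i \sum_j q i j = n%:R * \sum_j q i0 j.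
  under eq_bigr do under eq_bigr do rewrite (q_const _ i0).
  by rewrite sumr_const card_ord mulr_natl.
rewrite -mulr_sumr in kkl.
have -> : 416 / m%:R * (n%:R * \sum_j q i0 j) =
  208 / m%:R * (n%:R * (2 * \sum_j q i0 j)) by ring.
by move: kkl var; lra.
Qed.

Section enlargement.
Variable r : R.
Hypothesis r0 : 0 < r.
Local Notation G := (staircase A r).

Let mG k : measurable (G k). Proof. exact: measurable_staircase. Qed.

Let g k : R := fine (mu (G k)).

Let muG k : mu (G k) = (g k)%:E. Proof. by rewrite fineK// fin_num_measure. Qed.

Let muA : mu A = t%:E. Proof. by rewrite fineK// fin_num_measure. Qed.

Let subAG k : A `<=` G k.
Proof. exact: subset_trans (staircase0 r0) (staircaseS r0 (leq0n k)). Qed.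

Let muD (B C : set 'rV[R]_n) : measurable B -> measurable C -> B `<=` C ->
  mu (C `\` B) = (fine (mu C) - fine (mu B))%:E.
Proof.
move=> mB mC BC; rewrite measureD// ?ltey_eq ?fin_num_measure// setIidr//.
by rewrite EFinB !fineK// fin_num_measure.
Qed.

Let g_le k l : (k <= l)%N -> g k <= g l.
Proof.
move=> kl; rewrite -lee_fin -!muG le_measure ?inE//; exact: staircaseS.
Qed.

Let t_le k : t <= g k.
Proof. by rewrite -lee_fin -muG -muA le_measure ?inE. Qed.

(** The staircase bounds the fluxes of [G i], while [variance_le_cflux] asks for those of [A]. The
    loss [g n - t] is uniform in [i], and will be multiplied by [r]. *)
Let cflux_A s i : bijective s -> fine (cflux P (m := m) s i A) <=
  fine (cflux P s i (G i)) + (g n - t).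
Proof.
move=> bs; have := cflux_le F_cont F_inc i bs mA (mG i) (@subAG i).
have := g_le (ltnW (ltn_ord i)); have EG := muD mA (mG i) (@subAG i).
have E1 := fineK (cflux_fin i bs mA); have E2 := fineK (cflux_fin i bs (mG i)).
rewrite -{1}E1 -{1}E2 EG -EFinD lee_fin => gi; move/le_trans; apply.
by rewrite lerD2l lerD2r.
Qed.

Let fiber_enlarge (i : 'I_n) x z w : fiber (G i) i x z -> `|w - z| < r -> fiber (G i.+1) i x w.
Proof.
move=> Gz wz; rewrite /fiber/= -(upd_upd i x z w); apply: staircase_upd => //.
by rewrite updE eqxx.
Qed.

Let p_stair (i : 'I_n) : r * fine (cflux P idp i (G i)) <=
  (r + C0 / m%:R `^ (1 - rho^-1)) * (g i.+1 - g i).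
Proof.
have K0 : 0 <= r + C0 / m%:R `^ (1 - rho^-1).
  by rewrite addr_ge0 ?(ltW r0)// divr_ge0 ?powR_ge0// ltW// isoperimetric_const_gt0.
have sub : G i `<=` G i.+1 by exact: staircaseS.
rewrite -lee_fin !EFinM fineK ?cflux_fin// -muD//.
have mD : measurable (G i.+1 `\` G i) by exact: measurableD.
have mf := measurable_flux_fiber F_cont idp i (mG i).
have mPD : measurable_fun setT (fun x => P (fiber (G i.+1 `\` G i) i x)).
  by have := measurable_fun_fiber P i mD measurableT; under eq_fun do rewrite setIT.
rewrite -(power_prob_fiber P i mD) /cflux -!ge0_integralZl ?lee_fin//;
  [|by move=> x _; exact: flux_ge0|exact: ltW].
  apply: ge0_le_integral => //.
  - by move=> x _; rewrite mule_ge0 ?flux_ge0 ?lee_fin// ltW.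
  - exact: measurable_funeM.
  - exact: measurable_funeM.
  move=> x _; apply: flux_id_enlargement => //.
  - exact: measurable_fiber.
  - exact: measurable_fiber.
  - by move=> y; exact: sub.
  - by move=> y z; exact: fiber_enlarge.
Qed.

Let q_stair (i : 'I_n) : r * (\sum_(j < m) fine (cflux P (flip j) i (G i))) <=
  (r * m%:R + C0 * m%:R `^ (rho^-1)) * (g i.+1 - g i).
Proof.
have K0 : 0 <= r * m%:R + C0 * m%:R `^ (rho^-1).
  have C00 := isoperimetric_const_gt0 rho_gt1.
  by apply: addr_ge0; apply: mulr_ge0; rewrite ?powR_ge0 ?(ltW r0) ?(ltW C00).
have sub : G i `<=` G i.+1 by exact: staircaseS.
rewrite -lee_fin EFinM -sumEFin.
under eq_bigr do rewrite fineK ?cflux_fin//.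
rewrite EFinM -muD//.
have mD : measurable (G i.+1 `\` G i) by exact: measurableD.
have mf j := measurable_flux_fiber F_cont (flip (I := 'I_m) j) i (mG i).
have mPD : measurable_fun setT (fun x => P (fiber (G i.+1 `\` G i) i x)).
  by have := measurable_fun_fiber P i mD measurableT; under eq_fun do rewrite setIT.
rewrite -(power_prob_fiber P i mD) /cflux -ge0_integral_sum//; last first.
  by move=> j x _; exact: flux_ge0.
rewrite -!ge0_integralZl ?lee_fin//; last 3 first.
- exact: emeasurable_sum.
- by move=> x _; rewrite sume_ge0// => j _; exact: flux_ge0.
- exact: ltW.
apply: ge0_le_integral => //.
- by move=> x _; rewrite mule_ge0 ?lee_fin ?(ltW r0)// sume_ge0// => j _; exact: flux_ge0.
- by apply: measurable_funeM; exact: emeasurable_sum.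
- exact: measurable_funeM.
move=> x _; apply: flux_flip_enlargement => //.
- exact: measurable_fiber.
- exact: measurable_fiber.
- by move=> y; exact: sub.
- by move=> y z; exact: fiber_enlarge.
Qed.

Let eta : R := g n - t.

Let telescope (K : R) : 0 <= K -> \sum_(i < n) K * (g i.+1 - g i) <= K * eta.
Proof.
move=> K0; rewrite -mulr_sumr ler_wpM2l//.
rewrite -(big_mkord predT (fun i => g i.+1 - g i)) telescope_sumr//.
by rewrite /eta lerD2l lerN2; exact: t_le.
Qed.

(** Since [m ^ (1 / rho) = m / m ^ (1 - 1 / rho)], the digit flips, divided by [m], cost the same as
    the resamplings; hence [417 = 1 + 416]. In [n.+1], the [n] comes from replacing each [G i] by
    [A] and the 1 from the telescoping sum. *)
Lemma enlargement_variance : r * (t * (1 - t)) <=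
  (417 * (n.+1%:R * r) + 417 * (C0 / m%:R `^ (1 - rho^-1))) * eta.
Proof.
have C00 : 0 < C0 by exact: isoperimetric_const_gt0.
have mR : 0 < m%:R :> R by rewrite ltr0n.
have eta0 : 0 <= eta by rewrite subr_ge0 t_le.
have K1 : 0 <= r + C0 / m%:R `^ (1 - rho^-1).
  by rewrite addr_ge0 ?(ltW r0)// divr_ge0 ?powR_ge0// ltW.
have K2 : 0 <= r * m%:R + C0 * m%:R `^ (rho^-1).
  by apply: addr_ge0; apply: mulr_ge0; rewrite ?powR_ge0 ?(ltW r0) ?(ltW C00).
have sumc (k : nat) (x : R) : k%:R * x = \sum_(i < k) x.
  by rewrite sumr_const card_ord mulr_natl.
have sp : r * \sum_i p i <= (r + C0 / m%:R `^ (1 - rho^-1)) * eta + n%:R * (r * eta).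
  apply: le_trans (lerD (telescope K1) (lexx _)).
  rewrite (sumc n) -big_split/= mulr_sumr.
  apply: ler_sum => i _; apply: le_trans (lerD (p_stair i) (lexx _)).
  by rewrite -mulrDr ler_wpM2l ?(ltW r0)// cflux_A.
have sq : r * \sum_i \sum_j q i j <=
    (r * m%:R + C0 * m%:R `^ (rho^-1)) * eta + n%:R * (r * (m%:R * eta)).
  apply: le_trans (lerD (telescope K2) (lexx _)).
  rewrite (sumc n) -big_split/= mulr_sumr.
  apply: ler_sum => i _; apply: le_trans (lerD (q_stair i) (lexx _)).
  rewrite -mulrDr ler_wpM2l ?(ltW r0)//.
  rewrite (sumc m) -big_split/=.
  by apply: ler_sum => j _; exact: cflux_A.
have pw : m%:R `^ rho^-1 = m%:R / m%:R `^ (1 - rho^-1) :> R.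
  rewrite -{2}[m%:R]powRr1 ?(ltW mR)// -powRB; last by rewrite (gt_eqF mR) implybT.
  by rewrite opprB addrCA subrr addr0.
have := variance_le_cflux; move: sp sq; rewrite pw.
have M0 : 0 < m%:R `^ (1 - rho^-1) :> R by exact: powR_gt0.
move: (\sum_i p i) (\sum_i \sum_j q i j) (t * (1 - t)) (m%:R `^ (1 - rho^-1)) M0
  => Sp Sq v M M0 sp sq var.
have K0 : 0 <= 416 / m%:R :> R by apply: divr_ge0; [exact: ler0n|exact: ltW].
have h1 : r * v <= r * Sp + 416 / m%:R * (r * Sq).
  by rewrite mulrCA -mulrDr ler_wpM2l// ltW.
apply: (le_trans h1).
apply: (le_trans (lerD sp (ler_wpM2l K0 sq))).
rewrite le_eqVlt; apply/orP; left; apply/eqP; rewrite -natr1.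
by field; rewrite (gt_eqF mR) (gt_eqF M0).
Qed.

End enlargement.

Lemma boltzmann_isoperimetry s : 0 < s < 2 * (C0 / m%:R `^ (1 - rho^-1) / n.+1%:R) ->
  ((t * (1 - t) * m%:R `^ (1 - rho^-1) / (1668 * C0))%:E <=
   (mu^*%mu (minkowski_sum A (cube s)) - mu A) / s%:E)%E.
Proof.
(* The staircase ends inside the sum with the cube of size [2 * r = s]. The bound on [s] makes
   [n.+1 * r] at most the main term, hence [834 = 2 * 417], and [r = s / 2] doubles it to 1668. *)
move=> /andP[s0 s1]; pose r := s / 2; have r0 : 0 < r by rewrite divr_gt0.
have C00 : 0 < C0 by exact: isoperimetric_const_gt0.
have mR : 0 < m%:R :> R by rewrite ltr0n.
have M0 : 0 < m%:R `^ (1 - rho^-1) :> R by exact: powR_gt0.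
have nR : 0 < n.+1%:R :> R by rewrite ltr0n.
have rn : n.+1%:R * r <= C0 / m%:R `^ (1 - rho^-1).
  by rewrite mulrC -ler_pdivlMr// ler_pdivrMr// mulrC ltW.
have := enlargement_variance r0.
set e := fine (mu (staircase A r n)) - t; set X := C0 / _ in rn s1 * => ev.
have mG : measurable (staircase A r n) by exact: measurable_staircase.
have muGE : (mu (staircase A r n) - mu A)%E = e%:E.
  by rewrite /e EFinB !fineK// fin_num_measure.
apply: (@le_trans _ _ ((mu (staircase A r n) - mu A) / s%:E)%E).
  rewrite muGE inver gt_eqF// -EFinM lee_fin ler_pdivlMr//.
  have e0 : 0 <= e.
    rewrite -lee_fin -muGE sube_ge0 ?fin_num_measure//.
    rewrite le_measure ?inE//; apply: subset_trans (staircase0 r0) _.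
    exact: staircaseS.
  have X0 : 0 < 834 * X by apply: mulr_gt0; [exact: ltr0n|exact: divr_gt0].
  have h : r * (t * (1 - t)) <= e * (834 * X).
    by apply: (le_trans ev); rewrite mulrC ler_wpM2l//; lra.
  have -> : t * (1 - t) * m%:R `^ (1 - rho^-1) / (1668 * C0) * s =
      r * (t * (1 - t)) / (834 * X) by rewrite /r /X; field; rewrite !gt_eqF.
  by rewrite (ler_pdivrMr _ _ X0).
rewrite lee_wpmul2r ?inver ?gt_eqF ?lee_fin ?invr_ge0 ?(ltW s0)//.
apply: leeB => //; rewrite -(measurable_mu_extE mu mG).
apply: le_mu_ext; have -> : s = 2 * r by rewrite /r; field.
exact: staircase_minkowski.
Qed.

End boltzmann_isoperimetry.

Theorem theorem4p1 (R : realType) (rho : R) (rho_gt1 : 1 < rho) :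
  exists2 c : R, 0 < c &
    forall (n : nat) (A : set 'rV[R]_n), (1 <= n)%N ->
      measurable A -> transitive_set A ->
      let mu := power_prob (boltzmann (ltW rho_gt1)) n in
      let t := fine (mu A) in
      ((c * (t * (1 - t)) * ln n%:R `^ (1 - rho^-1))%:E <=
       limf_einf (fun r : R => (mu^*%mu (minkowski_sum A (cube r)) - mu A) / r%:E)
         0%R^'+)%E.
Proof.
have C00 := isoperimetric_const_gt0 rho_gt1.
set C0 := isoperimetric_const rho in C00.
(* [3336 = 2 * 1668], where 2 is the loss from replacing [m] by the logarithm of [n]. *)
have c0 : 0 < (3336 * C0)^-1.
  by rewrite invr_gt0; apply: mulr_gt0 C00; exact: ltr0n.
exists (3336 * C0)^-1 => //.
move=> n A n1 mA trA; cbv zeta.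
set mu := power_prob _ n; set t := fine (mu A).
have rho0 : 0 < rho := lt_trans ltr01 rho_gt1.
have a0 : 0 < 1 - rho^-1 by rewrite subr_gt0 invf_lt1.
have a1 : 1 - rho^-1 <= 1 by rewrite gerBl invr_ge0 ltW.
(* For [n = 1] no positive [m] satisfies [2 ^ m <= n], but the logarithm vanishes and its exponent
   is positive, so the quotient only has to be nonnegative. *)
have [n2|n2] := leqP 2 n; last first.
  have n_1 : n = 1%N by apply/eqP; rewrite eqn_leq n1 -ltnS n2.
  have -> : ln n%:R = 0 :> R by rewrite n_1 ln1.
  rewrite powR0 ?gt_eqF// mulr0; apply: (@le_limf_einf _ _ _ 1) => // s /andP[s0 _].
  rewrite inver gt_eqF// mule_ge0 ?lee_fin ?invr_ge0 ?(ltW s0)//.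
  rewrite sube_ge0 ?fin_num_measure// -(measurable_mu_extE mu mA).
  apply: le_mu_ext => x Ax; exists x => //; exists 0; last by rewrite addr0.
  by move=> i; rewrite mxE in_itv/= oppr_le0 (ltW s0).
pose m := trunc_log 2 n.
have m0 : (0 < m)%N by rewrite trunc_log_gt0.
have mn : (2 ^ m <= n)%N by rewrite trunc_logP.
have mR : 0 < m%:R :> R by rewrite ltr0n.
have M0 : 0 < m%:R `^ (1 - rho^-1) :> R by exact: powR_gt0.
apply: (@le_limf_einf _ _ _ (2 * (C0 / m%:R `^ (1 - rho^-1) / n.+1%:R))).
  by apply: mulr_gt0 => //; apply: divr_gt0; [exact: divr_gt0|rewrite ltr0n].
move=> s ss; apply: le_trans (boltzmann_isoperimetry rho_gt1 m0 mn mA trA ss).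
rewrite lee_fin.
have t01 : 0 <= t * (1 - t).
  have tle : t <= 1 by rewrite -lee_fin fineK ?fin_num_measure// probability_le1.
  by rewrite mulr_ge0 ?subr_ge0// fine_ge0.
(* From [n < 2 ^ m.+1] and [ln 2 <= 1] comes [m.+1], at most [2 * m] because [m] is positive. *)
have lnm : ln n%:R <= 2 * m%:R :> R.
  have nm : (n < 2 ^ m.+1)%N by rewrite trunc_log_ltn.
  have nR : 0 < n%:R :> R by rewrite ltr0n.
  apply: (@le_trans _ _ (ln (2 ^+ m.+1))).
    by rewrite ler_ln ?posrE ?exprn_gt0// -natrX ler_nat ltnW.
  have l2 : ln 2 <= 1 :> R by apply: (@le_ln1Dx R 1); lra.
  rewrite lnXn//; apply: le_trans (ler_wMn2r m.+1 l2) _.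
  by rewrite -natrM ler_nat mul2n -addnn -addn1 leq_add2l.
have ln0 : 0 <= ln n%:R :> R by rewrite ln_ge0// ler1n.
have lnM : ln n%:R `^ (1 - rho^-1) <= 2 * m%:R `^ (1 - rho^-1).
  apply: (@le_trans _ _ ((2 * m%:R) `^ (1 - rho^-1))).
    by apply: ge0_ler_powR; rewrite ?nnegrE ?mulr_ge0// ltW.
  rewrite powRM// ler_wpM2r ?powR_ge0//.
  by apply: ler1_powR => //; lra.
have := ler_wpM2l t01 lnM => h.
have -> : t * (1 - t) * m%:R `^ (1 - rho^-1) / (1668 * C0) =
  (3336 * C0)^-1 * (t * (1 - t) * (2 * m%:R `^ (1 - rho^-1))) by field; rewrite gt_eqF.
by rewrite -mulrA; apply: (ler_wpM2l (ltW c0)).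
Qed.
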